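(* The isomorphism problem for plain groups presented by inverse-closed finite convergent length-reducing rewriting systems is decidable in $\mathsf{PSPACE}$. That is, there is an algorithm which, on input two inverse-closed finite convergent length-reducing rewriting systems $(\Sigma,T)$ and $(\Sigma',T')$, each of which presents a plain group, decides whether the two presented groups are isomorphic, using space polynomial in the size of the input.
   Context: A group is plain if it is isomorphic to a free product of finitely many finite groups and finitely many copies of $\mathbb{Z}$. A length-reducing rewriting system is a pair $(\Sigma,T)$ with $\Sigma$ a non-empty finite alphabet and $T\subseteq \Sigma^*\times\Sigma^*$ such that $|\ell|_\Sigma>|r|_\Sigma$ for all $(\ell,r)\in T$, where $|\cdot|_\Sigma$ is word length and $\lambda$ is the empty word. Write $u\ell v\to urv$ for $u,v\in\Sigma^*$, $(\ell,r)\in T$; $\overset{*}{\to}$ is the reflexive transitive closure and $\overset{*}{\leftrightarrow}$ the reflexive, transitive and symmetric closure. The system is finite if $T$ is finite, convergent if it is terminating (automatic here) and confluent (whenever $w\overset{*}{\to}x$ and $w\overset{*}{\to}y$ there is $z$ with $x\overset{*}{\to}z$ and $y\overset{*}{\to}z$), and inverse-closed if for every $a\in\Sigma$ there is $b\in\Sigma$ with $ab\overset{*}{\to}\lambda$. The group presented by $(\Sigma,T)$ is $M(\Sigma,T)=\Sigma^*/\overset{*}{\leftrightarrow}$, which is a group when the system is inverse-closed. The size of $(\Sigma,T)$ is $n_T=|\Sigma|+\sum_{(\ell,r)\in T}|\ell r|_\Sigma$; the input size for the problem is measured by $\max\{n_T,n_{T'}\}$. Inputs are promised to present plain groups. *)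

(* Defs.v *)
From HB Require Import structures.
From mathcomp Require Import all_boot all_order all_fingroup all_algebra.
From mathcomp Require Import boolp.
From Stdlib Require Import Relations.

Set Implicit Arguments.
Unset Strict Implicit.
Unset Printing Implicit Defensive.

Local Open Scope nat_scope.

Section Rewriting.
Variables (X : Type) (R : seq X -> seq X -> Prop).

Inductive rewrite_step : seq X -> seq X -> Prop :=
  RewriteStep u l r v of R l r : rewrite_step (u ++ l ++ v) (u ++ r ++ v).

Definition rewrites : seq X -> seq X -> Prop :=
  clos_refl_trans (seq X) rewrite_step.

Definition convertible : seq X -> seq X -> Prop :=
  clos_refl_sym_trans (seq X) rewrite_step.

Definition terminating := well_founded (fun v u => rewrite_step u v).

Definition confluent := forall w x y, rewrites w x -> rewrites w y ->
  exists2 z, rewrites x z & rewrites y z.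

Definition convergent := terminating /\ confluent.

Definition inverse_closed := forall a, exists b, rewrites [:: a; b] [::].

Definition right_invertible := forall a, exists b, convertible [:: a; b] [::].

Lemma inverse_closed_right_invertible : inverse_closed -> right_invertible.
Proof. by move=> H a; have [b ab] := H a; exists b; apply: clos_rt_clos_rst. Qed.

Lemma convertible_catl w u v : convertible u v -> convertible (w ++ u) (w ++ v).
Proof.
elim=> {u v} [_ _ [u l r v lr]|u|u v _ |u x v _ + _].
- by apply: rst_step; rewrite !(catA w u); constructor.
- exact: rst_refl.
- exact: rst_sym.
- exact: rst_trans.
Qed.

Lemma convertible_catr w u v : convertible u v -> convertible (u ++ w) (v ++ w).
Proof.
elim=> {u v} [_ _ [u l r v lr]|u|u v _ |u x v _ + _].
- by apply: rst_step; rewrite -!catA; constructor.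
- exact: rst_refl.
- exact: rst_sym.
- exact: rst_trans.
Qed.

Lemma convertible_cat u u' v v' :
  convertible u u' -> convertible v v' -> convertible (u ++ v) (u' ++ v').
Proof.
move=> uu' vv'; apply: (rst_trans _ _ _ (u' ++ v)).
  exact: convertible_catr.
exact: convertible_catl.
Qed.

Lemma right_invertible_word :
  right_invertible -> forall u, exists v, convertible (u ++ v) [::].
Proof.
move=> H; elim=> [|a u [v uv]]; first by exists [::]; apply: rst_refl.
have [b ab] := H a; exists (v ++ [:: b]).
apply: (rst_trans _ _ _ [:: a; b]) => //; rewrite catA.
exact: (convertible_catl [:: a] (convertible_catr [:: b] uv)).
Qed.

End Rewriting.

Section PresentedMonoid.
Variables (X : choiceType) (R : seq X -> seq X -> Prop).
Local Open Scope quotient_scope.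

Definition convertibleb (u v : seq X) : bool := `[< convertible R u v >].

Lemma convertibleb_equiv : equiv_class_of convertibleb.
Proof.
split=> [u|u v|v u w].
- by apply/asboolP/rst_refl.
- by apply/asboolP/asboolP => uv; apply: rst_sym.
- by move=> /asboolP uv /asboolP vw; apply/asboolP; apply: rst_trans uv vw.
Qed.

Canonical convertibleb_equivRel := EquivRelPack convertibleb_equiv.

Definition presented_monoid := {eq_quot convertibleb}.
HB.instance Definition _ := EqQuotient.on presented_monoid.
HB.instance Definition _ := Choice.on presented_monoid.

Definition word_class (u : seq X) : presented_monoid := \pi u.

Lemma word_classP u v : word_class u = word_class v <-> convertible R u v.
Proof.
split=> [/eqP|uv]; first by rewrite eqmodE => /asboolP.
by apply/eqP; rewrite eqmodE; apply/asboolP.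
Qed.

Definition word_repr (x : presented_monoid) : seq X := generic_quotient.repr x.

Lemma word_class_repr (x : presented_monoid) : word_class (word_repr x) = x.
Proof. exact: reprK. Qed.

Definition pm_mul (x y : presented_monoid) := word_class (word_repr x ++ word_repr y).
Definition pm_one := word_class [::].

Lemma pm_mulE u v : pm_mul (word_class u) (word_class v) = word_class (u ++ v).
Proof.
by apply/word_classP/convertible_cat; apply/word_classP/word_class_repr.
Qed.

Lemma pm_mulA : associative pm_mul.
Proof.
move=> x y z; rewrite -(word_class_repr x) -(word_class_repr y).
by rewrite -(word_class_repr z) !pm_mulE catA.
Qed.

Lemma pm_mul1 : left_id pm_one pm_mul.
Proof. by move=> x; rewrite -(word_class_repr x) pm_mulE. Qed.

Lemma pm_mulr1 : right_id pm_one pm_mul.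
Proof. by move=> x; rewrite -(word_class_repr x) pm_mulE cats0. Qed.

HB.instance Definition _ :=
  isMonoid.Build presented_monoid pm_mulA pm_mul1 pm_mulr1.

End PresentedMonoid.

Section PresentedGroup.
Variables (X : choiceType) (R : seq X -> seq X -> Prop).
Hypothesis invR : right_invertible R.
Local Open Scope group_scope.

Definition presented_group of right_invertible R := presented_monoid R.
Local Notation G := (presented_group invR).
HB.instance Definition _ := monoid.Monoid.on G.

Lemma pg_right_inverse (x : G) : exists y : G, x * y == 1.
Proof.
have [v uv] := right_invertible_word invR (word_repr (x : presented_monoid R)).
exists (word_class R v); apply/eqP.
have -> : x = word_class R (word_repr (x : presented_monoid R)).
  by rewrite word_class_repr.
by rewrite [LHS]pm_mulE; apply/word_classP.
Qed.

Definition pg_inv (x : G) : G := xchoose (pg_right_inverse x).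

Lemma pg_mulV : right_inverse 1 pg_inv (@monoid.mul G).
Proof. by move=> x; apply/eqP/(xchooseP (pg_right_inverse x)). Qed.

Lemma pg_Vmul : left_inverse 1 pg_inv (@monoid.mul G).
Proof.
move=> x; rewrite -[LHS]mulg1 -[in LHS](pg_mulV (pg_inv x)) mulgA.
by rewrite -(mulgA (pg_inv x)) pg_mulV mulg1 pg_mulV.
Qed.

HB.instance Definition _ := hasInv.Build G pg_inv.
HB.instance Definition _ := Monoid_isGroup.Build G pg_Vmul pg_mulV.

End PresentedGroup.

Definition isomorphic (G H : groupType) : Prop :=
  exists f : {multiplicative G -> H}, bijective f.

Section FreeProduct.
Variables (I : choiceType) (F : I -> groupType).
Local Open Scope group_scope.

(* The free product is presented by the disjoint union of the factors and
   their multiplication tables. *)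
Inductive free_product_rule : seq {i & F i} -> seq {i & F i} -> Prop :=
| FreeProductOne i :
    free_product_rule [:: Tagged F (1 : F i)] [::]
| FreeProductMul i (g h : F i) :
    free_product_rule [:: Tagged F g; Tagged F h] [:: Tagged F (g * h)].

Lemma free_product_right_invertible : right_invertible free_product_rule.
Proof.
case=> i g; exists (Tagged F g^-1).
have mul := RewriteStep [::] [::] (FreeProductMul g g^-1).
have one := RewriteStep [::] [::] (FreeProductOne i).
rewrite mulgV in mul.
exact: rst_trans (rst_step _ _ _ _ mul) (rst_step _ _ _ _ one).
Qed.

Definition free_product : groupType :=
  presented_group free_product_right_invertible.

End FreeProduct.

Definition plain_factor k m (H : 'I_k -> finGroupType) (i : 'I_k + 'I_m) :
    groupType :=
  match i with
  | inl j => H j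
  | inr _ => Algebra.to_multiplicative int
  end.

Definition plain (G : groupType) : Prop :=
  exists k m (H : 'I_k -> finGroupType),
    isomorphic G (free_product (@plain_factor k m H)).

(* The list [rules] enumerates the finite set of rules, in an arbitrary order. *)
Record lr_system := LRSystem {
  letter : finType;
  rules : seq (seq letter * seq letter);
  letter_gt0 : 0 < #|letter|;
  rules_uniq : uniq rules;
  rules_reducing : forall lr, lr \in rules -> size lr.2 < size lr.1
}.

Definition rule_rel (S : lr_system) (l r : seq (letter S)) : Prop :=
  (l, r) \in rules S.

(* Inverse-closed, finite, convergent and length-reducing systems. *)
Record icfclr_system := ICFCLRSystem {
  system :> lr_system;
  system_convergent : convergent (@rule_rel system);
  system_inverse_closed : inverse_closed (@rule_rel system)
}.

Definition presented_by (S : icfclr_system) : groupType :=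
  presented_group (inverse_closed_right_invertible (@system_inverse_closed S)).

Definition system_size (S : lr_system) : nat :=
  #|letter S| + \sum_(lr <- rules S) size (lr.1 ++ lr.2).

Inductive move := MoveLeft | Stay | MoveRight.

(* A symbol is the blank [None], an input symbol or a work symbol. *)
Record turing_machine (A : finType) := TuringMachine {
  ntapes : nat;
  state : finType;
  work_symbol : finType;
  start : state;
  verdict : state -> option bool;
  transition :
    state -> {ffun 'I_ntapes.+1 -> option (A + work_symbol)} ->
    state * ('I_ntapes.+1 -> option (A + work_symbol) * move)
}.

Section TuringMachine.
Variables (A : finType) (M : turing_machine A).
Let symbol := option (A + work_symbol M).

(* The visited cells of a two-way infinite tape: those left of the head
   (nearest first), the scanned one, and those right of the head. They are
   never discarded, so that their number is the space used so far. *)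
Record tape := Tape {
  left_of_head : seq symbol;
  scanned : symbol;
  right_of_head : seq symbol
}.

Definition blank_tape := Tape [::] None [::].

Definition input_tape (w : seq A) : tape :=
  if w is a :: w' then Tape [::] (Some (inl a)) [seq Some (inl b) | b <- w']
  else blank_tape.

Definition write_move (am : symbol * move) (t : tape) : tape :=
  let: (a, m) := am in
  let: Tape l _ r := t in
  match m with
  | Stay => Tape l a r
  | MoveLeft => Tape (behead l) (head None l) (a :: r)
  | MoveRight => Tape (a :: l) (head None r) (behead r)
  end.

Definition config : Type := state M * ('I_(ntapes M).+1 -> tape).

Definition init (w : seq A) : config :=
  (start M, fun i => if i == ord0 then input_tape w else blank_tape).

Definition step (c : config) : config :=
  let: (q, ts) := c in
  if verdict q is Some _ then c else
  let: (q', act) := transition q [ffun i => scanned (ts i)] in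
  (q', fun i => write_move (act i) (ts i)).

Definition run (w : seq A) (n : nat) : config := iter n step (init w).

Definition tape_space (t : tape) : nat :=
  (size (left_of_head t) + size (right_of_head t)).+1.

Definition space (c : config) : nat := \sum_i tape_space (c.2 i).

(* The machine halts with the right answer; cells holding the input count. *)
Definition decides_in_space (w : seq A) (P : Prop) (s : nat) : Prop :=
  (exists n b, verdict (run w n).1 = Some b /\ (b <-> P)) /\
  (forall n, space (run w n) <= s).

End TuringMachine.

Inductive token := Tick | EndNumber | EndWord | EndSystem.

Definition token_code (t : token) : 'I_4 :=
  match t with
  | Tick => inord 0 | EndNumber => inord 1
  | EndWord => inord 2 | EndSystem => inord 3
  end.

Definition token_decode (i : 'I_4) : token :=
  match val i with
  | 0 => Tick | 1 => EndNumber | 2 => EndWord | _ => EndSystem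
  end.

Lemma token_codeK : cancel token_code token_decode.
Proof. by case; rewrite /token_decode /= inordK. Qed.

HB.instance Definition _ := Finite.copy token (can_type token_codeK).

(* Letters are written in unary, by their position in the alphabet. As the
   alphabet contributes its cardinality to [system_size], the encoding is
   polynomially bounded in [system_size], as would be a binary one. *)
Definition encode_number (n : nat) : seq token := rcons (nseq n Tick) EndNumber.

Definition encode_word (X : finType) (w : seq X) : seq token :=
  rcons (flatten [seq encode_number (enum_rank a) | a <- w]) EndWord.

Definition encode_system (S : lr_system) : seq token :=
  encode_number #|letter S| ++
  rcons (flatten [seq encode_word lr.1 ++ encode_word lr.2 | lr <- rules S])
    EndSystem.

(* Main.v *)
(* The rewriting system selects a unique geodesic for every element g of the
   group, and the geodesics to g and to ga, for a letter a, branch only near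
   their ends. Hence a finite subgroup is conjugate into the ball of a radius K
   linear in the size of the system, and conjugate tuples generating nontrivial
   finite subgroups inside a ball are conjugate by an element whose length is
   polynomial: an element moving both ends of a long geodesic a little shifts
   the middle, which a nontrivial torsion element cannot do.

   In a free product of finite groups H_i and copies of Z, let e(G) be the
   number of conjugacy classes of tuples satisfying the same relations as a
   given tuple t generating a finite group A. Then e(G) is the sum of the e(H_i).
   Starting with factors of maximal order, these numbers determine the
   nontrivial H_i, and the number of homomorphisms to Z/2 then determines the
   number of copies of Z. By the cube lemma of Babai and Erdos, 2r elements
   generate a group of order at most 2^r by words of length at most 2r, so it is
   enough to consider tuples of polynomial size.

   Coding words and tuples as numbers below 2^poly turns the comparison of these
   invariants into an arithmetic expression whose recursions are truncated at
   such a bound; it is evaluated in polynomial space by a machine whose tapes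
   hold registers. *)
Require Import Defs.
From HB Require Import structures.
From mathcomp Require Import all_boot all_order all_fingroup all_algebra.
From mathcomp Require Import boolp zify.
From Stdlib Require Import Relations.

Set Implicit Arguments.
Unset Strict Implicit.
Unset Printing Implicit Defensive.

Local Open Scope nat_scope.

(** * Tape programs *)

(** The factors of the groups are never computed: plainness enters only the proof that the compared
    numbers decide isomorphism. This is why [e] is attached to tuples rather than subgroups:
    equality of relations and conjugacy of tuples can be tested on words of bounded length.
    Additivity needs nontrivial tuples: a nontrivial finite subgroup fixes exactly one vertex of the
    Bass-Serre tree, whereas the trivial tuple lies in every factor. Maximal order is the place to
    start because an embedding of a factor of maximal order into another factor is an isomorphism;
    the matched pair then cancels from all sums. Homomorphisms to Z/2 multiply over the factors,
    each Z contributing 2, so after the matching only the power of 2 is left to compare. The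
    searches run through exponentially many numbers without nondeterminism: the loops are slow but
    store only their counters. One expression serves all inputs, hence a fixed number of registers;
    its values are polynomial in those of its variables, hence registers of polynomial length. *)

Section TapePrograms.
Variables (A W : finType) (k : nat).

Let symbol := option (A + W).
Let scan := {ffun 'I_k.+1 -> symbol}.
Let action := 'I_k.+1 -> symbol * move.

Inductive tape_program :=
| Act of scan -> action
| Seq of tape_program & tape_program
| While of (scan -> bool) & tape_program
| If of (scan -> bool) & tape_program.

(** [None] is the control point at which a [While] or an [If] evaluates its test, in one idle step
    of its own. The type is finite by construction, so it can be part of the state set of a
    machine. *)
Fixpoint pc (p : tape_program) : finType :=
  match p with
  | Act _ => unit
  | Seq a b => (pc a + pc b)%type
  | While _ a => option (pc a)
  | If _ a => option (pc a)
  end.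

Fixpoint entry (p : tape_program) : pc p :=
  match p with
  | Act _ => tt
  | Seq a _ => inl (entry a)
  | While _ _ => None
  | If _ _ => None
  end.

Definition idle (s : scan) : action := fun i => (s i, Stay).

Fixpoint next (p : tape_program) : pc p -> scan -> option (pc p) * action :=
  match p with
  | Act f => fun _ s => (None, f s)
  | Seq a b => fun x s =>
      match x with
      | inl x => let: (y, act) := next x s in
          (Some (if y is Some y then inl y else inr (entry b)), act)
      | inr x => let: (y, act) := next x s in (omap inr y, act)
      end
  | While t a => fun x s =>
      match x with
      | None => (if t s then Some (Some (entry a)) else None, idle s)
      | Some x => let: (y, act) := next x s in (Some y, act)
      end
  | If t a => fun x s =>
      match x with
      | None => (if t s then Some (Some (entry a)) else None, idle s)
      | Some x => let: (y, act) := next x s in (omap Some y, act)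
      end
  end.

Variable halting : scan -> bool.

(** The end of the program, [inl None], is not yet halting: one further step reads the verdict off
    the scanned symbols. *)
Definition machine (p : tape_program) : turing_machine A :=
  @TuringMachine A k (option (pc p) + bool)%type W (inl (Some (entry p)))
    (fun q => if q is inr b then Some b else None)
    (fun q s => match q with
       | inl (Some x) => let: (y, act) := next x s in (inl y, act)
       | inl None => (inr (halting s), idle s)
       | inr b => (inr b, idle s)
       end).

(* The type of tapes of a machine depends on the machine; this copy does
   not, so that programs can be composed. *)
Record band := Band {
  before : seq symbol;
  cell : symbol;
  after : seq symbol
}.

Definition act_on (am : symbol * move) (t : band) : band :=
  let: (a, m) := am in
  let: Band l _ r := t in
  match m with
  | Stay => Band l a r
  | MoveLeft => Band (behead l) (head None l) (a :: r)
  | MoveRight => Band (a :: l) (head None r) (behead r)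
  end.

Definition bands := 'I_k.+1 -> band.
Definition cells (ts : bands) : scan := [ffun i => cell (ts i)].
Definition act_all (act : action) (ts : bands) : bands :=
  fun i => act_on (act i) (ts i).
Definition band_space (t : band) := (size (before t) + size (after t)).+1.

Lemma act_all_idle ts : act_all (idle (cells ts)) ts = ts.
Proof. by apply: funext => i; rewrite /act_all /idle ffunE; case: (ts i). Qed.

Variable Inv : bands -> Prop.

(** [Inv] is demanded at every visited configuration, not only at the two ends, so that space bounds
    compose together with the runs. *)
Inductive steps (p : tape_program) :
    option (pc p) -> bands -> option (pc p) -> bands -> Prop :=
| StepsRefl x ts of Inv ts : steps x ts x ts
| StepsNext x ts y ts' of Inv ts :
    steps (next x (cells ts)).1 (act_all (next x (cells ts)).2 ts) y ts' ->
    steps (Some x) ts y ts'.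

Definition runs (p : tape_program) (ts ts' : bands) : Prop :=
  steps (Some (entry p)) ts None ts'.

Lemma steps_trans p (x y z : option (pc p)) ts1 ts2 ts3 :
  steps x ts1 y ts2 -> steps y ts2 z ts3 -> steps x ts1 z ts3.
Proof.
by move=> xy; elim: xy z ts3 => // {}x t {}y u it _ IH z v /IH; exact: StepsNext.
Qed.

Lemma runs_act f ts : Inv ts -> Inv (act_all (f (cells ts)) ts) ->
  runs (Act f) ts (act_all (f (cells ts)) ts).
Proof. by move=> i1 i2; apply: StepsNext => //=; apply: StepsRefl. Qed.

Lemma steps_start p x ts y ts' : @steps p x ts y ts' -> Inv ts.
Proof. by case. Qed.

Lemma steps_end p x ts y ts' : @steps p x ts y ts' -> Inv ts'.
Proof. by elim. Qed.

Lemma runs_seq a b ts1 ts2 ts3 :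
  runs a ts1 ts2 -> runs b ts2 ts3 -> runs (Seq a b) ts1 ts3.
Proof.
move=> ra rb.
have lift_b x t y t' : @steps b x t y t' ->
    @steps (Seq a b) (omap inr x) t (omap inr y) t'.
  elim=> {x t y t'} [x t it|x t y t' it _ IH]; first exact: StepsRefl.
  by apply: StepsNext => //=; case: (next _ _) IH.
have lift_a x t y t' : @steps a x t y t' ->
    @steps (Seq a b) (Some (if x is Some x then inl x else inr (entry b))) t
      (Some (if y is Some y then inl y else inr (entry b))) t'.
  elim=> {x t y t'} [x t it|x t y t' it _ IH]; first exact: StepsRefl.
  by apply: StepsNext => //=; case: (next _ _) IH.
exact: steps_trans (lift_a _ _ _ _ ra) (lift_b _ _ _ _ rb).
Qed.

Lemma runs_while_done (t : scan -> bool) a ts : Inv ts -> t (cells ts) = false ->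
  runs (While t a) ts ts.
Proof.
move=> its tF; apply: StepsNext => //=.
by rewrite tF act_all_idle; apply: StepsRefl.
Qed.

Lemma runs_while (t : scan -> bool) a ts1 ts2 ts3 : t (cells ts1) ->
  runs a ts1 ts2 -> runs (While t a) ts2 ts3 -> runs (While t a) ts1 ts3.
Proof.
move=> tT ra rb.
have lift x u y v : @steps a x u y v ->
    @steps (While t a) (Some x) u (Some y) v.
  elim=> {x u y v} [x u iu|x u y v iu _ IH]; first exact: StepsRefl.
  by apply: StepsNext => //=; case: (next _ _) IH.
apply: StepsNext; first exact: steps_start ra.
by rewrite /= tT act_all_idle; apply: steps_trans (lift _ _ _ _ ra) rb.
Qed.

Lemma runs_if_false (t : scan -> bool) a ts : Inv ts -> t (cells ts) = false ->
  runs (If t a) ts ts.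
Proof.
move=> its tF; apply: StepsNext => //=.
by rewrite tF act_all_idle; apply: StepsRefl.
Qed.

Lemma runs_if (t : scan -> bool) a ts1 ts2 : t (cells ts1) -> runs a ts1 ts2 ->
  runs (If t a) ts1 ts2.
Proof.
move=> tT ra.
have lift x u y v : @steps a x u y v ->
    @steps (If t a) (omap Some x) u (omap Some y) v.
  elim=> {x u y v} [x u iu|x u y v iu _ IH]; first exact: StepsRefl.
  by apply: StepsNext => //=; case: (next _ _) IH.
apply: StepsNext; first exact: steps_start ra.
by rewrite /= tT act_all_idle; exact: lift ra.
Qed.

Section Simulation.
Variable p : tape_program.
Let M := machine p.

Definition tape_of (t : band) : tape M :=
  @Tape A M (before t) (cell t) (after t).

Definition config_of (x : state M) (ts : bands) : config M :=
  (x, fun i => tape_of (ts i)).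

Lemma scanned_tape_of ts :
  [ffun i => scanned (tape_of (ts i))] = cells ts :> {ffun 'I_k.+1 -> symbol}.
Proof. by apply/ffunP => i; rewrite !ffunE. Qed.

Lemma write_move_tape_of am t :
  write_move (am : option (A + work_symbol M) * move) (tape_of t) =
  tape_of (act_on am t).
Proof. by case: am => a []; case: t. Qed.

Lemma step_config_of x ts :
  step (config_of (inl (Some x)) ts) =
  config_of (inl (next x (cells ts)).1) (act_all (next x (cells ts)).2 ts).
Proof.
rewrite /step /config_of /= scanned_tape_of; case: (next _ _) => y act /=.
congr pair; apply: funext => i. exact: (@write_move_tape_of (act i) (ts i)).
Qed.

Lemma step_halting ts :
  step (config_of (inl None) ts) = config_of (inr (halting (cells ts))) ts.
Proof.
rewrite /step /config_of /= scanned_tape_of.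
congr pair; apply: funext => i; rewrite -[in RHS](act_all_idle ts).
exact: (@write_move_tape_of (idle (cells ts) i) (ts i)).
Qed.

Lemma step_halted b ts : step (config_of (inr b) ts) = config_of (inr b) ts.
Proof. by []. Qed.

Lemma steps_iter x ts y ts' : @steps p x ts y ts' ->
  exists n, iter n (@step A M) (config_of (inl x) ts) = config_of (inl y) ts' /\
    forall m, m <= n -> exists q us, Inv us /\
      iter m (@step A M) (config_of (inl x) ts) = config_of q us.
Proof.
elim=> {x ts y ts'} [x ts its|x ts y ts' its _ [n [nE nI]]].
  by exists 0; split=> // [[]] // _; exists (inl x), ts.
exists n.+1; split; first by rewrite iterSr step_config_of.
case=> [_|m mn]; first by exists (inl (Some x)), ts.
by rewrite iterSr step_config_of; apply: nI.
Qed.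

Lemma runs_machine ts ts' s :
  (forall us, Inv us -> \sum_i band_space (us i) <= s) ->
  runs p ts ts' ->
  let c0 := config_of (inl (Some (entry p))) ts in
  (exists n, verdict (iter n (@step A M) c0).1 = Some (halting (cells ts'))) /\
  (forall n, Defs.space (iter n (@step A M) c0) <= s).
Proof.
move=> Is r c0; have [n [nE nI]] := steps_iter r.
have final m : iter (n + m.+1) (@step A M) c0 =
    config_of (inr (halting (cells ts'))) ts'.
  elim: m => [|m IH]; first by rewrite addn1 iterS nE step_halting.
  by rewrite addnS iterS IH step_halted.
split; first by exists (n + 1); rewrite (final 0).
move=> m; case: (leqP m n) => [/nI[q [us [Ius ->]]]|nm]; first exact: Is.
(* After the run the configuration is frozen, so the bound persists for all times. *)
have -> : m = n + (m - n).-1.+1 by lia.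
by rewrite final; apply: Is; apply: steps_end r.
Qed.

End Simulation.
End TapePrograms.

(** * Registers *)

Definition update (T : eqType) (S : Type) (f : T -> S) (x : T) (y : S) : T -> S :=
  fun z => if z == x then y else f z.

Section Registers.
Variables (A : finType) (k Lin Wd : nat).

Local Notation symbol := (option (A + bool)).
Local Notation scan := {ffun 'I_k.+1 -> symbol}.
Local Notation prog := (@tape_program A bool k).
Local Notation bnd := (@band A bool).

(** Tape 0 holds the input, the others hold registers of at most [Wd] digits; the three additional
    cells are for the blanks visited at both ends. *)
Definition within (ts : bands A bool k) : Prop :=
  forall i, band_space (ts i) <= if i == ord0 then Lin else Wd.+3.

Definition act_at (r : 'I_k.+1) (f : symbol -> symbol * move) (s : scan) :
    'I_k.+1 -> symbol * move :=
  fun i => if i == r then f (s r) else (s i, Stay).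

Definition digit (b : bool) : symbol := Some (inr b).
Definition focus (l ds : seq symbol) : bnd := Band l (head None ds) (behead ds).

(* Numbers are written in bijective base 2, least significant digit first:
   [false] stands for the digit 1 and [true] for the digit 2. *)
Fixpoint bijective2 (s : seq bool) : nat :=
  if s is b :: s' then b.+1 + 2 * bijective2 s' else 0.

Lemma bijective2_cat s t :
  bijective2 (s ++ t) = bijective2 s + 2 ^ size s * bijective2 t.
Proof. by elim: s => [|b s IH] /=; rewrite ?expn0 ?mul1n // IH expnS; lia. Qed.

Lemma bijective2_nseq m b : bijective2 (nseq m b) = b.+1 * (2 ^ m).-1.
Proof. elim: m => [|m IH] /=; first by rewrite muln0. rewrite IH expnS; case: b {IH}; lia. Qed.

Lemma bijective2_size s : 2 ^ size s <= (bijective2 s).+1.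
Proof. elim: s => // b s; rewrite /= expnS; lia. Qed.

(** The head rests on the least significant digit. Visited cells are never given back, hence the
    account of blanks: [j] beyond the top digit, and at most one before the lowest digit, where
    [rewind] turns round. *)
Definition represents (t : bnd) (x : nat) : Prop :=
  exists l s j, [/\ t = focus l (map digit s ++ nseq j None),
    l = [::] \/ l = [:: None], bijective2 s = x & size s <= Wd /\ size s + j <= Wd.+1].

Lemma band_space_focus (l ds : seq symbol) : band_space (focus l ds) = size l + (size ds).-1.+1.
Proof. by rewrite /band_space /= size_behead addnS. Qed.

Lemma represents_space t x : represents t x -> band_space t <= Wd.+3.
Proof.
move=> [l [s [j [-> hl _ [_ sz]]]]].
rewrite band_space_focus size_cat size_map size_nseq.
have : size l <= 1 by case: hl => ->.
by move: sz; lia.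
Qed.

(** Only zero has the empty numeral in bijective base 2, so one cell decides positivity; with
    leading zeros the whole register would have to be scanned. *)
Lemma represents_cell t x : represents t x -> (cell t != None) = (0 < x).
Proof.
move=> [l [s [j [-> _ <- _]]]]; case: s => [|b s] /=; last by rewrite addSn.
by case: j.
Qed.

Section OneTape.
Variable r : 'I_k.+1.
Hypothesis r0 : r != ord0.

Definition runs_at (p : prog) (t t' : bnd) : Prop :=
  forall ts, within ts -> ts r = t -> runs within p ts (update ts r t').

Lemma within_update ts t : within ts -> band_space t <= Wd.+3 ->
  within (update ts r t).
Proof.
by move=> ws ht i; rewrite /update; case: eqP => [->|_]; rewrite ?(negPf r0).
Qed.

Lemma update_update (ts : bands A bool k) t t' :
  update (update ts r t) r t' = update ts r t'.
Proof. by apply: funext => i; rewrite /update; case: eqP. Qed.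

Lemma update_id (ts : bands A bool k) : update ts r (ts r) = ts.
Proof. by apply: funext => i; rewrite /update; case: eqP => [->|]. Qed.

Lemma runs_at_act f t : band_space (act_on (f (cell t)) t) <= Wd.+3 ->
  runs_at (Act (act_at r f)) t (act_on (f (cell t)) t).
Proof.
move=> sp ts ws tsr.
have E : update ts r (act_on (f (cell t)) t) =
    act_all (act_at r f (cells ts)) ts.
  apply: funext => i; rewrite /update /act_all /act_at !ffunE.
  by case: eqP => [->|_]; rewrite ?tsr //; case: (ts i).
by rewrite E; apply: runs_act => //; rewrite -E; apply: within_update.
Qed.

Lemma runs_at_seq p q t1 t2 t3 : runs_at p t1 t2 -> band_space t2 <= Wd.+3 ->
  runs_at q t2 t3 -> runs_at (Seq p q) t1 t3.
Proof.
move=> hp ht hq ts ws tsr; apply: runs_seq (hp _ ws tsr) _.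
rewrite -(update_update ts t2 t3); apply: hq; first exact: within_update.
by rewrite /update eqxx.
Qed.

Lemma runs_at_while_done (c : symbol -> bool) p t : c (cell t) = false ->
  runs_at (While (fun s => c (s r)) p) t t.
Proof.
move=> ct ts ws tsr; rewrite -tsr update_id.
by apply: runs_while_done => //; rewrite ffunE tsr.
Qed.

Lemma runs_at_while (c : symbol -> bool) p t1 t2 t3 : c (cell t1) ->
  runs_at p t1 t2 -> band_space t2 <= Wd.+3 ->
  runs_at (While (fun s => c (s r)) p) t2 t3 ->
  runs_at (While (fun s => c (s r)) p) t1 t3.
Proof.
move=> ct hp ht hq ts ws tsr; apply: runs_while (hp _ ws tsr) _.
  by rewrite ffunE tsr.
rewrite -(update_update ts t2 t3); apply: hq; first exact: within_update.
by rewrite /update eqxx.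
Qed.

Lemma runs_at_if_false (c : symbol -> bool) p t : c (cell t) = false ->
  runs_at (If (fun s => c (s r)) p) t t.
Proof.
move=> ct ts ws tsr; rewrite -tsr update_id.
by apply: runs_if_false => //; rewrite ffunE tsr.
Qed.

Lemma runs_at_if (c : symbol -> bool) p t t' : c (cell t) ->
  runs_at p t t' -> runs_at (If (fun s => c (s r)) p) t t'.
Proof.
by move=> ct hp ts ws tsr; apply: runs_if (hp _ ws tsr); rewrite ffunE tsr.
Qed.

Definition go (a : symbol) (m : move) : prog :=
  Act (act_at r (fun _ => (a, m))).
Definition keep (m : move) : prog := Act (act_at r (fun c => (c, m))).

Definition rewind : prog :=
  Seq (While (fun s => s r != None) (keep MoveLeft)) (keep MoveRight).

(** The carry turns digits 2 into 1 until it is absorbed by a digit 1, which becomes 2, or by the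
    blank, which becomes 1; in both cases the new digit is [c == digit false]. *)
Definition increment : prog :=
  Seq (While (fun s => s r == digit true) (go (digit false) MoveRight))
 (Seq (Act (act_at r (fun c => (digit (c == digit false), Stay))))
      rewind).

(** The borrow turns digits 1 into 2 until it meets a 2, which becomes 1. If it meets the blank
    instead, all digits were 1 and the top one must be erased. *)
Definition decrement : prog :=
  If (fun s => s r != None)
 (Seq (While (fun s => s r == digit false) (go (digit true) MoveRight))
 (Seq (If (fun s => s r == digit true) (go (digit false) Stay))
 (Seq (If (fun s => s r == None)
         (Seq (keep MoveLeft) (go None MoveLeft)))
      rewind))).

(** Serves carries with [b = true] and borrows with [b = false]. *)
Lemma carry b (l : seq symbol) m (ds : seq symbol) : size l + m + size ds <= Wd.+2 ->
  (head None ds == digit b) = false ->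
  runs_at (While (fun s => s r == digit b) (go (digit (~~ b)) MoveRight))
    (focus l (map digit (nseq m b) ++ ds))
    (focus (nseq m (digit (~~ b)) ++ l) ds).
Proof.
move=> sz hds; elim: m l sz => [|m IH] l sz /=.
  exact: (@runs_at_while_done (fun c => c == digit b)).
set t := (X in runs_at _ X _).
have act : act_on (digit (~~ b), MoveRight) t =
    focus (digit (~~ b) :: l) (map digit (nseq m b) ++ ds).
  by rewrite /t /focus /=.
have sp : band_space (focus (digit (~~ b) :: l) (map digit (nseq m b) ++ ds)) <= Wd.+3.
  rewrite band_space_focus size_cat size_map size_nseq /=.
  by move: sz; lia.
apply: (@runs_at_while (fun c => c == digit b)) (sp) _.
- by rewrite /t /= eqxx.
- rewrite -act; apply: (@runs_at_act (fun _ => (digit (~~ b), MoveRight))).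
  by rewrite act.
have -> : digit (~~ b) :: nseq m (digit (~~ b)) ++ l =
    nseq m (digit (~~ b)) ++ digit (~~ b) :: l.
  by rewrite -cat_rcons -[rcons _ _]cats1 -(nseqD m 1) addn1.
by apply: IH; move: sz => /=; lia.
Qed.

Lemma rewind_run (l : seq symbol) u b (ds : seq symbol) : l = [::] \/ l = [:: None] ->
  size u + size ds <= Wd.+1 ->
  runs_at rewind (focus (map digit u ++ l) (digit b :: ds))
    (focus [:: None] (map digit (rev u) ++ digit b :: ds)).
Proof.
move=> hl sz; set e := map digit (rev u) ++ digit b :: ds.
have sze : size e = size u + (size ds).+1 by rewrite size_cat size_map size_rev.
have fe : act_on (None, MoveRight) (focus [::] (None :: e)) = focus [:: None] e by [].
apply: (@runs_at_seq _ _ _ (focus [::] (None :: e))); last first.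
- rewrite -fe; apply: (@runs_at_act (fun c => (c, MoveRight))).
  by rewrite fe band_space_focus /= sze; move: sz; lia.
- by rewrite band_space_focus /= sze; move: sz; lia.
rewrite /e; elim: u b ds sz {e sze fe} => [|c u IH] b ds sz.
  set t := (X in runs_at _ X _).
  have E : act_on (cell t, MoveLeft) t = focus [::] (None :: digit b :: ds).
    by rewrite /t /focus; case: hl => ->.
  have sp : band_space (focus [::] (None :: digit b :: ds)) <= Wd.+3.
    by rewrite band_space_focus /=; move: sz => /=; lia.
  apply: (@runs_at_while (fun c => c != None)) (sp) _ => //.
    by rewrite -E; apply: (@runs_at_act (fun c => (c, MoveLeft))); rewrite E.
  exact: (@runs_at_while_done (fun c => c != None)).
rewrite rev_cons map_rcons cat_rcons.
set t := (X in runs_at _ X _).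
have E : act_on (cell t, MoveLeft) t =
  focus (map digit u ++ l) (digit c :: digit b :: ds) by [].
have sp : band_space (focus (map digit u ++ l) (digit c :: digit b :: ds)) <= Wd.+3.
  rewrite band_space_focus size_cat size_map /=.
  have : size l <= 1 by case: hl => ->.
  by move: sz => /=; lia.
apply: (@runs_at_while (fun c => c != None)) (sp) _ => //.
  by rewrite -E; apply: (@runs_at_act (fun c => (c, MoveLeft))); rewrite E.
by apply: IH; move: sz => /=; lia.
Qed.

Lemma split_prefix (b : bool) s : exists m s', s = nseq m b ++ s' /\
  (s' = [::] \/ exists u, s' = ~~ b :: u).
Proof.
elim: s => [|c s [m [s' [-> H]]]]; first by exists 0, [::]; split=> //; left.
case: (eqVneq c b) => [->|cb]; first by exists m.+1, s'.
exists 0, (c :: nseq m b ++ s'); split=> //; right.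
by exists (nseq m b ++ s'); congr (_ :: _); move: cb; case: c; case: (b).
Qed.

Lemma increment_run t x : represents t x -> x.+1 < 2 ^ Wd ->
  exists2 t', represents t' x.+1 & runs_at increment t t'.
Proof.
move=> [l [s [j [-> hl sx [sz0 sz]]]]] xW.
have szl : size l <= 1 by case: hl => ->.
(* The bound on the value leaves room for one more digit. *)
have sW : size s < Wd.
  rewrite -(ltn_exp2l _ _ (isT : 1 < 2)); apply: leq_ltn_trans xW.
  by rewrite -sx; exact: bijective2_size.
have [m [s' [sE Hs']]] := split_prefix true s.
set ds := map digit s' ++ nseq j None.
have szs : size s = m + size s' by rewrite sE size_cat size_nseq.
have szds : size ds = size s' + j by rewrite size_cat size_map size_nseq.
pose ds' := digit (head None ds == digit false) :: behead ds.
have szds' : size ds' = (size ds).-1.+1 by rewrite /= size_behead.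
have spc : band_space (focus (nseq m (digit false) ++ l) ds') <= Wd.+3.
  by rewrite band_space_focus size_cat size_nseq szds' szds; lia.
exists (focus [:: None] (nseq m (digit false) ++ ds')).
  pose u := nseq m false ++ (if s' is _ :: v then true :: v else [:: false]).
  exists [:: None], u, (if s' is [::] then j.-1 else j); split; try by right.
  - rewrite /u /ds' /ds map_cat map_nseq -catA; congr (focus _ (_ ++ _)).
    by case: Hs' => [->|[v ->]] //=; case: (j).
  - rewrite -sx sE /u !bijective2_cat !bijective2_nseq !size_nseq.
    have : 0 < 2 ^ m by rewrite expn_gt0.
    by case: Hs' => [->|[v ->]] /=; lia.
  - rewrite /u size_cat size_nseq.
    by case: Hs' szs szds => [->|[v ->]] /=; lia.
have -> : map digit s ++ nseq j None = map digit (nseq m true) ++ ds.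
  by rewrite sE map_cat catA.
apply: (runs_at_seq (carry (b := true) _ _)).
- by rewrite szds; lia.
- by rewrite /ds; case: Hs' => [->|[v ->]] //=; case: (j).
- by rewrite band_space_focus size_cat size_nseq szds; lia.
have E : act_on (digit (head None ds == digit false), Stay)
    (focus (nseq m (digit false) ++ l) ds) =
  focus (nseq m (digit false) ++ l) ds' by [].
apply: (runs_at_seq (t2 := focus (nseq m (digit false) ++ l) ds')) (spc) _.
  rewrite -E.
  apply: (@runs_at_act (fun c => (digit (c == digit false), Stay))).
  by rewrite E.
have -> : nseq m (digit false) = map digit (nseq m false) by rewrite map_nseq.
rewrite -{2}(rev_nseq m false) /ds'; apply: rewind_run => //.
by rewrite size_nseq size_behead szds; lia.
Qed.

Lemma decrement_run t x : represents t x ->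
  exists2 t', represents t' x.-1 & runs_at decrement t t'.
Proof.
move=> rt; have cx := represents_cell rt.
have [x0|xpos] := posnP x.
  exists t; first by move: rt; rewrite x0.
  by apply: (@runs_at_if_false (fun c => c != None)); rewrite cx x0.
case: rt cx => l [s [j [-> hl sx [sz0 sz]]]] cx.
have szl : size l <= 1 by case: hl => ->.
have [m [s' [sE Hs']]] := split_prefix false s.
set ds := map digit s' ++ nseq j None.
have szs : size s = m + size s' by rewrite sE size_cat size_nseq.
have szds : size ds = size s' + j by rewrite size_cat size_map size_nseq.
have dsE : map digit s ++ nseq j None = map digit (nseq m false) ++ ds.
  by rewrite sE map_cat catA.
have carryE : runs_at (While (fun s => s r == digit false) (go (digit true) MoveRight))
    (focus l (map digit s ++ nseq j None)) (focus (nseq m (digit true) ++ l) ds).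
  rewrite dsE; apply: (carry (b := false)); first by rewrite szds; lia.
  by rewrite /ds; case: Hs' => [->|[v ->]] //=; case: (j).
have spc : band_space (focus (nseq m (digit true) ++ l) ds) <= Wd.+3.
  by rewrite band_space_focus size_cat size_nseq szds; lia.
have sp1 : band_space (focus l (map digit s ++ nseq j None)) <= Wd.+3.
  by rewrite band_space_focus size_cat size_map size_nseq; lia.
have after_if u u' : band_space u <= Wd.+3 ->
    runs_at (Seq (If (fun s => s r == digit true) (go (digit false) Stay))
      (Seq (If (fun s => s r == None) (Seq (keep MoveLeft) (go None MoveLeft)))
        rewind)) u u' ->
    runs_at (While (fun s => s r == digit false) (go (digit true) MoveRight))
      (focus l (map digit s ++ nseq j None)) u ->
    runs_at decrement (focus l (map digit s ++ nseq j None)) u'.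
  move=> spt h1 h2; apply: (@runs_at_if (fun c => c != None)); first by rewrite cx.
  exact: runs_at_seq h2 spt h1.
case: Hs' => [s'0|[v s'E]].
  case: m => [|m] in sE szs dsE carryE spc *.
    by move: xpos; rewrite -sx sE s'0.
  (* Behind the remaining digits lie the erased cell and the cell where the borrow stopped, which is
     new on the tape if [j = 0]; this makes [j.-1.+2] blanks. *)
  pose u : seq symbol := None :: None :: nseq j.-1 None.
  exists (focus [:: None] (map digit (nseq m true) ++ u)).
    exists [:: None], (nseq m true), j.-1.+2; split => //; try by right.
      rewrite -sx sE s'0 cats0 !bijective2_nseq expnS.
      have : 0 < 2 ^ m by rewrite expn_gt0.
      lia.
    by rewrite size_nseq; move: szs sz sz0; rewrite s'0 /=; lia.
  apply: (after_if _ _ spc _ carryE).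
  have dsN : ds = nseq j None by rewrite /ds s'0.
  have hN : head None ds = None by rewrite dsN; case: (j).
  have szj : m.+1 <= Wd /\ m.+1 + j <= Wd.+1.
    by move: szs sz sz0; rewrite s'0 /=; lia.
  apply: runs_at_seq (spc) _.
    by apply: (@runs_at_if_false (fun c => c == digit true)); rewrite /= hN.
  pose t1 := focus (nseq m (digit true) ++ l) (digit true :: None :: nseq j.-1 None).
  have E1 : act_on (cell (focus (nseq m.+1 (digit true) ++ l) ds), MoveLeft)
      (focus (nseq m.+1 (digit true) ++ l) ds) = t1.
    by rewrite /t1 dsN; case: (j).
  have s1 : band_space t1 <= Wd.+3.
    by rewrite band_space_focus size_cat size_nseq /= size_nseq; lia.
  pose t2 := focus (behead (nseq m (digit true) ++ l))
    (head None (nseq m (digit true) ++ l) :: u).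
  have E2 : act_on (None, MoveLeft) t1 = t2 by [].
  have s2 : band_space t2 <= Wd.+3.
    by rewrite band_space_focus size_behead size_cat size_nseq /= size_nseq; lia.
  apply: runs_at_seq (s2) _.
    apply: (@runs_at_if (fun c => c == None)); first by rewrite /= hN.
    apply: runs_at_seq (s1) _.
      by rewrite -E1; apply: (@runs_at_act (fun c => (c, MoveLeft))); rewrite E1.
    by rewrite -E2; apply: (@runs_at_act (fun _ => (None, MoveLeft))); rewrite E2.
  rewrite /t2; case: m {E1 E2 s2 t2 s1 t1 dsE carryE spc szs sE} szj => [|m] szj.
    have -> : focus (behead (nseq 0 (digit true) ++ l))
        (head None (nseq 0 (digit true) ++ l) :: u) = focus [::] (None :: u).
      by case: hl => ->.
    apply: (@runs_at_seq _ _ _ (focus [::] (None :: u))).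
    - exact: (@runs_at_while_done (fun c => c != None)).
    - by rewrite band_space_focus /= size_nseq; lia.
    have E : act_on (None, MoveRight) (focus [::] (None :: u)) = focus [:: None] u by [].
    rewrite /= -E; apply: (@runs_at_act (fun c => (c, MoveRight))).
    by rewrite E band_space_focus /= size_nseq; lia.
  have -> : nseq m.+1 true = rcons (rev (nseq m true)) true.
    by rewrite rev_nseq -cats1 -(nseqD m 1) addn1.
  rewrite map_rcons cat_rcons /=.
  have -> : nseq m (digit true) = map digit (nseq m true) by rewrite map_nseq.
  apply: rewind_run => //.
  by rewrite /u /= !size_nseq; lia.
pose ds' := digit false :: map digit v ++ nseq j None.
have dsT : ds = digit true :: behead ds by rewrite /ds s'E.
have bds : behead ds = map digit v ++ nseq j None by rewrite /ds s'E.
exists (focus [:: None] (map digit (nseq m true) ++ ds')).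
  exists [:: None], (nseq m true ++ false :: v), j; split; try by right.
  - by rewrite map_cat -catA.
  - rewrite -sx sE s'E !bijective2_cat !bijective2_nseq !size_nseq /=.
    have : 0 < 2 ^ m by rewrite expn_gt0.
    lia.
  - by rewrite size_cat size_nseq /=; move: szs sz sz0; rewrite s'E /=; lia.
apply: (after_if _ _ spc _ carryE).
have E : act_on (digit false, Stay) (focus (nseq m (digit true) ++ l) ds) =
    focus (nseq m (digit true) ++ l) ds' by rewrite dsT /ds' -bds.
have s1 : band_space (focus (nseq m (digit true) ++ l) ds') <= Wd.+3.
  rewrite band_space_focus size_cat size_nseq /= size_cat size_map size_nseq.
  by move: szs sz sz0; rewrite s'E /=; lia.
apply: runs_at_seq (s1) _.
  apply: (@runs_at_if (fun c => c == digit true)); first by rewrite dsT.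
  by rewrite -E; apply: (@runs_at_act (fun _ => (digit false, Stay))); rewrite E.
apply: runs_at_seq (s1) _.
  exact: (@runs_at_if_false (fun c => c == None)).
have -> : nseq m (digit true) = map digit (nseq m true) by rewrite map_nseq.
rewrite -{2}(rev_nseq m true); apply: rewind_run => //.
rewrite size_nseq size_cat size_map size_nseq.
by move: szs sz sz0; rewrite s'E /=; lia.
Qed.

End OneTape.

Definition reg (r : nat) : 'I_k.+1 := inord r.+1.

Lemma reg_neq0 r : r < k -> reg r != ord0.
Proof. by move=> rk; rewrite -val_eqE /= inordK. Qed.

Lemma reg_eq r s : r < k -> s < k -> (reg r == reg s) = (r == s).
Proof. by move=> rk sk; rewrite -val_eqE /= !inordK. Qed.

Definition stores (ts : bands A bool k) (f : nat -> nat) : Prop :=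
  within ts /\ forall r, r < k -> represents (ts (reg r)) (f r).

Definition does (p : prog) (f g : nat -> nat) : Prop :=
  forall ts, stores ts f ->
  exists ts', [/\ stores ts' g, ts' ord0 = ts ord0 & runs within p ts ts'].

Lemma does_at p r x f : r < k ->
  (forall t, represents t (f r) ->
     exists2 t', represents t' x & runs_at (reg r) p t t') ->
  does p f (update f r x).
Proof.
move=> rk H ts [ws rs]; have [t' rt' ht'] := H _ (rs _ rk).
exists (update ts (reg r) t'); split; last exact: ht'.
- split.
    apply: within_update => //; first exact: reg_neq0.
    exact: (represents_space rt').
  move=> s sk; rewrite /update reg_eq //.
  by case: eqP => // _; apply: rs.
- by rewrite /update eq_sym (negPf (reg_neq0 rk)).
Qed.

Definition inc r := increment (reg r).
Definition dec r := decrement (reg r).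
Definition while_pos r (p : prog) : prog :=
  While (fun s : scan => s (reg r) != None) p.
Definition if_pos r (p : prog) : prog :=
  If (fun s : scan => s (reg r) != None) p.
Definition skip : prog := If (fun s : scan => false) (Act (@idle _ _ _)).

Lemma does_inc r f : r < k -> (f r).+1 < 2 ^ Wd ->
  does (inc r) f (update f r (f r).+1).
Proof.
move=> rk fr; apply: does_at => // t rt.
by apply: increment_run => //; exact: reg_neq0.
Qed.

Lemma does_dec r f : r < k -> does (dec r) f (update f r (f r).-1).
Proof.
move=> rk; apply: does_at => // t rt.
by apply: decrement_run => //; exact: reg_neq0.
Qed.

Lemma does_skip f : does skip f f.
Proof. by move=> ts st; exists ts; split=> //; apply: runs_if_false => //; case: st. Qed.

Lemma does_seq p q f g h : does p f g -> does q g h -> does (Seq p q) f h.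
Proof.
move=> hp hq ts /hp[ts1 [st1 e1 r1]]; have [ts2 [st2 e2 r2]] := hq _ st1.
by exists ts2; split; rewrite ?e2 //; apply: runs_seq r1 r2.
Qed.

Lemma stores_cell ts f r : r < k -> stores ts f ->
  (cells ts (reg r) != None) = (0 < f r).
Proof. by move=> rk [_ /(_ _ rk) /represents_cell <-]; rewrite ffunE. Qed.

Lemma does_while0 r p f : r < k -> f r = 0 -> does (while_pos r p) f f.
Proof.
move=> rk fr ts st; exists ts; split => //.
by apply: runs_while_done; [case: st | rewrite (stores_cell rk st) fr].
Qed.

Lemma does_while r p f g h : r < k -> 0 < f r -> does p f g ->
  does (while_pos r p) g h -> does (while_pos r p) f h.
Proof.
move=> rk fr hp hq ts st; have [ts1 [st1 e1 r1]] := hp _ st.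
have [ts2 [st2 e2 r2]] := hq _ st1.
exists ts2; split; rewrite ?e2 //; apply: runs_while r1 r2.
by rewrite (stores_cell rk st).
Qed.

Lemma does_if0 r p f : r < k -> f r = 0 -> does (if_pos r p) f f.
Proof.
move=> rk fr ts st; exists ts; split => //.
by apply: runs_if_false; [case: st | rewrite (stores_cell rk st) fr].
Qed.

Lemma does_if r p f g : r < k -> 0 < f r -> does p f g -> does (if_pos r p) f g.
Proof.
move=> rk fr hp ts st; have [ts1 [st1 e1 r1]] := hp _ st.
by exists ts1; split=> //; apply: runs_if r1; rewrite (stores_cell rk st).
Qed.

End Registers.

Arguments does_dec {A k Lin Wd r} f.
Arguments does_skip {A k Lin Wd} f.
Arguments does_while0 {A k Lin Wd r} p f.
Arguments does_if0 {A k Lin Wd r} p f.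

(** * Bounded arithmetic *)

Definition scons (x : nat) (v : nat -> nat) : nat -> nat :=
  fun i => if i is j.+1 then v j else x.

(** The cap bounds the accumulator by a value known before the loop starts; without it, iterated
    multiplication would leave polynomial space. *)
Fixpoint capped_rec (cap n x : nat) (step : nat -> nat -> nat) : nat :=
  minn (if n is m.+1 then step m (capped_rec cap m x step) else x) cap.

(* Variables are de Bruijn indices: [Let] binds one variable, and the last
   argument of [Rec] binds the counter (index 0) and the accumulator. *)
Inductive expr :=
| Var of nat
| Const of nat
| Add of expr & expr
| Sub of expr & expr
| Mul of expr & expr
| Let of expr & expr
| Rec of expr & expr & expr & expr.

Fixpoint eval (e : expr) (v : nat -> nat) : nat :=
  match e with
  | Var i => v i
  | Const n => n
  | Add a b => eval a v + eval b v
  | Sub a b => eval a v - eval b v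
  | Mul a b => eval a v * eval b v
  | Let a b => eval b (scons (eval a v) v)
  | Rec c n x s => capped_rec (eval c v) (eval n v) (eval x v)
      (fun i y => eval s (scons i (scons y v)))
  end.

(* Bounds all intermediate results when the environment is bounded by V. *)
Fixpoint value_bound (e : expr) (V : nat) : nat :=
  match e with
  | Var i => V
  | Const n => n
  | Add a b | Sub a b => value_bound a V + value_bound b V
  | Mul a b => value_bound a V + value_bound b V +
               value_bound a V * value_bound b V
  | Let a b => value_bound a V + value_bound b (V + value_bound a V)
  | Rec c n x s =>
      let U := value_bound c V + value_bound n V + value_bound x V in
      U + value_bound s (V + U)
  end.

Lemma capped_rec_le cap n x step : capped_rec cap n x step <= cap.
Proof. by case: n => [|n] /=; exact: geq_minr. Qed.

Lemma eval_bound e v V : (forall x, v x <= V) -> eval e v <= value_bound e V.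
Proof.
elim: e v V => [i|n|a IHa b IHb|a IHa b IHb|a IHa b IHb|a IHa b IHb|c IHc n IHn x IHx s IHs] v V vV /=.
- exact: vV.
- by [].
- exact: leq_add (IHa _ _ vV) (IHb _ _ vV).
- by move: (IHa _ _ vV) (IHb _ _ vV); lia.
- have := leq_mul (IHa _ _ vV) (IHb _ _ vV); lia.
- apply: leq_trans (leq_addl _ _); apply: IHb => -[|j] /=.
    by apply: leq_trans (leq_addl _ _); apply: IHa.
  exact: leq_trans (vV j) (leq_addr _ _).
- by have := capped_rec_le (eval c v) (eval n v) (eval x v)
    (fun i y => eval s (scons i (scons y v))); have := IHc _ _ vV; lia.
Qed.

(** For [V = 2 ^ q] this allows registers of about [q * D] digits: evaluation costs only a constant
    factor in length. *)
Lemma value_bound_poly e : exists D, forall V, 2 <= V -> value_bound e V <= V ^ D.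
Proof.
have add V a b x y : 2 <= V -> x <= V ^ a -> y <= V ^ b -> x + y <= V ^ (a + b).+1.
  move=> V2 ha hb; have [pa pb] : 0 < V ^ a /\ 0 < V ^ b by rewrite !expn_gt0; lia.
  rewrite expnS expnD; move: (V ^ a) (V ^ b) ha hb pa pb => p q ha hb pa pb.
  have pq : p + q <= 2 * (p * q) by nia.
  by apply: leq_trans (leq_add ha hb) (leq_trans pq _); rewrite leq_mul2r V2 orbT.
elim: e => [i|n|a [Da Ha] b [Db Hb]|a [Da Ha] b [Db Hb]|a [Da Ha] b [Db Hb]|a [Da Ha] b [Db Hb]|c [Dc Hc] n [Dn Hn] x [Dx Hx] s [Ds Hs]] /=.
- by exists 1 => V _; rewrite expn1.
- exists n => V V2; apply: ltnW; apply: leq_trans (ltn_expl _ V2) _; exact: leqnn.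
- by exists (Da + Db).+1 => V V2; apply: add; auto.
- by exists (Da + Db).+1 => V V2; apply: add; auto.
- exists ((Da + Db).+1 + (Da + Db)).+1 => V V2; apply: (add) => //.
    by apply: add; auto.
  by rewrite expnD leq_mul; auto.
- exists (Da + (1 + Da).+1 * Db).+1 => V V2; apply: (add) => //; first exact: Ha.
  have VU : V + value_bound a V <= V ^ (1 + Da).+1.
    by apply: add; rewrite ?expn1 //; exact: Ha.
  rewrite expnM; apply: leq_trans (Hb _ _) _; first by apply: leq_trans V2 (leq_addr _ _).
  by case: (Db) => // D; rewrite leq_exp2r.
- pose DU := ((Dc + Dn).+1 + Dx).+1; exists (DU + (1 + DU).+1 * Ds).+1 => V V2.
  set U := _ + _ + value_bound x V.
  have HU : U <= V ^ DU by apply: (add) => //; [apply: add; auto|auto].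
  apply: (add) => //.
  have VU : V + U <= V ^ (1 + DU).+1 by apply: add => //; rewrite expn1.
  rewrite expnM; apply: leq_trans (Hs _ _) _; first by apply: leq_trans V2 (leq_addr _ _).
  by case: (Ds) => // D; rewrite leq_exp2r.
Qed.

(** * Compilation of expressions into register programs *)

Section Compile.
Variables (A : finType) (k Lin Wd : nat).
Local Notation prog := (@tape_program A bool k).
Local Notation does := (@does A k Lin Wd).
Local Notation inc := (@inc A k).
Local Notation dec := (@dec A k).
Local Notation while_pos := (@while_pos A k).
Local Notation if_pos := (@if_pos A k).
Local Notation skip := (@skip A k).

Definition clear r : prog := while_pos r (dec r).
Definition move_to r s : prog := while_pos r (Seq (dec r) (inc s)).
Definition copy_to r s t : prog :=
  Seq (while_pos r (Seq (dec r) (Seq (inc s) (inc t)))) (move_to t r).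
Definition sub_from r s : prog := while_pos s (Seq (dec s) (dec r)).
(** A copy of the cap [c] in [t] is spent by one for each unit passing from [s] to [r]; the excess
    of [s] is dropped. *)
Definition add_min r s t u c : prog :=
  Seq (copy_to c t u)
 (Seq (while_pos s (Seq (dec s) (if_pos t (Seq (dec t) (inc r)))))
      (clear t)).

(** Registers form a stack: on entry those from [d] on are zero and [rho] sends the variables below
    [d]; on exit the value is in [d] and everything above is zero again. *)
Fixpoint compile (e : expr) (rho : nat -> nat) (d : nat) : prog :=
  match e with
  | Var i => copy_to (rho i) d d.+1
  | Const n => iter n (fun p => Seq p (inc d)) skip
  | Add a b => Seq (compile a rho d) (Seq (compile b rho d.+1) (move_to d.+1 d))
  | Sub a b => Seq (compile a rho d) (Seq (compile b rho d.+1) (sub_from d d.+1))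
  | Mul a b =>
      Seq (compile a rho d.+1) (Seq (compile b rho d.+2)
     (Seq (while_pos d.+1 (Seq (dec d.+1) (copy_to d.+2 d d.+3)))
          (clear d.+2)))
  | Let a b => Seq (compile a rho d) (Seq (compile b (scons d rho) d.+1)
     (Seq (clear d) (move_to d.+1 d)))
  | Rec c n x s =>
      let cap := d.+1 in let cnt := d.+2 in let idx := d.+3 in
      let new := d.+4 in
      Seq (compile c rho cap) (Seq (compile n rho cnt) (Seq (compile x rho new)
     (Seq (add_min d new d.+4.+1 d.+4.+2 cap)
     (Seq (while_pos cnt (Seq (dec cnt)
             (Seq (compile s (scons idx (scons d rho)) new)
             (Seq (clear d) (Seq (add_min d new d.+4.+1 d.+4.+2 cap) (inc idx))))))
     (Seq (clear cap) (clear idx))))))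
  end.

Fixpoint registers_needed (e : expr) : nat :=
  match e with
  | Var _ => 2
  | Const _ => 1
  | Add a b | Sub a b => maxn (registers_needed a) (registers_needed b).+1
  | Mul a b => maxn (registers_needed a).+1 (maxn (registers_needed b).+2 4)
  | Let a b => maxn (registers_needed a) (registers_needed b).+2
  | Rec c n x s => maxn (registers_needed c).+1 (maxn (registers_needed n).+2
      (maxn (registers_needed x).+4 (maxn (registers_needed s).+4 7)))
  end.

Lemma registers_needed_gt0 e : 0 < registers_needed e.
Proof. by elim: e => //= *; lia. Qed.

Lemma does_eq p f g g' : does p f g -> g =1 g' -> does p f g'.
Proof. by move=> h /funext <-. Qed.

Ltac upd :=
  let i := fresh "i" in
  move=> i; rewrite /update /=;
  repeat match goal with
  | |- context [@eq_op _ ?x ?x] => rewrite eqxx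
  | H : is_true (?x != ?y) |- context [@eq_op _ ?x ?y] => rewrite (negPf H)
  | H : is_true (?y != ?x) |- context [@eq_op _ ?x ?y] =>
      rewrite [x == y]eq_sym (negPf H)
  | |- context [@eq_op ?T i ?y] => case: (@eqVneq T i y) => [?|?]; try subst i
  | |- context [@eq_op ?T ?x ?y] => have -> : @eq_op T x y = false by lia
  end; try done;
  repeat match goal with H : is_true (_ != _) |- _ => clear H end; try lia.

Lemma does_clear r f : r < k -> does (clear r) f (update f r 0).
Proof.
move=> rk; move En : (f r) => n; elim: n f En => [|n IH] f En.
  by apply: does_eq (does_while0 _ _ rk En) _; upd.
apply: (does_while (f := f) rk); first by rewrite En.
  exact: does_dec.
apply: does_eq (IH _ _) _; last by upd.
by rewrite /update eqxx En.
Qed.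

Lemma does_move_to r s f : r < k -> s < k -> r != s -> f s + f r < 2 ^ Wd ->
  does (move_to r s) f (update (update f s (f s + f r)) r 0).
Proof.
move=> rk sk rs; move En : (f r) => n; elim: n f En => [|n IH] f En lt.
  by apply: does_eq (does_while0 _ _ rk En) _; upd.
apply: (does_while (f := f) rk); first by rewrite En.
  apply: does_seq (does_dec _ rk) (does_inc sk _).
  by rewrite /update eq_sym (negPf rs); lia.
apply: does_eq (IH _ _ _) _.
- by rewrite /update eqxx (negPf rs) En.
- by rewrite /update !eqxx eq_sym (negPf rs); lia.
- by upd.
Qed.

Lemma does_copy_to r s t f : r < k -> s < k -> t < k -> uniq [:: r; s; t] ->
  f t = 0 -> f s + f r < 2 ^ Wd ->
  does (copy_to r s t) f (update f s (f s + f r)).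
Proof.
move=> rk sk tk; rewrite /= !inE negb_or !andbT => /andP[/andP[rs rt] st] ft lt.
have key n g : g r = n -> g s + n < 2 ^ Wd -> g t + n < 2 ^ Wd ->
    does (while_pos r (Seq (dec r) (Seq (inc s) (inc t)))) g
    (update (update (update g s (g s + n)) t (g t + n)) r 0).
  elim: n g => [|n IH] g En l1 l2.
    by apply: does_eq (does_while0 _ _ rk En) _; upd.
  apply: (does_while (f := g) rk); first by rewrite En.
    apply: does_seq (does_dec _ rk) _; apply: does_seq (does_inc sk _) (does_inc tk _).
      by rewrite /update eq_sym (negPf rs); lia.
    rewrite /update [t == s]eq_sym (negPf st) [t == r]eq_sym (negPf rt); lia.
  apply: does_eq (IH _ _ _ _) _.
  - by rewrite /update eqxx (negPf rs) (negPf rt) En.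
  - by rewrite /update !eqxx (negPf st) [s == r]eq_sym (negPf rs); lia.
  - by rewrite /update !eqxx [t == s]eq_sym (negPf st) [t == r]eq_sym (negPf rt); lia.
  - by upd.
apply: does_seq (key _ _ (erefl _) _ _) _ => //; first by lia.
apply: does_eq (does_move_to tk rk _ _) _.
- by rewrite eq_sym.
- by rewrite /update !eqxx [t == r]eq_sym (negPf rt); lia.
- by upd.
Qed.

Lemma does_sub_from r s f : r < k -> s < k -> r != s ->
  does (sub_from r s) f (update (update f r (f r - f s)) s 0).
Proof.
move=> rk sk rs; move En : (f s) => n; elim: n f En => [|n IH] f En.
  by apply: does_eq (does_while0 _ _ sk En) _; upd.
apply: (does_while (f := f) sk); first by rewrite En.
  exact: does_seq (does_dec _ sk) (does_dec _ rk).
apply: does_eq (IH _ _) _.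
- by rewrite /update eqxx [s == r]eq_sym (negPf rs) En.
- by upd.
Qed.

Lemma does_add_min r s t u c f : r < k -> s < k -> t < k -> u < k -> c < k ->
  uniq [:: r; s; t; u; c] -> f t = 0 -> f u = 0 ->
  f r + f c < 2 ^ Wd ->
  does (add_min r s t u c) f
    (update (update f r (f r + minn (f s) (f c))) s 0).
Proof.
move=> rk sk tk uk ck; rewrite /= !inE !negb_or !andbT.
move=> /and4P[/and4P[rs rt ru rc] /and3P[st su sc] /andP[tu tc] uc] ft fu lt.
have key n g : g s = n -> g r + g t < 2 ^ Wd ->
    does (while_pos s (Seq (dec s) (if_pos t (Seq (dec t) (inc r))))) g
    (update (update (update g r (g r + minn n (g t))) t (g t - n)) s 0).
  elim: n g => [|n IH] g En l1.
    by apply: does_eq (does_while0 _ _ sk En) _; upd.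
  pose g' := update g s n.
  have [gt0|gtp] := posnP (g t).
    apply: (does_while (f := g) (g := g') sk); first by rewrite En.
      apply: does_seq (does_dec _ sk) _.
      apply: does_eq (does_if0 _ _ tk _) _.
        by rewrite /update [t == s]eq_sym (negPf st).
      by rewrite /g'; upd.
    apply: does_eq (IH _ _ _) _.
    - by rewrite /g' /update eqxx.
    - by rewrite /g' /update (negPf rs) [t == s]eq_sym (negPf st).
    - by rewrite /g'; upd.
  pose g1 := update (update g' t (g t).-1) r (g r).+1.
  apply: (does_while (f := g) (g := g1) sk); first by rewrite En.
    apply: does_seq (does_dec _ sk) _.
    apply: does_if => //.
      by rewrite /update [t == s]eq_sym (negPf st).
    apply: does_eq (does_seq (does_dec _ tk) (does_inc rk _)) _.
      by rewrite /update (negPf rt) (negPf rs); lia.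
    by rewrite /g1 /g'; upd.
  apply: does_eq (IH _ _ _) _.
  - by rewrite /g1 /g' /update eqxx [s == r]eq_sym (negPf rs) (negPf st).
  - by rewrite /g1 /g' /update !eqxx [t == r]eq_sym (negPf rt); lia.
  - by rewrite /g1 /g'; upd.
apply: does_seq (does_copy_to ck tk uk _ fu _) _.
- by rewrite /= !inE negb_or !andbT [c == t]eq_sym tc [c == u]eq_sym uc tu.
- by rewrite ft; lia.
apply: does_seq (key _ _ (erefl _) _) _.
  by rewrite /update eqxx (negPf rt) ft.
apply: does_eq (does_clear tk) _.
by upd.
Qed.

Lemma compile_correct e rho d f V :
  d + registers_needed e <= k -> (forall x, rho x < d) ->
  (forall r, d <= r -> f r = 0) -> (forall x, f (rho x) <= V) ->
  value_bound e V < 2 ^ Wd ->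
  does (compile e rho d) f (update f d (eval e (f \o rho))).
Proof.
elim: e rho d f V => [i|n|a IHa b IHb|a IHa b IHb|a IHa b IHb|a IHa b IHb|c IHc n IHn x IHx s IHs] rho d f V dk rd f0 fV /= bV.
- have rdi := rd i; rewrite /= in dk.
  apply: does_eq (does_copy_to _ _ _ _ _ _) _; try lia.
  + by rewrite /= !inE negb_or !andbT; apply/andP; split; [apply/andP; split|]; lia.
  + by apply: f0; lia.
  + by rewrite f0 // add0n; apply: leq_ltn_trans (fV _) bV.
  + by rewrite f0.
- rewrite /= in dk; elim: n bV => [|n IH] bV /=.
    by apply: does_eq (does_skip _) _; have fd0 := f0 d (leqnn d); upd.
  apply: does_seq (IH _) _; first by lia.
  apply: does_eq (does_inc _ _) _; first by lia.
    by rewrite /update eqxx; lia.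
  by upd.
- rewrite /= in dk.
  have ea := @eval_bound a (f \o rho) V fV; have pa := registers_needed_gt0 a; have eb := @eval_bound b (f \o rho) V fV; have pb := registers_needed_gt0 b.
  apply: does_seq (IHa _ _ _ V _ _ _ _ _) _ => //; try lia.
  apply: does_seq (IHb _ _ _ V _ _ _ _ _) _ => //; try lia.
  + by move=> j; have := rd j; lia.
  + by move=> r dr; rewrite /update; case: eqP => [?|_]; [lia|apply: f0; lia].
  + by move=> j; rewrite /update; have := rd j; case: eqP => [?|_ _]; [lia|exact: fV].
  have E : update f d (eval a (f \o rho)) \o rho = f \o rho.
    by apply: funext => j /=; rewrite /update; have := rd j; case: eqP => [?|//]; lia.
  rewrite E; apply: does_eq (does_move_to _ _ _ _) _; try lia.
  + rewrite /update !eqxx; case: eqP => [?|_]; [lia|].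
    by rewrite -/(comp f rho); lia.
  + by have fd0 := f0 d.+1 (leqnSn d); upd.
- rewrite /= in dk.
  have ea := @eval_bound a (f \o rho) V fV; have pa := registers_needed_gt0 a; have eb := @eval_bound b (f \o rho) V fV; have pb := registers_needed_gt0 b.
  apply: does_seq (IHa _ _ _ V _ _ _ _ _) _ => //; try lia.
  apply: does_seq (IHb _ _ _ V _ _ _ _ _) _ => //; try lia.
  + by move=> j; have := rd j; lia.
  + by move=> r dr; rewrite /update; case: eqP => [?|_]; [lia|apply: f0; lia].
  + by move=> j; rewrite /update; have := rd j; case: eqP => [?|_ _]; [lia|exact: fV].
  have E : update f d (eval a (f \o rho)) \o rho = f \o rho.
    by apply: funext => j /=; rewrite /update; have := rd j; case: eqP => [?|//]; lia.
  rewrite E; apply: does_eq (does_sub_from _ _ _) _; try lia.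
  by have fd0 := f0 d.+1 (leqnSn d); upd.
- rewrite /= in dk.
  have ea := @eval_bound a (f \o rho) V fV; have pa := registers_needed_gt0 a; have eb := @eval_bound b (f \o rho) V fV; have pb := registers_needed_gt0 b.
  apply: does_seq (IHa _ _ _ V _ _ _ _ _) _ => //; try lia.
  + by move=> j; have := rd j; lia.
  + by move=> r dr; apply: f0; lia.
  apply: does_seq (IHb _ _ _ V _ _ _ _ _) _ => //; try lia.
  + by move=> j; have := rd j; lia.
  + by move=> r dr; rewrite /update; case: eqP => [?|_]; [lia|apply: f0; lia].
  + by move=> j; rewrite /update; have := rd j; case: eqP => [?|_ _]; [lia|exact: fV].
  have E : update f d.+1 (eval a (f \o rho)) \o rho = f \o rho.
    by apply: funext => j /=; rewrite /update; have := rd j; case: eqP => [?|//]; lia.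
  rewrite E; set y := eval b _ in eb *; set x := eval a _ in ea *.
  have key m g : g d.+1 = m -> g d.+2 = y -> g d.+3 = 0 -> g d + m * y < 2 ^ Wd ->
      does (while_pos d.+1 (Seq (dec d.+1) (copy_to d.+2 d d.+3))) g
        (update (update g d (g d + m * y)) d.+1 0).
    elim: m g => [|m IH] g g1 g2 g3 lt.
      apply: does_eq (does_while0 _ _ _ g1) _; first by lia.
      by upd.
    apply: (does_while (f := g)); [lia|by rewrite g1| |].
      apply: does_seq (does_dec _ _) (does_copy_to _ _ _ _ _ _); try lia.
      + by rewrite /= !inE negb_or !andbT; apply/andP; split; [apply/andP; split|]; lia.
      + by rewrite /update; case: eqP => // ?; lia.
      + rewrite /update; case: eqP => [?|_]; [lia|].
        by case: eqP => [?|_]; [lia|rewrite g2; lia].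
    apply: does_eq (IH _ _ _ _ _) _.
    + by rewrite /update eqxx; case: eqP => [?|_]; [lia|rewrite g1].
    + by rewrite /update; case: eqP => [?|_]; [lia|case: eqP => [?|_ //]; lia].
    + by rewrite /update; case: eqP => [?|_]; [lia|case: eqP => [?|_ //]; lia].
    + rewrite /update eqxx; case: eqP => [?|_]; [lia|].
      by case: eqP => [?|_]; [lia|rewrite g2; lia].
    + by upd.
  have xyb : x * y <= value_bound a V * value_bound b V by apply: leq_mul.
  apply: does_seq (key x _ _ _ _ _) _.
  + by rewrite /update eqxx; case: eqP => [?|_ //]; lia.
  + by rewrite /update eqxx.
  + by rewrite /update; case: eqP => [?|_]; [lia|case: eqP => [?|_ //]; [lia|apply: f0; lia]].
  + rewrite /update; case: eqP => [?|_]; [lia|case: eqP => [?|_ //]; [lia|]].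
    by rewrite f0 //; lia.
  apply: does_eq (does_clear _) _; first by lia.
  have d0 := f0 d (leqnn d); have d1 : f d.+1 = 0 by apply: f0; lia.
  have d2 : f d.+2 = 0 by apply: f0; lia.
  by upd.
- rewrite /= in dk.
  have ea := @eval_bound a (f \o rho) V fV; have pa := registers_needed_gt0 a.
  apply: does_seq (IHa _ _ _ V _ _ _ _ _) _ => //; try lia.
  set x := eval a _ in ea *.
  have E : update f d x \o scons d rho = scons x (f \o rho).
    apply: funext => -[|j] /=; rewrite /update ?eqxx //.
    by have := rd j; case: eqP => [?|//]; lia.
  have EV j : scons x (f \o rho) j <= V + value_bound a V.
    case: j => [|j] /=; first by lia.
    by have := fV j; lia.
  have eb := eval_bound b EV.
  apply: does_seq (IHb _ _ _ (V + value_bound a V) _ _ _ _ _) _; try lia.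
  + by case=> [|j] //=; have := rd j; lia.
  + by move=> r dr; rewrite /update; case: eqP => [?|_]; [lia|apply: f0; lia].
  + by move=> j; have := EV j; rewrite -E.
  apply: does_seq (does_clear _) _; first by lia.
  rewrite E; apply: does_eq (does_move_to _ _ _ _) _; try lia.
  + rewrite /update !eqxx; case: eqP => [?|_]; [lia|].
    by rewrite add0n; lia.
  + by have fd0 := f0 d.+1 (leqnSn d); upd.
- rewrite /= in dk.
  have ec := @eval_bound c (f \o rho) V fV; have pc := registers_needed_gt0 c; have en := @eval_bound n (f \o rho) V fV; have pn := registers_needed_gt0 n; have ex := @eval_bound x (f \o rho) V fV; have px := registers_needed_gt0 x.
  apply: does_seq (IHc _ _ _ V _ _ _ _ _) _ => //; try lia.
  + by move=> j; have := rd j; lia.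
  + by move=> r dr; apply: f0; lia.
  set cap := eval c _ in ec *.
  have E1 : update f d.+1 cap \o rho = f \o rho.
    by apply: funext => j /=; rewrite /update; have := rd j; case: eqP => [?|//]; lia.
  have E1j j : update f d.+1 cap (rho j) = f (rho j) by have := congr1 (@^~ j) E1.
  apply: does_seq (IHn _ _ _ V _ _ _ _ _) _ => //; try lia.
  + by move=> j; have := rd j; lia.
  + by move=> r dr; rewrite /update; case: eqP => [?|_]; [lia|apply: f0; lia].
  + by move=> j; rewrite E1j.
  rewrite E1; set num := eval n _ in en *.
  set f2 := update _ d.+2 num.
  have E2j j : f2 (rho j) = f (rho j).
    by rewrite /f2 /update; have := rd j; case: eqP => [?|_]; [lia|case: eqP => [?|//]; lia].
  have E2 : f2 \o rho = f \o rho by apply: funext => j /=.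
  apply: does_seq (IHx _ _ _ V _ _ _ _ _) _ => //; try lia.
  + by move=> j; have := rd j; lia.
  + move=> r dr; rewrite /f2 /update; case: eqP => [?|_]; [lia|].
    by case: eqP => [?|_]; [lia|apply: f0; lia].
  + by move=> j; rewrite E2j.
  rewrite E2; set y := eval x _ in ex *.
  pose step := fun i z => eval s (scons i (scons z (f \o rho))).
  have d0 r : d <= r -> f r = 0 by exact: f0.
  (* The registers at the head of the loop after [i] rounds: accumulator, cap, rounds left, index.
     The index counts upwards because [capped_rec] applies its step to 0 first. *)
  pose st i z : nat -> nat := update (update (update (update f d z) d.+1 cap)
     d.+2 (num - i)) d.+3 i.
  have addmin z z' i : z = 0 -> does (add_min d d.+4 d.+4.+1 d.+4.+2 d.+1)
      (update (st i z) d.+4 z') (st i (minn z' cap)).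
    move=> z0; apply: does_eq (does_add_min _ _ _ _ _ _ _ _ _) _; try lia.
    + by rewrite /= !inE; lia.
    + rewrite /st /update; repeat (case: eqP => [?|_]; [lia|]); apply: d0; lia.
    + rewrite /st /update; repeat (case: eqP => [?|_]; [lia|]); apply: d0; lia.
    + have -> : update (st i z) d.+4 z' d = z.
        by rewrite /st /update !eqxx; repeat (case: eqP => [?|_]; [lia|]).
      have -> : update (st i z) d.+4 z' d.+1 = cap.
        by rewrite /st /update !eqxx; repeat (case: eqP => [?|_]; [lia|]).
      by lia.
    + have e4 : f d.+4 = 0 by apply: d0; lia.
      by rewrite /st; upd.
  apply: (does_seq (g := st 0 (minn y cap))).
    have -> : update f2 d.+4 y = update (st 0 0) d.+4 y.
      apply: funext; rewrite /f2 /st.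
      have e0 := d0 d (leqnn d); have e3 : f d.+3 = 0 by apply: d0; lia.
      by upd.
    exact: addmin.
  pose acc i := capped_rec cap i y step.
  have loop m i : i + m = num ->
    does (while_pos d.+2 (Seq (dec d.+2)
             (Seq (compile s (scons d.+3 (scons d rho)) d.+4)
             (Seq (clear d) (Seq (add_min d d.+4 d.+4.+1 d.+4.+2 d.+1) (inc d.+3))))))
      (st i (acc i)) (st num (acc num)).
    elim: m i => [|m IH] i im.
      have -> : i = num by lia.
      apply: does_while0; first by lia.
      by rewrite /st /update eqxx; case: eqP => [?|_]; [lia|rewrite subnn].
    apply: (does_while (g := st i.+1 (acc i.+1))); first by lia.
    - by rewrite /st /update eqxx; case: eqP => [?|_]; lia.
    - pose st' z := update (st i z) d.+2 (num - i).-1.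
      apply: (does_seq (g := st' (acc i))).
        apply: does_eq (does_dec _ _) _; first by lia.
        rewrite /st'; move=> r; rewrite /update /st /update.
        by repeat (case: eqP => ?; subst); try done; lia.
      have E3 z : st' z \o scons d.+3 (scons d rho) = scons i (scons z (f \o rho)).
        apply: funext => -[|[|j]] /=; rewrite /st' /st /update.
        + by rewrite eqxx; case: eqP => // ?; lia.
        + by rewrite eqxx; repeat (case: eqP => [?|_]; [lia|]).
        + by have := rd j; repeat (case: eqP => [?|_]; [lia|]).
      have accc : acc i <= cap by exact: capped_rec_le.
      have EV j : scons i (scons (acc i) (f \o rho)) j <=
          V + (value_bound c V + value_bound n V + value_bound x V).
        case: j => [|[|j]] /=; try lia.
        by have := fV j; lia.
      apply: does_seq (IHs _ _ _ (V + (value_bound c V + value_bound n V + value_bound x V)) _ _ _ _ _) _; try lia.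
      + by case=> [|[|j]] /=; [lia|lia|have := rd j; lia].
      + move=> r dr; rewrite /st' /st /update.
        by repeat (case: eqP => [?|_]; [lia|]); apply: d0; lia.
      + by move=> j; have := EV j; rewrite -E3.
      rewrite E3 -/(step i (acc i)).
      apply: does_seq (does_clear _) _; first by lia.
      pose st2 i z := update (st i z) d.+2 (num - i.+1).
      have addmin' z' : does (add_min d d.+4 d.+4.+1 d.+4.+2 d.+1)
          (update (st2 i 0) d.+4 z') (st2 i (minn z' cap)).
        apply: does_eq (does_add_min _ _ _ _ _ _ _ _ _) _; try lia.
        + by rewrite /= !inE; lia.
        + rewrite /st2 /st /update; repeat (case: eqP => [?|_]; [lia|]); apply: d0; lia.
        + rewrite /st2 /st /update; repeat (case: eqP => [?|_]; [lia|]); apply: d0; lia.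
        + have -> : update (st2 i 0) d.+4 z' d = 0.
            by rewrite /st2 /st /update !eqxx; repeat (case: eqP => [?|_]; [lia|]).
          have -> : update (st2 i 0) d.+4 z' d.+1 = cap.
            by rewrite /st2 /st /update !eqxx; repeat (case: eqP => [?|_]; [lia|]).
          by lia.
        + have e4 : f d.+4 = 0 by apply: d0; lia.
          by rewrite /st2 /st; upd.
      apply: (does_seq (g := st2 i (acc i.+1))).
        have -> : update (update (st' (acc i)) d.+4 (step i (acc i))) d 0 =
            update (st2 i 0) d.+4 (step i (acc i)).
          apply: funext; rewrite /st' /st2 /st.
          by upd.
        exact: addmin'.
      apply: does_eq (does_inc _ _) _; first by lia.
        have -> : st2 i (acc i.+1) d.+3 = i.
          by rewrite /st2 /st /update !eqxx; repeat (case: eqP => [?|_]; [lia|]).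
        by lia.
      by rewrite /st2 /st; upd.
    - by apply: IH; lia.
  apply: does_seq (loop num 0 _) _; first by lia.
  apply: does_seq (does_clear _) _; first by lia.
  apply: does_eq (does_clear _) _; first by lia.
  have e1 : f d.+1 = 0 by apply: d0; lia.
  have e2 : f d.+2 = 0 by apply: d0; lia.
  have e3 : f d.+3 = 0 by apply: d0; lia.
  by rewrite /st; upd.
Qed.

End Compile.

(** * The machine that decides an expression *)

Definition token_value (t : token) : nat := val (token_code t).

(** [Tick] has value 0, so initial ticks are lost in the number; the length of the input is
    therefore kept beside it. *)
Definition tokens_value (w : seq token) : nat :=
  foldl (fun x t => 4 * x + token_value t) 0 w.

Definition env3 (a l b x : nat) : nat :=
  match x with 1 => l | 2 => b | _ => a end.

Lemma tokens_value_lt w : tokens_value w < 4 ^ size w.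
Proof.
suff H x y : x < y -> foldl (fun x t => 4 * x + token_value t) x w < y * 4 ^ size w.
  by rewrite -[4 ^ _]mul1n; apply: H.
elim: w x y => [|t w IH] x y xy; first by rewrite muln1.
rewrite /= expnS mulnA; apply: IH.
have : token_value t < 4 := ltn_ord _.
by move: xy; lia.
Qed.

Section Decider.
Variables (e : expr) (c : nat).
Hypothesis c2 : 2 <= c.

Definition width_expr : expr :=
  iter c (fun x => Mul x (Add (Var 1) (Const 2))) (Const 1).

Lemma eval_width v : eval width_expr v = (v 1 + 2) ^ c.
Proof.
rewrite /width_expr; elim: (c) => [|m IH] //=.
by rewrite IH expnS mulnC.
Qed.

Let times4 := Mul (Const 4) (Var 0).
Let plus (n : nat) := Add (Const n) (Var 0).
Let double := Add (Var 2) (Var 2).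

Definition used_exprs : seq expr :=
  [:: e; width_expr; times4; plus 1; plus 2; plus 3; double; Const 1; Const 0].

Definition used x : Prop := List.In x used_exprs.

Definition tapes_used : nat := \sum_(x <- used_exprs) registers_needed x + 9.

Local Notation k := tapes_used.
Local Notation prog := (@tape_program token bool k).
Local Notation compile := (@compile token k).
Local Notation clear := (@clear token k).
Local Notation move_to := (@move_to token k).
Local Notation inc := (@inc token k).
Local Notation dec := (@dec token k).

Definition rho3 (x : nat) : nat := if x < 3 then x else 0.

Definition assign (r : nat) (x : expr) : prog :=
  Seq (compile x rho3 4) (Seq (clear r) (move_to 4 r)).

Definition reads_token (t : token) (s : {ffun 'I_k.+1 -> option (token + bool)}) :=
  s ord0 == Some (inl t).

Definition advance : prog :=
  Act (act_at ord0 (fun a => (a, MoveRight))).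

Definition read_input : prog :=
  While (fun s : {ffun 'I_k.+1 -> option (token + bool)} => s ord0 != None)
 (Seq (assign 0 times4)
 (Seq (If (reads_token EndNumber) (assign 0 (plus 1)))
 (Seq (If (reads_token EndWord) (assign 0 (plus 2)))
 (Seq (If (reads_token EndSystem) (assign 0 (plus 3)))
 (Seq (inc 1) advance))))).

(** An expression is polynomially bounded in its variables, so from the input number, below [4 ^ n],
    none can produce a cap [2 ^ (n + 2) ^ c] for all [n] once [c] is at least 2. The program builds
    the cap by repeated doubling; only the number of doublings is an expression. *)
Definition decision_program : prog :=
  Seq read_input
 (Seq (assign 2 (Const 1))
 (Seq (assign 3 width_expr)
 (Seq (while_pos 3 (Seq (dec 3) (assign 2 double)))
      (assign 3 e)))).

Definition decider : turing_machine token :=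
  machine (fun s : {ffun 'I_k.+1 -> option (token + bool)} => s (reg k 3) != None)
    decision_program.

Definition memory (a l b x : nat) (r : nat) : nat :=
  match r with 0 => a | 1 => l | 2 => b | 3 => x | _ => 0 end.

Lemma memory_rho3 a l b x : memory a l b x \o rho3 = env3 a l b.
Proof. by apply: funext => -[|[|[|r]]]. Qed.

Section Bounds.
Variable w : seq token.
Let n := size w.
Let V := 2 ^ (n + 2) ^ c.
Variable Wd : nat.
Hypothesis bounds : forall x, used x -> value_bound x V < 2 ^ Wd.
Let Lin := n.+1.
Local Notation does := (@does token k Lin Wd).

Lemma used_needed x : used x -> registers_needed x + 9 <= k.
Proof.
move=> xu; rewrite /tapes_used leq_add2r.
move: xu; rewrite /used; elim: used_exprs => // y s IH; rewrite big_cons => -[->|/IH].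
  exact: leq_addr.
by move=> h; apply: leq_trans h (leq_addl _ _).
Qed.

Lemma tapes_used9 : 9 <= k.
Proof. exact: leq_addl. Qed.

Lemma does_assign r x a l b y : used x -> r < 4 ->
  a <= V -> l <= V -> b <= V ->
  does (assign r x) (memory a l b y)
    (update (memory a l b y) r (eval x (env3 a l b))).
Proof.
move=> xu r4 aV lV bV; have k9 := tapes_used9; have xk := used_needed xu.
have eV i : env3 a l b i <= V by case: i => [|[|[|i]]].
have evb := eval_bound x eV; have bx := bounds xu.
apply: does_seq.
  apply: (compile_correct (V := V)) => //.
  - by lia.
  - by case=> [|[|[|i]]].
  - by case=> [|[|[|[|i]]]].
  - by move=> i; have := eV i; rewrite -(memory_rho3 a l b y).
apply: does_seq; first by apply: does_clear; lia.
apply: does_eq.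
  apply: does_move_to; try lia.
  rewrite /update eqxx memory_rho3.
  have -> : (4 == r) = false by lia.
  by rewrite eqxx; lia.
have r4' : (4 == r) = false by lia.
move=> i; rewrite memory_rho3 /update !eqxx r4' /=.
case: (i =P 4) => [->|_]; first by rewrite r4'.
by case: (i =P r) => // _; have -> : (r == 4) = false by lia.
Qed.

Definition input_band l (v : seq token) : band token bool :=
  if v is t :: v' then Band l (Some (inl t)) [seq Some (inl x) | x <- v']
  else Band l None [::].

Lemma input_band_space l v : band_space (input_band l v) = size l + (size v).-1.+1.
Proof. by case: v => [|t v]; rewrite /band_space //= ?size_map addnS. Qed.

Lemma stores_update0 (ts : bands token bool k) f t : stores Lin Wd ts f -> band_space t <= Lin ->
  stores Lin Wd (update ts ord0 t) f.
Proof.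
move=> [ws rs] ht; split=> [i|r rk].
  by rewrite /update; case: eqP => [//|/eqP/negPf i0]; have := ws i; rewrite i0.
by rewrite /update (negPf (reg_neq0 rk)); apply: rs.
Qed.

Lemma does_if_token t p f g v l (ts : bands token bool k) :
  stores Lin Wd ts f -> ts ord0 = input_band l v ->
  (ohead v = Some t -> does p f g) -> (ohead v <> Some t -> g = f) ->
  exists ts', [/\ stores Lin Wd ts' g, ts' ord0 = ts ord0 &
    runs (within Lin Wd) (If (reads_token t) p) ts ts'].
Proof.
move=> st tsE h1 h2.
have cE : cells ts ord0 == Some (inl t) = (ohead v == Some t).
  by rewrite ffunE tsE; case: (v).
have [hv|hv] := eqVneq (ohead v) (Some t).
  have [ts' [st' e' r']] := h1 hv _ st; exists ts'; split=> //.
  by apply: runs_if => //; rewrite /reads_token cE hv.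
exists ts; split=> //; first by rewrite h2 //; apply/eqP.
apply: runs_if_false; first by case: st.
by rewrite /reads_token cE; exact: negbTE.
Qed.

Lemma V_bounds : 4 ^ n <= V /\ n <= V.
Proof.
have h : 4 ^ n <= V.
  rewrite -[4]/(2 ^ 2) -expnM leq_exp2l //.
  (* The input number fits below the cap because [c] is at least 2. *)
  apply: leq_trans (_ : (n + 2) ^ 2 <= _); first by rewrite -mulnn; lia.
  by rewrite leq_exp2l // addn2.
by split=> //; apply: leq_trans h; apply: ltnW; apply: ltn_expl.
Qed.

Lemma runs_read_input u v l (ts : bands token bool k) : w = u ++ v -> size l = size u ->
  stores Lin Wd ts (memory (tokens_value u) (size u) 0 0) ->
  ts ord0 = input_band l v ->
  exists ts', stores Lin Wd ts' (memory (tokens_value w) n 0 0) /\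
    runs (within Lin Wd) read_input ts ts'.
Proof.
elim: v u l ts => [|t v IH] u l ts wE lu st tsE.
  exists ts; split; first by rewrite /n wE cats0.
  by apply: runs_while_done; [case: st|rewrite ffunE tsE].
have k9 := tapes_used9.
have [ut4 uc1 up1 [up2 up3]] :
    [/\ used times4, used (Const 1), used (plus 1) & used (plus 2) /\ used (plus 3)].
  by rewrite /used /=; split; try split; auto 12.
have [V4 Vn] := V_bounds.
have nE : n = size u + (size v).+1 by rewrite /n wE size_cat.
have bu : 4 * tokens_value u + 3 < 4 ^ n.
  have := tokens_value_lt u; rewrite nE expnD expnS.
  have : 0 < 4 ^ size v by rewrite expn_gt0.
  move: (4 ^ size v) (4 ^ size u) => p q; nia.
pose f0 a := memory a (size u) 0 0.
have as0 x a : used x -> a <= V ->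
    does (assign 0 x) (f0 a) (f0 (eval x (env3 a (size u) 0))).
  move=> xu aV; apply: does_eq (does_assign _ _ _ _ _) _ => //; try lia.
  by case=> [|[|[|[|i]]]].
have [ts1 [st1 e1 r1]] := as0 times4 _ ut4 (ltac:(lia) : tokens_value u <= V) _ st.
have seqif ts2 t' m a : stores Lin Wd ts2 (f0 a) -> ts2 ord0 = ts ord0 ->
    used (plus m) -> a <= V ->
    exists ts3, [/\ stores Lin Wd ts3 (f0 (if t == t' then m + a else a)),
      ts3 ord0 = ts ord0 &
      runs (within Lin Wd) (If (reads_token t') (assign 0 (plus m))) ts2 ts3].
  move=> st2 e2 pm aV; rewrite -e2; apply: does_if_token st2 _ _ _.
  - by rewrite e2 tsE; reflexivity.
  - by move=> [->]; rewrite eqxx; apply: as0.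
  - by move=> h; case: eqP => // tt; case: h; rewrite tt.
have [ts2 [st2 e2 r2]] := seqif ts1 EndNumber 1 _ st1 e1 up1 (ltac:(rewrite /=; lia)).
have [ts3 [st3 e3 r3]] := seqif ts2 EndWord 2 _ st2 e2 up2 (ltac:(rewrite /=; case: ifP => _; lia)).
have [ts4 [st4 e4 r4]] := seqif ts3 EndSystem 3 _ st3 e3 up3 (ltac:(rewrite /=; do 2 case: ifP => _; lia)).
have sb : (size u).+1 < 2 ^ Wd by move: (bounds ut4); rewrite /=; lia.
have k1 : 1 < k by lia.
have [ts5 [st5 e5 r5]] := @does_inc token k Lin Wd 1 (f0 _) k1 sb _ st4.
pose ts6 := update ts5 ord0 (input_band (Some (inl t) :: l) v).
have sp6 : band_space (input_band (Some (inl t) :: l) v) <= Lin.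
  by rewrite input_band_space /= lu /Lin nE; lia.
have actE : act_all (act_at ord0 (fun a => (a, MoveRight)) (cells ts5)) ts5 = ts6.
  apply: funext => i; rewrite /act_all /act_at /ts6 /update !ffunE.
  case: eqP => [->|_]; last by case: (ts5 i).
  by rewrite e5 e4 tsE /=; case: (v).
have st6' : stores Lin Wd ts6 (memory (tokens_value (rcons u t)) (size (rcons u t)) 0 0).
  have -> : memory (tokens_value (rcons u t)) (size (rcons u t)) 0 0 =
      update (f0 (tokens_value (rcons u t))) 1 (size u).+1.
    by apply: funext => -[|[|[|[|i]]]] //=; rewrite /update /= size_rcons.
  apply: stores_update0 => //; move: st5.
  congr stores; apply: funext => i; congr (update (f0 _) 1 _ i).
  rewrite /tokens_value foldl_rcons -/(tokens_value u) /token_value.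
  by case: (t); do 3 (case: eqP => // _); rewrite /= inordK //; lia.
have r6 : runs (within Lin Wd) advance ts5 ts6.
  rewrite -actE; apply: runs_act; first by case: st5.
  by rewrite actE; case: st6'.
have [ts7 [st7 r7]] := IH (rcons u t) (Some (inl t) :: l) ts6
  (ltac:(by rewrite wE cat_rcons)) (ltac:(by rewrite /= size_rcons lu)) st6'
  (ltac:(by rewrite /ts6 /update eqxx)).
exists ts7; split=> //.
apply: runs_while _ r7; first by rewrite ffunE tsE.
apply: runs_seq r1 (runs_seq r2 (runs_seq r3 (runs_seq r4 (runs_seq r5 r6)))).
Qed.

Lemma does_decision (ts : bands token bool k) : stores Lin Wd ts (memory (tokens_value w) n 0 0) ->
  exists ts', stores Lin Wd ts'
    (memory (tokens_value w) n V (eval e (env3 (tokens_value w) n V))) /\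
    runs (within Lin Wd)
      (Seq (assign 2 (Const 1)) (Seq (assign 3 width_expr)
        (Seq (while_pos 3 (Seq (dec 3) (assign 2 double))) (assign 3 e)))) ts ts'.
Proof.
move=> st; have [V4 Vn] := V_bounds.
have aV : tokens_value w <= V by apply: leq_trans V4; apply: ltnW; apply: tokens_value_lt.
have k9 := tapes_used9.
set a := tokens_value w in st aV *.
have V0 : 0 < V by rewrite expn_gt0.
have [uc1 uw ud ue] : [/\ used (Const 1), used width_expr, used double & used e].
  by rewrite /used /=; split; try split; auto 12.
suff H : does (Seq (assign 2 (Const 1)) (Seq (assign 3 width_expr)
        (Seq (while_pos 3 (Seq (dec 3) (assign 2 double))) (assign 3 e))))
    (memory a n 0 0) (memory a n V (eval e (env3 a n V))).
  by have [ts' [st' _ r']] := H _ st; exists ts'.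
have eq4 f g : (forall i, i < 4 -> f i = g i) -> (forall i, f i.+4 = g i.+4) -> f =1 g.
  by move=> h1 h2 [|[|[|[|i]]]] //; exact: h1.
apply: (does_seq (g := memory a n 1 0)).
  apply: does_eq (does_assign _ _ _ _ _) _ => //.
  by case=> [|[|[|[|i]]]].
apply: (does_seq (g := memory a n 1 ((n + 2) ^ c))).
  apply: does_eq (does_assign _ _ _ _ _) _ => //.
  by case=> [|[|[|[|i]]]] //=; rewrite /update /= eval_width.
apply: (does_seq (g := memory a n V 0)).
  have key m j : m + j = (n + 2) ^ c ->
      does (while_pos 3 (Seq (dec 3) (assign 2 double)))
        (memory a n (2 ^ m) j) (memory a n V 0).
    elim: j m => [|j IH] m mj.
      apply: does_eq (does_while0 _ _ _ _) _ => //; first by lia.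
      by rewrite /V -mj addn0.
    apply: (does_while (g := memory a n (2 ^ m.+1) j)) => //; first by lia.
      apply: (does_seq (g := memory a n (2 ^ m) j)).
        apply: does_eq (does_dec _ _) _; first by lia.
        by case=> [|[|[|[|i]]]].
      apply: does_eq (does_assign _ _ _ _ _) _ => //.
        by rewrite leq_exp2l //; lia.
      by case=> [|[|[|[|i]]]] //=; rewrite /update /= expnS mul2n addnn.
    by apply: IH; lia.
  by apply: (key 0); rewrite add0n.
apply: does_eq (does_assign _ _ _ _ _) _ => //.
by case=> [|[|[|[|i]]]].
Qed.

Definition start_bands : bands token bool k :=
  fun i => if i == ord0 then input_band [::] w else Band [::] None [::].

Lemma decider_run P :
  (0 < eval e (env3 (tokens_value w) n V) <-> P) ->
  decides_in_space decider w P (k.+1 * (n + Wd + 3)).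
Proof.
move=> HP; have k9 := tapes_used9.
have st0 : stores Lin Wd start_bands (memory (tokens_value [::]) (size (Nil token)) 0 0).
  split=> [i|r rk].
    rewrite /start_bands; case: eqP => // _.
    by rewrite input_band_space /Lin /=; lia.
  rewrite /start_bands (negPf (reg_neq0 rk)).
  by exists [::], [::], 0; split=> //; [left|case: r rk => [|[|[|[|r]]]]].
have [ts1 [st1 r1]] := @runs_read_input [::] w [::] _ (erefl _) (erefl _) st0
  (erefl _ : start_bands ord0 = _).
have [ts2 [st2 r2]] := does_decision st1.
have r := runs_seq r1 r2.
have sp (us : bands token bool k) : within Lin Wd us -> \sum_i band_space (us i) <= k.+1 * (n + Wd + 3).
  move=> ws; apply: leq_trans (_ : \sum_(i < k.+1) (n + Wd + 3) <= _).
    apply: leq_sum => i _; apply: leq_trans (ws i) _.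
    by rewrite /Lin; case: ifP => _; lia.
  by rewrite sum_nat_const card_ord.
have init_eq : init decider w = @config_of token bool k
    (fun s : {ffun 'I_k.+1 -> option (token + bool)} => s (reg k 3) != None)
    decision_program (inl (Some (entry decision_program))) start_bands.
  rewrite /init /config_of; congr pair; apply: funext => i.
  by rewrite /start_bands; case: eqP => // _; case: (w).
have [[m hm] hs] := runs_machine
  (fun s : {ffun 'I_k.+1 -> option (token + bool)} => s (reg k 3) != None) sp r.
split; last by move=> m'; rewrite /run init_eq; exact: hs.
exists m, (0 < eval e (env3 (tokens_value w) n V)); split=> //.
rewrite /run init_eq; rewrite hm; congr Some.
have -> : (cells ts2 (reg k 3) != None) = (0 < memory (tokens_value w) n V
  (eval e (env3 (tokens_value w) n V)) 3) by apply: stores_cell st2; lia.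
by [].
Qed.

End Bounds.

Lemma decider_correct : exists K, forall w P,
  (0 < eval e (env3 (tokens_value w) (size w) (2 ^ (size w + 2) ^ c)) <-> P) ->
  decides_in_space decider w P (K * (size w + 2) ^ c).
Proof.
have [D HD] : exists D, forall V, 2 <= V ->
    forall x, used x -> value_bound x V <= V ^ D.
  rewrite /used; elim: used_exprs => [|x s [D HD]]; first by exists 0.
  have [D' HD'] := value_bound_poly x.
  exists (D + D') => V V2 y [<-|ys].
    by apply: leq_trans (HD' _ V2) _; rewrite leq_exp2l // leq_addl.
  by apply: leq_trans (HD _ V2 _ ys) _; rewrite leq_exp2l // leq_addr.
(* There are [k.+1] tapes, and with width [q * D + 1] and [n < q] the space [n + Wd + 3] of each is
   at most [q * (D + 5)]. *)
exists (k.+1 * (D + 5)) => w P HP.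
pose n := size w; pose q := (n + 2) ^ c.
have nq : n < q.
  apply: leq_trans (_ : (n + 2) ^ 1 <= _); first by rewrite expn1; lia.
  by rewrite leq_exp2l //; lia.
have V2 : 2 <= 2 ^ q by rewrite -{1}[2]expn1 leq_exp2l //; lia.
have bd x : used x -> value_bound x (2 ^ q) < 2 ^ (q * D).+1.
  move=> xu; apply: leq_ltn_trans (HD _ V2 _ xu) _.
  by rewrite -expnM ltn_exp2l.
have [h1 h2] := @decider_run w (q * D).+1 bd P HP.
split=> // m; apply: leq_trans (h2 m) _.
rewrite -mulnA leq_mul2l /= -/n -/q.
by nia.
Qed.

End Decider.

(** * Geodesics and finite subgroups *)

Section CommonPrefix.
Variable X : eqType.
Implicit Types s t u : seq X.

Fixpoint common_prefix s t : nat :=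
  match s, t with
  | a :: s', b :: t' => if a == b then (common_prefix s' t').+1 else 0
  | _, _ => 0
  end.

Lemma common_prefixP n s t : (n <= common_prefix s t) =
  [&& n <= size s, n <= size t & take n s == take n t].
Proof.
elim: s t n => [|a s IH] [|b t] [|n] //=; first by rewrite andbF.
case: eqVneq => [->|ab]; first by rewrite ltnS IH !ltnS eqseq_cons eqxx.
by rewrite eqseq_cons (negPf ab) !andbF.
Qed.

(** The ultrametric inequality in the tree of words. *)
Lemma common_prefix_trans m s t u :
  m <= common_prefix s t -> m <= common_prefix t u -> m <= common_prefix s u.
Proof.
by rewrite !common_prefixP => /and3P[-> _ /eqP->] /and3P[_ -> /eqP->] /=.
Qed.

Lemma common_prefix_le s t : common_prefix s t <= minn (size s) (size t).
Proof.
by have := leqnn (common_prefix s t); rewrite common_prefixP leq_min => /and3P[-> ->].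
Qed.

Lemma common_prefix_take s t :
  take (common_prefix s t) s = take (common_prefix s t) t.
Proof. by have := leqnn (common_prefix s t); rewrite common_prefixP => /and3P[_ _ /eqP]. Qed.

Lemma common_prefix_refl s : common_prefix s s = size s.
Proof. by elim: s => //= a s ->; rewrite eqxx. Qed.

End CommonPrefix.

Section Geometry.
Local Open Scope group_scope.
Variables (G : groupType) (X : eqType) (gen : X -> G) (nf : G -> seq X) (C : nat).

Definition word_value (w : seq X) : G := \prod_(a <- w) gen a.

(* [nf] selects unique geodesics, and those to neighbours branch late. *)
Hypothesis nfK : forall g, word_value (nf g) = g.
Hypothesis nf_min : forall w, size (nf (word_value w)) <= size w.
Hypothesis nf_unique : forall w, size w = size (nf (word_value w)) ->
  w = nf (word_value w).
Hypothesis gen_inv : forall a, exists b, gen b = (gen a)^-1.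
Hypothesis nf_gen : forall g a,
  size (nf g) <= common_prefix (nf g) (nf (g * gen a)) + C.

Lemma word_value_nil : word_value [::] = 1.
Proof. by rewrite /word_value big_nil. Qed.

Lemma word_value_cons a w : word_value (a :: w) = gen a * word_value w.
Proof. by rewrite /word_value big_cons. Qed.

Lemma word_value_cat u v : word_value (u ++ v) = word_value u * word_value v.
Proof.
elim: u => [|a u IH]; first by rewrite word_value_nil mul1g.
by rewrite cat_cons !word_value_cons IH mulgA.
Qed.

Lemma word_value_inv w : exists v, size v = size w /\ word_value v = (word_value w)^-1.
Proof.
elim: w => [|a w [v [sv vE]]]; first by exists [::]; rewrite word_value_nil invg1.
have [b bE] := gen_inv a; exists (v ++ [:: b]); split.
  by rewrite size_cat sv addn1.
by rewrite word_value_cat word_value_cons word_value_nil mulg1 word_value_cons invgM vE bE.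
Qed.

Definition glen (g : G) : nat := size (nf g).
Definition gdist (g h : G) : nat := glen (g^-1 * h).

Lemma glen_word w : glen (word_value w) <= size w. Proof. exact: nf_min. Qed.

Lemma glen1 : glen 1 = 0.
Proof. by have := nf_min [::]; rewrite word_value_nil /glen; case: size. Qed.

Lemma glenM g h : glen (g * h) <= glen g + glen h.
Proof. by rewrite -{1}(nfK g) -{1}(nfK h) -word_value_cat -size_cat glen_word. Qed.

Lemma glenV g : glen g^-1 = glen g.
Proof.
suff H x : glen x^-1 <= glen x by apply/eqP; rewrite eqn_leq H -{1}(invgK g) H.
have [v [sv vE]] := word_value_inv (nf x).
by rewrite nfK in vE; rewrite -vE; apply: leq_trans (glen_word v) _; rewrite sv.
Qed.

Lemma gdistC g h : gdist g h = gdist h g.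
Proof. by rewrite /gdist -glenV invgM invgK. Qed.

Lemma gdist1 g : gdist 1 g = glen g.
Proof. by rewrite /gdist invg1 mul1g. Qed.

Lemma gdistM a g h : gdist (a * g) (a * h) = gdist g h.
Proof. by rewrite /gdist invgM -mulgA mulKg. Qed.

Lemma gdist_triangle h g k : gdist g k <= gdist g h + gdist h k.
Proof. by rewrite /gdist -{1}(mulVKg h k) mulgA glenM. Qed.

Lemma glen_take g t : t <= glen g -> glen (word_value (take t (nf g))) = t.
Proof.
move=> tg; apply/eqP; rewrite eqn_leq; apply/andP; split.
  by apply: leq_trans (glen_word _) _; rewrite size_takel.
have := glenM (word_value (take t (nf g))) (word_value (drop t (nf g))).
rewrite -word_value_cat cat_take_drop nfK.
have := glen_word (drop t (nf g)); rewrite size_drop -/(glen g); lia.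
Qed.

Lemma glen_drop g t : t <= glen g -> glen (word_value (drop t (nf g))) = glen g - t.
Proof.
move=> tg; apply/eqP; rewrite eqn_leq; apply/andP; split.
  by apply: leq_trans (glen_word _) _; rewrite size_drop.
have := glenM (word_value (take t (nf g))) (word_value (drop t (nf g))).
by rewrite -word_value_cat cat_take_drop nfK glen_take //; lia.
Qed.

(** Joining the normal forms of [g] and [h] gives a word of minimal length, which by uniqueness is
    the normal form of the product. *)
Lemma between_unique g h : glen g + glen h = glen (g * h) ->
  g = word_value (take (glen g) (nf (g * h))).
Proof.
move=> E; have := nf_unique (w := nf g ++ nf h).
rewrite word_value_cat !nfK size_cat => /(_ E) <-.
by rewrite take_size_cat ?nfK.
Qed.

Local Notation cp g h := (common_prefix (nf g) (nf h)).

(** Together with [cp_lower] this says that the common prefix is, up to [C], the Gromov product of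
    [g] and [h]: the group looks like a tree. Here the common prefix simply cancels in
    [g^-1 * h]. *)
Lemma cp_upper g h : cp g h + cp g h + gdist g h <= glen g + glen h.
Proof.
set k := cp g h; have := common_prefix_le (nf g) (nf h).
rewrite -/k leq_min => /andP[kg kh].
have E : g^-1 * h = (word_value (drop k (nf g)))^-1 * word_value (drop k (nf h)).
  have gE : g = word_value (take k (nf g)) * word_value (drop k (nf g)).
    by rewrite -word_value_cat cat_take_drop nfK.
  have hE : h = word_value (take k (nf g)) * word_value (drop k (nf h)).
    by rewrite /k common_prefix_take -word_value_cat cat_take_drop nfK.
  by rewrite {1}gE {1}hE invgM -mulgA mulKg.
have := glenM (word_value (drop k (nf g)))^-1 (word_value (drop k (nf h))).
by rewrite -E glenV !glen_drop // /gdist; move: kg kh; rewrite -!/(glen _); lia.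
Qed.

(** Neighbours along the path branch late, and by the ultrametric inequality the loss [C] is paid
    once and not at every step. *)
Lemma cp_path m w g :
  (forall k, k <= size w -> m <= glen (g * word_value (take k w))) ->
  m <= cp g (g * word_value w) + C.
Proof.
elim: w g => [|a w IH] g H.
  have := H 0 isT; rewrite !word_value_nil mulg1 common_prefix_refl.
  by move=> h; apply: leq_trans h (leq_addr _ _).
have H0 : m <= glen g by have := H 0 isT; rewrite take0 word_value_nil mulg1.
have h1 : m - C <= cp g (g * gen a).
  by have := nf_gen g a; rewrite -/(glen g); lia.
have h2 : m - C <= cp (g * gen a) (g * word_value (a :: w)).
  rewrite word_value_cons mulgA leq_subLR addnC; apply: IH => k kw.
  by have := H k.+1 kw; rewrite /= word_value_cons mulgA.
by have := common_prefix_trans h1 h2; lia.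
Qed.

(** By the triangle inequality a geodesic from [g] to [h] never comes closer to 1 than the Gromov
    product, so [cp_path] applies to it. *)
Lemma cp_lower g h : glen g + glen h <= gdist g h + (cp g h + cp g h) + (C + C).
Proof.
have [w wE] : exists w, w = nf (g^-1 * h) by eexists.
have [n nE] : exists n, n = gdist g h by eexists.
have sw : size w = n by rewrite wE nE.
have hE : g * word_value w = h by rewrite wE nfK mulVKg.
suff H : uphalf (glen g + glen h - n) <= cp g h + C.
  by rewrite -nE; move: H; rewrite uphalf_half; lia.
rewrite -{2}hE; apply: cp_path => k kw.
have [x xE] : exists x, x = g * word_value (take k w) by eexists.
rewrite -xE.
have gx : glen g <= glen x + k.
  have := glenM x (word_value (take k w))^-1; rewrite {1}xE mulgK glenV.
  by have := glen_word (take k w); rewrite size_takel //; lia.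
have hx : glen h <= glen x + (n - k).
  have -> : h = x * word_value (drop k w).
    by rewrite xE -mulgA -word_value_cat cat_take_drop hE.
  have := glenM x (word_value (drop k w)).
  by have := glen_word (drop k w); rewrite size_drop sw; lia.
by move: kw; rewrite sw uphalf_half; lia.
Qed.

(** Take [x] with the least maximal distance to the finite subgroup [F]. Each [f * x] is as central
    as [x]; if it were far from [x], the midpoint between them would be more central still. *)
Lemma bounded_centre (F : seq G) : 1 \in F ->
  (forall f y, f \in F -> y \in F -> f^-1 * y \in F) ->
  exists x, forall f, f \in F -> glen (x^-1 * f * x) <= 4 * C + 1.
Proof.
move=> F1 FV; pose rho x := \max_(y <- F) gdist x y.
have [n [x xn] nmin] : exists2 n, exists x, rho x = n &
    forall z, n <= rho z.
  have ex : exists n, `[< exists x, rho x = n >].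
    by exists (rho 1); apply/asboolP; exists 1.
  case: (ex_minnP ex) => n /asboolP xn nmin; exists n => // z.
  by apply: nmin; apply/asboolP; exists z.
have rho_ge z y : y \in F -> gdist z y <= rho z.
  by move=> yF; rewrite /rho (big_rem y) //= leq_maxl.
have rho_lt z m : (forall y, y \in F -> gdist z y < m) -> rho z < m.
  have m0 : (forall y, y \in F -> gdist z y < m) -> 0 < m.
    by move=> H; apply: leq_ltn_trans (H 1 F1).
  move=> H; have {m0} m0 := m0 H; rewrite /rho big_seq.
  by elim/big_ind: _ => // a b; rewrite gtn_max => -> ->.
exists x => f fF; rewrite leqNgt; apply/negP => big.
have rf : rho (f * x) <= n.
  rewrite -ltnS; apply: rho_lt => y yF.
  rewrite ltnS -xn -{1}(mulVKg f y) gdistM; apply: rho_ge; exact: FV.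
pose w := nf (x^-1 * (f * x)); pose D := gdist x (f * x).
have DE : D = size w by [].
have D4 : 4 * C + 1 < D by rewrite /D /gdist mulgA.
(* As [D] exceeds [4 * C + 1], half of it exceeds the error [2 * C] of [cp_lower]. *)
pose t := D./2; have tD : t <= D by rewrite /t; lia.
pose z := x * word_value (take t w).
have xz : gdist z x = t.
  by rewrite gdistC /gdist /z mulKg glen_take.
have zfx : gdist z (f * x) = D - t.
  rewrite /gdist; have -> : z^-1 * (f * x) = word_value (drop t w).
    rewrite /z invgM -mulgA -{1}(nfK (x^-1 * (f * x))) -/w.
    by rewrite -{2}(cat_take_drop t w) word_value_cat mulKg.
  by rewrite glen_drop.
have := nmin z; rewrite leqNgt => /negP; apply.
rewrite -xn; apply: rho_lt => y yF.
pose c u v := cp (z^-1 * u) (z^-1 * v).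
have cfx : c x (f * x) = 0.
  have := cp_upper (z^-1 * x) (z^-1 * (f * x)).
  by rewrite gdistM -!/(gdist z _) xz zfx -/D /c; lia.
have xy := cp_lower (z^-1 * x) (z^-1 * y).
have yfx := cp_lower (z^-1 * y) (z^-1 * (f * x)).
rewrite !gdistM -!/(gdist z _) xz ?zfx in xy yfx.
have ry : gdist x y <= rho x by exact: rho_ge.
have rfy : gdist y (f * x) <= rho x by rewrite gdistC xn; apply: leq_trans rf; exact: rho_ge.
have [cxy|cxy] := posnP (c x y).
  by rewrite -/(c x y) cxy in xy; move: tD D4; rewrite /t in xy *; lia.
have [cyf|cyf] := posnP (c y (f * x)).
  by rewrite -/(c _ _) cyf in yfx; move: tD D4; rewrite /t in yfx *; lia.
by have := common_prefix_trans cxy cyf; rewrite -/(c _ _) cfx.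
Qed.

(** Read backwards from [x], the geodesic to 1 passes through elements lying between 1 and [x], and
    these are unique for their length. *)
Lemma reverse_geodesic x t : t <= glen x ->
  x * word_value (take t (nf x^-1)) = word_value (take (glen x - t) (nf x)).
Proof.
move=> tx; have tx' : t <= glen x^-1 by rewrite glenV.
set z := x * _.
have zE : z = (word_value (drop t (nf x^-1)))^-1.
  apply: (mulIg (word_value (drop t (nf x^-1)))).
  by rewrite mulVg /z -mulgA -word_value_cat cat_take_drop nfK mulgV.
have lz : glen z = glen x - t by rewrite zE glenV glen_drop // glenV.
have xz : x = z * (word_value (take t (nf x^-1)))^-1 by rewrite /z mulgK.
rewrite {1}(@between_unique z (word_value (take t (nf x^-1)))^-1); rewrite -xz ?lz //.
by rewrite glenV glen_take //; lia.
Qed.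

Section Conjugator.
Variables (x : G) (K : nat).
Local Notation ray t := (word_value (take t (nf x))).

(* An element moving both ends of a long geodesic a little shifts its middle. *)
Lemma shift_geodesic f s : glen f <= K -> glen (x^-1 * f * x) <= K ->
  K + C <= s -> s + 2 * K + C <= glen x ->
  f * ray s = ray (s + glen (f * x) - glen x) /\
  s <= s + glen (f * x) - glen x + K /\ s + glen (f * x) - glen x <= s + K.
Proof.
move=> fK fxK s1 s2.
have d1 : gdist x (f * x) <= K by rewrite /gdist mulgA.
have t1 := gdist_triangle x 1 (f * x); have t2 := gdist_triangle (f * x) 1 x.
rewrite !gdist1 [gdist (f * x) x]gdistC in t1 t2.
split; last by lia.
(* Seen from 1, the geodesics to [x] and [f * x] share a long beginning; seen from [f * x], those to
   1 and to [f] do. In the middle, the translate by [f] of the geodesic to [x] therefore lies on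
   that geodesic. *)
have a1 := cp_lower x (f * x).
have a2 := cp_lower ((f * x)^-1 * 1) ((f * x)^-1 * f).
have E1 : (f * x)^-1 * f = x^-1 by rewrite invgM -mulgA mulVg mulg1.
rewrite gdistM gdist1 E1 mulg1 !glenV in a2.
set u := cp x (f * x) in a1; set v := cp (f * x)^-1 x^-1 in a2.
pose t := glen x - s.
have tv : t <= v by rewrite /t; lia.
have := tv; rewrite /v common_prefixP -/(glen (f * x)^-1) -/(glen x^-1) !glenV.
move=> /and3P[tfx tx /eqP tE].
have sE : s = glen x - t by rewrite /t; lia.
rewrite {1}sE -reverse_geodesic // mulgA -tE reverse_geodesic //.
have -> : glen (f * x) - t = s + glen (f * x) - glen x by lia.
have : s + glen (f * x) - glen x <= u by lia.
by rewrite /u common_prefixP => /and3P[_ _ /eqP->].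
Qed.

(** The shift [glen (f * x) - glen x] is additive in [f], because shifts of the middle compose. On a
    finite set closed under products its extrema must vanish, so every [f] fixes a point of the
    geodesic and is 1. *)
Lemma conjugator_bound (F : seq G) :
  (forall f g, f \in F -> g \in F -> f * g \in F) ->
  (forall f, f \in F -> glen f <= K) ->
  (forall f, f \in F -> glen (x^-1 * f * x) <= K) ->
  5 * K + 2 * C <= glen x -> forall f, f \in F -> f = 1.
Proof.
(* The position [s] and all its shifts by at most [K] must satisfy the bounds of [shift_geodesic];
   the largest, [3 * K + C], needs [glen x] to be [5 * K + 2 * C]. *)
move=> FM FK FxK xL; pose s := 2 * K + C.
have ray_inj t t' : t <= glen x -> t' <= glen x -> ray t = ray t' -> t = t'.
  by move=> tx t'x /(congr1 glen); rewrite !glen_take.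
have sh f t : f \in F -> K + C <= t -> t + 2 * K + C <= glen x ->
  f * ray t = ray (t + glen (f * x) - glen x) /\
  t <= t + glen (f * x) - glen x + K /\ t + glen (f * x) - glen x <= t + K.
  by move=> fF; apply: shift_geodesic; [apply: FK|apply: FxK].
have ge f : f \in F -> glen x <= glen (f * x) + K /\ glen (f * x) <= glen x + K.
  move=> fF; have := FxK f fF; rewrite -mulgA -/(gdist x (f * x)) => d1.
  have := gdist_triangle (f * x) 1 x; have := gdist_triangle x 1 (f * x).
  by rewrite !gdist1 [gdist (f * x) x]gdistC; lia.
have add f g : f \in F -> g \in F ->
    glen (f * g * x) + glen x = glen (f * x) + glen (g * x).
  move=> fF gF; have [eg [g1 g2]] := sh g s gF (ltac:(rewrite /s; lia)) (ltac:(rewrite /s; lia)).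
  set t := s + glen (g * x) - glen x in eg g1 g2.
  have [ef [f1 f2]] := sh f t fF (ltac:(rewrite /s in g1 *; lia)) (ltac:(rewrite /s in g2 *; lia)).
  have [efg [h1 h2]] := sh _ s (FM _ _ fF gF) (ltac:(rewrite /s; lia)) (ltac:(rewrite /s; lia)).
  have := ge _ fF; have := ge _ gF; have := ge _ (FM _ _ fF gF) => q1 q2 q3.
  rewrite -mulgA eg ef in efg; have := ray_inj _ _ _ _ efg.
  by rewrite /t /s in g1 g2 f1 f2 h1 h2 *; lia.
move=> f fF.
have extremal (P : rel nat) : ssrbool.reflexive P -> ssrbool.transitive P -> ssrbool.total P ->
    exists2 g, g \in F & forall h, h \in F -> P (glen (g * x)) (glen (h * x)).
  move=> Pr Pt Ptot; have : F != [::] by case: (F) fF.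
  elim: (F) => // a F' IH _; case: (eqVneq F' [::]) => [->|F'0].
    by exists a; rewrite ?inE // => h; rewrite inE => /eqP->; exact: Pr.
  have [g gF gm] := IH F'0; case/orP: (Ptot (glen (a * x)) (glen (g * x))) => ag.
    exists a; first by rewrite inE eqxx.
    by move=> h; rewrite inE => /orP[/eqP->|/gm]; [exact: Pr|exact: Pt].
  exists g; first by rewrite inE gF orbT.
  by move=> h; rewrite inE => /orP[/eqP->//|/gm].
(* The squares of a minimal and of a maximal element shift twice as far, so both shifts are zero. *)
have [g gF gmin] := extremal leq leqnn leq_trans leq_total.
have [h hF hmax] := extremal (fun a b => b <= a) leqnn
  (fun b a c ba cb => leq_trans cb ba) (fun a b => leq_total b a).
have gE := add _ _ gF gF; have hE := add _ _ hF hF.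
have := gmin _ (FM _ _ gF gF); have := hmax _ (FM _ _ hF hF).
have := gmin _ fF; have := hmax _ fF => m1 m2 m3 m4.
have fx : glen (f * x) = glen x by lia.
have [ef _] := sh f s fF (ltac:(rewrite /s; lia)) (ltac:(rewrite /s; lia)).
rewrite fx addnK in ef.
by apply: (mulIg (ray s)); rewrite ef mul1g.
Qed.

End Conjugator.
End Geometry.

(** * Normal forms of confluent length-reducing systems *)

Section NormalForms.
Variables (X : choiceType) (R : seq X -> seq X -> Prop) (M : nat).
Hypothesis reducing : forall l r, R l r -> size r < size l.
Hypothesis bounded : forall l r, R l r -> size l <= M.
Hypothesis confluentR : confluent R.
Hypothesis invR : inverse_closed R.

Local Open Scope group_scope.
Local Notation G := (presented_group (inverse_closed_right_invertible invR)).

Definition irreducible (w : seq X) : Prop := forall w', ~ rewrite_step R w w'.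

Lemma rewrite_stepP u v : rewrite_step R u v ->
  exists p l r s, [/\ R l r, u = p ++ l ++ s & v = p ++ r ++ s].
Proof. by case=> p l r s lr; exists p, l, r, s. Qed.

Lemma rewrite_step_size u v : rewrite_step R u v -> size v < size u.
Proof. by case=> p l r s /reducing lr; rewrite !size_cat; lia. Qed.

Lemma rewrites_size u v : rewrites R u v -> u = v \/ size v < size u.
Proof.
elim=> {u v} [u v /rewrite_step_size|u|u v w _ [->|h1] _ [<-|h2]]; auto.
by right; lia.
Qed.

Lemma rewrites_irreducible u v : irreducible u -> rewrites R u v -> v = u.
Proof.
move=> iu uv; elim: uv iu => {u v} [u v uv /(_ _ uv)//|//|u v w _ h1 _ h2 iu].
by have vu := h1 iu; rewrite vu in h2 *; apply: h2.
Qed.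

Lemma rewrites_first u v : rewrites R u v ->
  u = v \/ exists2 w, rewrite_step R u w & rewrites R w v.
Proof.
elim=> {u v} [u v uv|u|u v w uv [->//|[z uz zv]] vw _]; auto.
  by right; exists v => //; apply: rt_refl.
by right; exists z => //; apply: rt_trans zv vw.
Qed.

Lemma irreducible_exists w : exists2 w', rewrites R w w' & irreducible w'.
Proof.
have [n] := ubnP (size w); elim: n w => // n IH w wn.
case: (pselect (irreducible w)) => iw; first by exists w => //; apply: rt_refl.
have [w' ww'] : exists w', rewrite_step R w w'.
  by apply: contra_notP iw => H w' ww'; apply: H; exists w'.
have [z w'z iz] := IH w' (leq_trans (rewrite_step_size ww') wn).
by exists z => //; apply: rt_trans w'z; apply: rt_step.
Qed.

Lemma convertible_join u v : convertible R u v ->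
  exists2 z, rewrites R u z & rewrites R v z.
Proof.
elim=> {u v} [u v uv|u|u v _ [z uz vz]|u v w _ [z uz vz] _ [y vy wy]].
- by exists v; [apply: rt_step|apply: rt_refl].
- by exists u; apply: rt_refl.
- by exists z.
have [x zx yx] := confluentR vz vy.
by exists x; [apply: rt_trans uz zx|apply: rt_trans wy yx].
Qed.

Lemma irreducible_unique u v : convertible R u v -> irreducible u -> irreducible v ->
  u = v.
Proof.
by move=> /convertible_join[z uz vz] /rewrites_irreducible /(_ uz) <-
  /rewrites_irreducible /(_ vz).
Qed.

Definition class_of (w : seq X) : G := word_class R w.

Lemma class_ofM u v : class_of u * class_of v = class_of (u ++ v).
Proof. exact: pm_mulE. Qed.

Lemma class_of_nil : class_of [::] = 1. Proof. by []. Qed.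

Lemma class_ofP u v : class_of u = class_of v <-> convertible R u v.
Proof. exact: word_classP. Qed.

Lemma class_of_rewrites u v : rewrites R u v -> class_of u = class_of v.
Proof. by move=> uv; apply/class_ofP/clos_rt_clos_rst. Qed.

Lemma class_of_surj (g : G) : exists w, class_of w = g.
Proof. by exists (word_repr (g : presented_monoid R)); exact: word_class_repr. Qed.

Lemma normal_form_exists (g : G) : exists w, class_of w = g /\ irreducible w.
Proof.
have [w <-] := class_of_surj g; have [w' ww' iw'] := irreducible_exists w.
by exists w'; rewrite (class_of_rewrites ww').
Qed.

Definition normal_form (g : G) : seq X := projT1 (cid (normal_form_exists g)).

Lemma class_of_normal_form g : class_of (normal_form g) = g.
Proof. by rewrite /normal_form; case: cid => ? []. Qed.

Lemma normal_form_irreducible g : irreducible (normal_form g).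
Proof. by rewrite /normal_form; case: cid => ? []. Qed.

Lemma rewrites_normal_form w : rewrites R w (normal_form (class_of w)).
Proof.
have [w' ww' iw'] := irreducible_exists w.
rewrite (_ : normal_form _ = w') //; apply: irreducible_unique iw'.
  by apply/class_ofP; rewrite class_of_normal_form; exact: class_of_rewrites.
exact: normal_form_irreducible.
Qed.

Definition letter_class (a : X) : G := class_of [:: a].

Lemma word_valueE w : word_value letter_class w = class_of w.
Proof.
elim: w => [|a w IH]; first exact: word_value_nil.
by rewrite word_value_cons IH class_ofM.
Qed.

Lemma letter_classV a : exists b, letter_class b = (letter_class a)^-1.
Proof.
have [b ab] := invR a; exists b; apply: (mulgI (letter_class a)).
by rewrite mulgV class_ofM -class_of_nil; exact: class_of_rewrites.
Qed.

Lemma normal_form_min w : size (normal_form (word_value letter_class w)) <= size w.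
Proof.
by rewrite word_valueE; have [<-//|/ltnW] := rewrites_size (rewrites_normal_form w).
Qed.

Lemma normal_form_unique w :
  size w = size (normal_form (word_value letter_class w)) ->
  w = normal_form (word_value letter_class w).
Proof.
rewrite word_valueE; have [<-//|h e] := rewrites_size (rewrites_normal_form w).
by move: h; rewrite -e ltnn.
Qed.

Lemma irreducible_cat p l r s : irreducible (p ++ l ++ s) -> ~ R l r.
Proof. by move=> H lr; exact: H (RewriteStep p s lr). Qed.

(* At most two rewriting steps lead from [u a] to its normal form, since the
   length of the latter is at least [size u - 1]. *)
Lemma normal_form_letter g a : size (normal_form g) <=
  common_prefix (normal_form g) (normal_form (g * letter_class a)) + 2 * M.
Proof.
set u := normal_form g; set v := normal_form _.
have iu : irreducible u := @normal_form_irreducible g.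
have vE : v = normal_form (class_of (u ++ [:: a])).
  by rewrite -class_ofM class_of_normal_form.
have uv : rewrites R (u ++ [:: a]) v by rewrite vE; exact: rewrites_normal_form.
have [b bE] := letter_classV a.
have vu : size u <= (size v).+1.
  have := normal_form_min (v ++ [:: b]).
  rewrite word_valueE -class_ofM class_of_normal_form -/(letter_class b) bE mulgK.
  by rewrite size_cat addn1.
have prefix n s : n <= size u -> n <= size v -> take n u = take n v ->
    size u <= n + s -> s <= 2 * M -> size u <= common_prefix u v + 2 * M.
  move=> h1 h2 h3 h4 h5; apply: leq_trans h4 _; apply: leq_add => //.
  by rewrite common_prefixP h1 h2 h3 eqxx.
have [uav|[w1 st1 r1]] := rewrites_first uv.
  apply: (@prefix (size u) 0) => //; rewrite -?uav ?size_cat ?leq_addr //.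
  by rewrite take_size take_size_cat.
have := rewrite_step_size st1; rewrite size_cat addn1 ltnS => sw1.
have [p1 [l1 [x1 [s1 [lx1 E1 w1E]]]]] := rewrite_stepP st1.
subst w1.
(* The first left-hand side must use the new letter [a], since [u] is irreducible. *)
have s10 : s1 = [::].
  case/lastP: s1 E1 {st1 r1 sw1} => // s1 c; rewrite -!rcons_cat cats1 => /rcons_inj[E _].
  by case: (irreducible_cat (p := p1) (s := s1) _ lx1); rewrite -E.
subst s1; rewrite !cats0 in E1 r1 sw1 st1.
have lM1 := bounded lx1; have rl1 := reducing lx1.
have sz1 : size p1 + size l1 = (size u).+1.
  by move/(congr1 size): E1; rewrite !size_cat addn1.
have p1u : take (size p1) u = p1.
  have l0 : 0 < size l1 by lia.
  have := congr1 (take (size p1)) E1.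
  by rewrite [in RHS]take_size_cat // takel_cat //; lia.
have [w1v|[w2 st2 r2]] := rewrites_first r1.
  apply: (@prefix (size p1) M) => //; rewrite -?w1v ?size_cat; try lia.
  by rewrite p1u take_size_cat.
have sw2 := rewrite_step_size st2.
have w2v : w2 = v by have [//|] := rewrites_size r2; lia.
subst w2.
have [p2 [l2 [x2 [s2 [lx2 E2 E3]]]]] := rewrite_stepP st2.
have lM2 := bounded lx2; have rl2 := reducing lx2.
(* The second left-hand side reaches beyond [p1], a prefix of the irreducible [u], so it starts at
   most [M] letters before the end of [p1]. *)
have p12 : size p1 < size p2 + size l2.
  rewrite ltnNge; apply/negP => le.
  have : take (size p2 + size l2) u = p2 ++ l2.
    rewrite -(take_takel u le) p1u.
    have := congr1 (take (size p2 + size l2)) E2; rewrite takel_cat // => ->.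
    by rewrite catA take_size_cat // size_cat.
  move=> tE; apply: (irreducible_cat (p := p2) (l := l2) (r := x2)
    (s := drop (size p2 + size l2) u)) lx2.
  by rewrite catA -tE cat_take_drop.
pose n := minn (size p1) (size p2).
apply: (@prefix n (2 * M)%N) => //; rewrite ?E3 ?size_cat; try (rewrite /n; lia).
have [n1 n2] : n <= size p1 /\ n <= size p2 by rewrite /n; lia.
rewrite -(take_takel u n1) p1u.
have := congr1 (take n) E2; rewrite !takel_cat //.
Qed.

Definition normal_form_spec :=
  And5 class_of_normal_form normal_form_min normal_form_unique letter_classV
    normal_form_letter.

End NormalForms.

(** * Free products *)

Section Morphisms.
Local Open Scope group_scope.
Variables (G H : groupType) (f : G -> H).
Hypothesis fM : {morph f : x y / x * y}.

Lemma morph_one : f 1 = 1.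
Proof. by apply: (mulgI (f 1)); rewrite -fM !mulg1. Qed.

Lemma morph_inv x : f x^-1 = (f x)^-1.
Proof. by apply: (mulgI (f x)); rewrite -fM !mulgV morph_one. Qed.

Lemma morph_exp x n : f (x ^+ n) = f x ^+ n.
Proof. by elim: n => [|n IH]; rewrite ?morph_one // !expgS fM IH. Qed.

Lemma morph_prod I (r : seq I) (E : I -> G) :
  f (\prod_(i <- r) E i) = \prod_(i <- r) f (E i).
Proof. by elim: r => [|i r IH]; rewrite ?big_nil ?morph_one // !big_cons fM IH. Qed.

Definition bundle_morphism : {multiplicative G -> H} :=
  HB.pack f (isMultiplicative.Build G H f fM).

End Morphisms.

Lemma isomorphicP (G H : groupType) : isomorphic G H <->
  exists f : G -> H, {morph f : x y / (x * y)%g} /\ bijective f.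
Proof.
split=> [[f fb]|[f [fM fb]]]; first by exists f; split=> //; exact: gmulfM.
by exists (bundle_morphism fM).
Qed.

Section PresentedLift.
Local Open Scope group_scope.
Variables (X : choiceType) (R : seq X -> seq X -> Prop) (invR : right_invertible R).
Local Notation G := (presented_group invR).

Definition pcls (w : seq X) : G := word_class R w.

Lemma pclsM u v : pcls u * pcls v = pcls (u ++ v).
Proof. exact: pm_mulE. Qed.

Lemma pcls1 : pcls [::] = 1. Proof. by []. Qed.

Lemma pclsP u v : pcls u = pcls v <-> convertible R u v.
Proof. exact: word_classP. Qed.

Lemma pcls_surj (x : G) : exists w, pcls w = x.
Proof. by exists (word_repr (x : presented_monoid R)); exact: word_class_repr. Qed.

Lemma pcls_prod w : pcls w = \prod_(a <- w) pcls [:: a].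
Proof. by elim: w => [|a w IH]; rewrite ?big_nil // big_cons -IH pclsM. Qed.

Variable H : groupType.

Lemma morph_ext (f g : G -> H) :
  {morph f : x y / x * y} -> {morph g : x y / x * y} ->
  (forall a, f (pcls [:: a]) = g (pcls [:: a])) -> f =1 g.
Proof.
move=> fM gM fg x; have [w <-] := pcls_surj x.
by rewrite pcls_prod (morph_prod fM) (morph_prod gM); apply: eq_bigr.
Qed.

Variable phi : X -> H.
Local Notation value w := (\prod_(a <- w) phi a).
Hypothesis phi_rules : forall l r, R l r -> value l = value r.

Lemma value_cat u v : value (u ++ v) = value u * value v.
Proof.
elim: u => [|a u IH]; first by rewrite big_nil mul1g.
by rewrite cat_cons !big_cons IH mulgA.
Qed.

Lemma value_convertible u v : convertible R u v -> value u = value v.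
Proof.
elim=> {u v} [_ _ [u l r v lr]|//|u v _ ->//|u v w _ -> _ ->//].
by rewrite !value_cat (phi_rules lr).
Qed.

Definition presented_lift (x : G) : H := value (word_repr (x : presented_monoid R)).

Lemma presented_lift_class w : presented_lift (pcls w) = value w.
Proof. by apply: value_convertible; apply/word_classP/word_class_repr. Qed.

Lemma presented_liftM : {morph presented_lift : x y / x * y}.
Proof.
move=> x y; have [u <-] := pcls_surj x; have [v <-] := pcls_surj y.
by rewrite pclsM !presented_lift_class value_cat.
Qed.

End PresentedLift.

Definition torsion (G : groupType) (x : G) : Prop :=
  exists2 n, 0 < n & (x ^+ n = 1)%g.

Lemma torsion_conj (G : groupType) (x y : G) : torsion x -> torsion (x ^ y)%g.
Proof. by case=> n n0 xn; exists n => //; rewrite -conjXg xn conj1g. Qed.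

Section FreeProductTheory.
Local Open Scope group_scope.
Variables (I : choiceType) (F : I -> groupType).
Local Notation P := (free_product F).
Local Notation letter := {i & F i}.
Local Notation cls := (@pcls _ _ (@free_product_right_invertible I F)).

Definition fp_in i (g : F i) : P := cls [:: Tagged F g].

Lemma fp_inM i : {morph @fp_in i : g h / g * h}.
Proof.
move=> g h; rewrite /fp_in pclsM; apply/pclsP/rst_sym/rst_step.
exact: (RewriteStep [::] [::] (FreeProductMul g h)).
Qed.

Lemma fp_in1 i : fp_in (1 : F i) = 1.
Proof. exact: morph_one (@fp_inM i). Qed.

Lemma fp_inV i (g : F i) : fp_in g^-1 = (fp_in g)^-1.
Proof. exact: morph_inv (@fp_inM i) g. Qed.

Lemma cls_letter (a : letter) : cls [:: a] = fp_in (tagged a).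
Proof. by case: a. Qed.

Lemma cls_cons a w : cls (a :: w) = fp_in (tagged a) * cls w.
Proof. by rewrite -cls_letter pclsM. Qed.

Lemma cls_rcons w a : cls (rcons w a) = cls w * fp_in (tagged a).
Proof. by rewrite -cls_letter pclsM cats1. Qed.

Lemma fp_lift_rules (H : groupType) (f : forall i, F i -> H) :
  (forall i, {morph @f i : x y / x * y}) ->
  forall l r, free_product_rule l r ->
  \prod_(a <- l) f (tag a) (tagged a) = \prod_(a <- r) f (tag a) (tagged a).
Proof.
move=> fM l r [i|i g h]; rewrite !big_cons !big_nil ?mulg1 /=.
  exact: morph_one (@fM i).
by rewrite fM.
Qed.

Definition fp_lift (H : groupType) (f : forall i, F i -> H) : P -> H :=
  @presented_lift _ _ (@free_product_right_invertible I F) H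
    (fun a : letter => f (tag a) (tagged a)).

Lemma fp_liftM (H : groupType) (f : forall i, F i -> H) :
  (forall i, {morph @f i : x y / x * y}) ->
  {morph fp_lift f : x y / x * y}.
Proof. by move=> fM; apply: presented_liftM => l r; apply: fp_lift_rules. Qed.

Lemma fp_lift_in (H : groupType) (f : forall i, F i -> H) :
  (forall i, {morph @f i : x y / x * y}) ->
  forall i (g : F i), fp_lift f (fp_in g) = f i g.
Proof.
move=> fM i g; rewrite /fp_lift presented_lift_class; last exact: fp_lift_rules.
by rewrite big_cons big_nil mulg1.
Qed.

Lemma fp_morph_ext (H : groupType) (f g : P -> H) :
  {morph f : x y / x * y} -> {morph g : x y / x * y} ->
  (forall i (x : F i), f (fp_in x) = g (fp_in x)) -> f =1 g.
Proof. by move=> fM gM fg; apply: morph_ext => // a; rewrite cls_letter. Qed.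

Definition push (a : letter) (w : seq letter) : seq letter :=
  if tagged a == 1 then w else
  if w is b :: w' then
    if tag b == tag a then
      let g := tagged a * tagged_as a b in
      if g == 1 then w' else Tagged F g :: w'
    else a :: w
  else [:: a].

Definition reduced (w : seq letter) : bool :=
  all (fun a : letter => tagged a != 1) w && sorted (fun a b : letter => tag a != tag b) w.

Definition starts_with i (w : seq letter) : bool :=
  if w is b :: _ then tag b == i else false.

Lemma reduced_cons a w : reduced (a :: w) =
  [&& tagged a != 1, ~~ starts_with (tag a) w & reduced w].
Proof.
rewrite /reduced /=; case: w => [|b w] /=; first by rewrite !andbT.
rewrite [tag a == _]eq_sym; case: (tagged a != 1); case: (tag b != tag a) => //=.
by rewrite andbF.
Qed.

(** Coordinates on reduced words relative to the factor [i]: in them [push] is multiplication in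
    [F i], without distinction of cases. *)
Definition glue i (x : F i) (v : seq letter) :=
  if x == 1 then v else Tagged F x :: v.

Lemma glueP i (x : F i) w : reduced w ->
  exists x v, [/\ w = @glue i x v, ~~ starts_with i v & reduced v].
Proof.
case: w => [|[j y] w] rw; first by exists 1, [::]; rewrite /glue eqxx.
have [ji|ji] := eqVneq j i; last first.
  by exists 1, (Tagged F y :: w); rewrite /glue eqxx /= (negPf ji).
subst j; move: rw; rewrite reduced_cons => /and3P[/= y1 sw rw].
by exists y, w; rewrite /glue (negPf y1).
Qed.

Lemma push_glue i (h x : F i) v : ~~ starts_with i v ->
  push (Tagged F h) (glue x v) = glue (h * x) v.
Proof.
move=> sv; rewrite /push /=.
have [->|h1] := eqVneq h 1; first by rewrite mul1g.
rewrite /glue; have [->|x1] := eqVneq x 1.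
  rewrite mulg1 (negPf h1); case: v sv => //= b v.
  by move=> /negPf->.
by rewrite /= eqxx tagged_asE.
Qed.

Lemma reduced_glue i (x : F i) v : ~~ starts_with i v -> reduced v ->
  reduced (glue x v).
Proof.
by move=> sv rv; rewrite /glue; case: ifP => // /negbT x1; rewrite reduced_cons x1 sv.
Qed.

Lemma reduced_push a w : reduced w -> reduced (push a w).
Proof.
case: a => i h rw; have [x [v [-> sv rv]]] := glueP (1 : F i) rw.
by rewrite (push_glue h x sv); apply: reduced_glue.
Qed.

(** Van der Waerden's argument: the factors act on reduced words, so reduction respects the defining
    rules and reduced forms are unique. *)
Lemma push_mul i (g h : F i) w : reduced w ->
  push (Tagged F g) (push (Tagged F h) w) = push (Tagged F (g * h)) w.
Proof.
move=> rw; have [x [v [-> sv rv]]] := glueP (1 : F i) rw.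
by rewrite !push_glue // mulgA.
Qed.

Lemma push_reduced a w : reduced (a :: w) -> push a w = a :: w.
Proof.
rewrite reduced_cons => /and3P[a1 hw _]; rewrite /push (negPf a1).
by case: w hw => //= b w /negPf->.
Qed.

Definition reduce (w : seq letter) := foldr push [::] w.

Lemma reduced_reduce w : reduced (reduce w).
Proof. by elim: w => //= a w; exact: reduced_push. Qed.

Lemma reduce_id w : reduced w -> reduce w = w.
Proof.
elim: w => //= a w IH rw; rewrite IH ?push_reduced //.
by move: rw; rewrite reduced_cons => /and3P[].
Qed.

Lemma reduce_convertible u v : convertible (@free_product_rule I F) u v ->
  reduce u = reduce v.
Proof.
elim=> {u v} [_ _ [u l r v lr]|//|u v _ ->//|u v w _ -> _ ->//].
rewrite /reduce !foldr_cat; congr foldr; case: lr => [i|i g h] /=.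
  by rewrite /push /= eqxx.
by rewrite push_mul //; exact: reduced_reduce.
Qed.

Lemma cls_push a w : cls (push a w) = cls (a :: w).
Proof.
have -> : cls (a :: w) = cls [:: a] * cls w by rewrite pclsM.
rewrite /push cls_letter; case: eqP => [->|_]; first by rewrite fp_in1 mul1g.
case: w => [|b w]; first by rewrite -cls_letter pclsM.
case: ifP => [/eqP ba|_]; last by rewrite -cls_letter pclsM.
have -> : cls (b :: w) = cls [:: b] * cls w by rewrite pclsM.
have -> : cls [:: b] = fp_in (tagged_as a b).
  by case: a b ba => i x [j y] /= ji; subst j; rewrite tagged_asE.
rewrite mulgA -fp_inM; case: ifP => [/eqP->|_]; first by rewrite fp_in1 mul1g.
by rewrite -(cls_letter (Tagged F _)) pclsM.
Qed.

Lemma cls_reduce w : cls (reduce w) = cls w.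
Proof.
by elim: w => //= a w IH; rewrite cls_push !cls_cons IH.
Qed.

Definition reduced_form (x : P) : seq letter :=
  reduce (word_repr (x : presented_monoid _)).

Lemma reduced_form_cls w : reduced_form (cls w) = reduce w.
Proof. by apply: reduce_convertible; apply/word_classP/word_class_repr. Qed.

Lemma reduced_form_reduced x : reduced (reduced_form x).
Proof. exact: reduced_reduce. Qed.

Lemma cls_reduced_form x : cls (reduced_form x) = x.
Proof. by rewrite cls_reduce; exact: word_class_repr. Qed.

Lemma cls_inj u v : reduced u -> reduced v -> cls u = cls v -> u = v.
Proof.
by move=> /reduce_id {2}<- /reduce_id {2}<- uv; rewrite -!reduced_form_cls uv.
Qed.

Lemma fp_in_inj i : injective (@fp_in i).
Proof.
move=> x y; rewrite /fp_in => /(congr1 reduced_form).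
rewrite !reduced_form_cls /reduce /push /=.
do 2 case: eqP => //; first by move=> -> ->.
by move=> _ _ [] /eqP; rewrite eq_Tagged => /eqP.
Qed.

Lemma fp_in_eq i j (x : F i) (y : F j) : x != 1 -> fp_in x = fp_in y ->
  Tagged F x = Tagged F y.
Proof.
move=> x1 /(congr1 reduced_form).
rewrite !reduced_form_cls /reduce /push /= (negPf x1).
by case: eqP => // _ [].
Qed.

Lemma reduced_cat u a b v : reduced (rcons u a) -> reduced (b :: v) ->
  tag a != tag b -> reduced (rcons u a ++ b :: v).
Proof.
move=> ra rb ab; move: ra rb; rewrite /reduced all_cat => /andP[-> su] /andP[-> sb] /=.
case: u su => [|c u] /=; first by rewrite ab.
by rewrite cat_path last_rcons /= ab => -> /=.
Qed.

Definition inverse_word (w : seq letter) : seq letter :=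
  rev [seq Tagged F (tagged a)^-1 | a : letter <- w].

Lemma cls_inverse_word w : cls (inverse_word w) = (cls w)^-1.
Proof.
elim: w => [|a w IH]; first by rewrite pcls1 invg1.
by rewrite /inverse_word /= rev_cons cls_rcons -/(inverse_word w) IH cls_cons invgM fp_inV.
Qed.

Lemma reduced_inverse_word w : reduced (inverse_word w) = reduced w.
Proof.
rewrite /reduced /inverse_word all_rev all_map rev_sorted sorted_map; congr (_ && _).
  by apply: eq_all => a /=; rewrite invg_eq1.
by apply: eq_sorted => a b /=; rewrite /relpre /= eq_sym.
Qed.

Lemma size_inverse_word w : size (inverse_word w) = size w.
Proof. by rewrite size_rev size_map. Qed.

(** The powers of a cyclically reduced word of length at least 2 are again reduced words. *)
Lemma cyclic_torsion_free a w b : reduced (rcons (a :: w) b) -> tag b != tag a ->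
  ~ torsion (cls (rcons (a :: w) b)).
Proof.
move=> rw ba [n n0 En].
have key m : reduced (flatten (nseq m (rcons (a :: w) b))) /\
    cls (flatten (nseq m (rcons (a :: w) b))) = cls (rcons (a :: w) b) ^+ m.
  elim: m => [|m [IH1 IH2]] //=; split; last first.
    by rewrite -[_ :: _ ++ _]/(rcons (a :: w) b ++ _) -pclsM IH2 expgS.
  case: m IH1 {IH2} => [|m] IH1; first by rewrite cats0.
  rewrite -[_ :: _ ++ _]/(rcons (a :: w) b ++ _) /=.
  exact: (@reduced_cat (a :: w) b a).
have [r c] := key n; have := @cls_inj _ [::] r isT.
by rewrite c En => /(_ (erefl _)); case: n n0 {En r c}.
Qed.

Lemma split_last j (g : P) : exists (g0 : seq letter) (h : F j),
  [/\ reduced g0, ~~ starts_with j (rev g0) & g = cls g0 * fp_in h].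
Proof.
have rg := reduced_form_reduced g^-1.
have [x [v [E sv rv]]] := glueP (1 : F j) rg.
exists (inverse_word v), x^-1; split.
- by rewrite reduced_inverse_word.
- by rewrite /inverse_word revK; case: (v) sv.
rewrite cls_inverse_word fp_inV -invgM -[LHS]invgK; congr (_^-1).
rewrite -[LHS]cls_reduced_form E /glue.
case: eqP => [->|_]; first by rewrite fp_in1 mul1g.
by rewrite -(cls_letter (Tagged F x)) pclsM.
Qed.

Lemma split_first i g0 : reduced g0 -> exists (k : F i) (g1 : seq letter),
  [/\ reduced g1, ~~ starts_with i g1, cls g0 = fp_in k * cls g1 &
      exists s, g0 = s ++ g1].
Proof.
move=> rg; have [x [v [E sv rv]]] := glueP (1 : F i) rg.
exists x, v; split=> //; rewrite E /glue; case: eqP => [x1|_].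
- by rewrite x1 fp_in1 mul1g.
- by rewrite cls_cons.
- by exists [::].
by exists [:: Tagged F x].
Qed.

Lemma reduced_conjugate g1 j (u : F j) : reduced g1 -> ~~ starts_with j (rev g1) ->
  u != 1 -> reduced (rcons g1 (Tagged F u) ++ inverse_word g1).
Proof.
move=> rg sg u1.
have r1 : reduced (rcons g1 (Tagged F u)).
  elim/last_ind: g1 rg sg => [|g a IH] rg sg; first by rewrite reduced_cons u1.
  rewrite -(cats1 (rcons g a)); apply: reduced_cat => //.
    by rewrite reduced_cons u1.
  by move: sg; rewrite rev_rcons.
case/lastP: g1 rg sg r1 => [|g a] rg sg r1; first by rewrite cats0.
have := reduced_inverse_word (rcons g a); rewrite rg.
rewrite /inverse_word map_rcons rev_rcons => r2.
apply: reduced_cat => //=.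
by move: sg; rewrite rev_rcons /= eq_sym.
Qed.

(* Both elements fix a vertex of the Bass-Serre tree; so does their product,
   hence all these vertices coincide. *)
Lemma torsion_product i (u : F i) j (v : F j) (g : P) : u != 1 -> v != 1 ->
  torsion (fp_in u * (g * fp_in v * g^-1)) ->
  exists h : F i, g * fp_in v * g^-1 = fp_in h.
Proof.
move=> u1 v1; have [g0 [h [rg0 sg0 ->]]] := split_last j g.
have [k [g1 [rg1 sg1 g0E [s g0s]]]] := split_first i rg0.
(* The letters of [g] that can be absorbed into [u] or [v] are moved there; what remains is [g1]. *)
pose v' := h * v * h^-1; pose u' := k^-1 * u * k.
have v'1 : v' != 1.
  apply: contraNneq v1 => E; rewrite -(mulKg h v) -[h * v](mulgVK h) -/v' E mul1g.
  by rewrite mulVg.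
have u'1 : u' != 1.
  apply: contraNneq u1 => E.
  by rewrite -[u](mulKVg k) -[k^-1 * u](mulgK k) -/u' E mul1g mulgV.
have E : cls g0 * fp_in h * fp_in v * (cls g0 * fp_in h)^-1 =
    fp_in k * (cls g1 * fp_in v' * (cls g1)^-1) * fp_in k^-1.
  by rewrite g0E /v' !fp_inM !fp_inV !invgM !mulgA.
rewrite E => tor.
have {}tor : torsion (fp_in u' * (cls g1 * fp_in v' * (cls g1)^-1)).
  have := torsion_conj (fp_in k) tor; congr torsion.
  rewrite conjgE /u' !fp_inM !fp_inV -!mulgA mulVg mulg1.
  by rewrite !mulgA.
have sg1' : ~~ starts_with j (rev g1).
  move: sg0; rewrite g0s rev_cat; case: (rev g1) => //.
have rc := reduced_conjugate rg1 sg1' v'1.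
have ce : fp_in u' * (cls g1 * fp_in v' * (cls g1)^-1) =
    cls (Tagged F u' :: rcons g1 (Tagged F v') ++ inverse_word g1).
  by rewrite cls_cons -pclsM cls_rcons cls_inverse_word.
rewrite ce in tor.
(* If [g1] is nonempty, the word [u' g1 v' g1^-1] is cyclically reduced, as [g1] does not start in
   the factor [i]; then it has infinite order. So is it when [g1] is empty and the factors
   differ. *)
case: g1 sg1 rc tor ce {sg1' rg1 g0E g0s E} => [|a g1] sg1 rc tor ce.
  have [ij|ij] := eqVneq j i; last first.
    case: (@cyclic_torsion_free (Tagged F u') [::] (Tagged F v')) => //.
    by rewrite !reduced_cons u'1 v'1 /= (negPf ij).
  subst j; exists (k * v' * k^-1).
  by rewrite !fp_inM fp_inV invg1 mul1g mulg1 mulgA.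
have iE : inverse_word (a :: g1) = rcons (inverse_word g1) (Tagged F (tagged a)^-1).
  by rewrite /inverse_word /= rev_cons.
rewrite iE -rcons_cat in rc tor.
case: (@cyclic_torsion_free (Tagged F u')
   (rcons (a :: g1) (Tagged F v') ++ inverse_word g1) (Tagged F (tagged a)^-1) _ _ tor).
  by rewrite rcons_cons reduced_cons u'1 rc andbT.
by [].
Qed.

(** A reduced word of finite order and length at least 2 begins and ends in the same factor, so
    conjugation by its first letter shortens it. *)
Lemma torsion_conjugate (f : P) : torsion f -> f != 1 ->
  exists g i (u : F i), u != 1 /\ f = g * fp_in u * g^-1.
Proof.
have [n] := ubnP (size (reduced_form f)); elim: n f => // n IH f.
have [w0 w0E] : exists w, w = reduced_form f by eexists.
have fE : f = cls w0 by rewrite w0E cls_reduced_form.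
have := reduced_form_reduced f; rewrite -w0E fE {fE w0E f}.
case: w0 => [|a w]; first by rewrite pcls1 eqxx.
case/lastP: w => [|w b] rw sn tor f1.
  move: rw; rewrite reduced_cons => /and3P[a1 _ _].
  by exists 1, (tag a), (tagged a); rewrite a1 invg1 mul1g mulg1 cls_letter.
have [ba|ba] := eqVneq (tag b) (tag a); last by case: (cyclic_torsion_free rw ba tor).
pose f' := (cls [:: a])^-1 * cls (a :: rcons w b) * cls [:: a].
have f'E : f' = cls (rcons (rcons w b) a).
  by rewrite /f' cls_letter [cls (a :: _)]cls_cons mulKg [RHS]cls_rcons.
have f'c : f' = cls (a :: rcons w b) ^ cls [:: a] by rewrite conjgE mulgA.
have sz : size (reduced_form f') < n.
  have -> : f' = cls (rcons w (Tagged F (tagged b * tagged_as b a))).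
    rewrite f'E !cls_rcons /= fp_inM mulgA; congr (_ * _ * _).
    by case: a b ba {rw sn tor f1 f' f'E f'c} => i x [j y] /= E; subst j; rewrite tagged_asE.
  have size_reduce v : size (reduce v) <= size v.
    elim: v => //= c v; rewrite /push; case: ifP => _; first by move/leqW.
    by case: (reduce v) => [|d v'] //; do 2 case: ifP => _ //=; lia.
  rewrite reduced_form_cls; apply: leq_ltn_trans (size_reduce _) _.
  by move: sn; rewrite /= !size_rcons; lia.
have [||g [i [u [u1 gE]]]] := IH f' sz.
- by rewrite f'c; exact: torsion_conj.
- by rewrite f'c conjg_eq1.
exists (cls [:: a] * g), i, u; split=> //.
have -> : cls (a :: rcons w b) = cls [:: a] * f' * (cls [:: a])^-1.
  by rewrite /f' !mulgA mulgV mul1g mulgK.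
by rewrite gE invgM !mulgA.
Qed.

(** The element [f0] selects a vertex of the tree, and [torsion_product] forces every other element
    to fix that vertex as well. *)
Lemma torsion_set_conjugate (T : P -> Prop) (f0 : P) : T f0 -> f0 != 1 ->
  (forall f g, T f -> T g -> torsion (f * g)) -> (forall f, T f -> torsion f) ->
  exists i (g : P), forall f, T f -> exists h : F i, f = g * fp_in h * g^-1.
Proof.
move=> T0 f01 TM Tt; have [g [i [u [u1 fE]]]] := torsion_conjugate (Tt _ T0) f01.
exists i, g => f Tf; have [->|f1] := eqVneq f 1.
  by exists 1; rewrite fp_in1 mulg1 mulgV.
have [g' [j [v [v1 fE']]]] := torsion_conjugate (Tt _ Tf) f1.
have [|h hE] := @torsion_product i u j v (g^-1 * g') u1 v1.
  have := torsion_conj g (TM _ _ T0 Tf); congr torsion.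
  by rewrite fE fE' conjgE invgM invgK !mulgA mulVg mul1g.
exists h; rewrite -hE fE' invgM invgK !mulgA mulgV mul1g mulgK //.
Qed.

(** Unless [g] lies in the factor of [u], the conjugate has a reduced form of length at least 3.
    Hence tuples in a factor are conjugate in the free product only if they are so in the factor. *)
Lemma fp_malnormal i (u : F i) j (v : F j) (g : P) : u != 1 ->
  g * fp_in u * g^-1 = fp_in v ->
  exists2 k : F i, g = fp_in k & Tagged F (k * u * k^-1) = Tagged F v.
Proof.
move=> u1; have [g0 [h [rg0 sg0 ->]]] := split_last i g.
pose u' := h * u * h^-1.
have u'1 : u' != 1.
  apply: contraNneq u1 => E; rewrite -(mulKg h u) -[h * u](mulgVK h) -/u' E mul1g.
  by rewrite mulVg.
have -> : cls g0 * fp_in h * fp_in u * (cls g0 * fp_in h)^-1 =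
    cls (rcons g0 (Tagged F u') ++ inverse_word g0).
  rewrite -pclsM cls_rcons cls_inverse_word /= /u' !fp_inM fp_inV.
  by rewrite invgM !mulgA.
move=> E; have := congr1 reduced_form E.
rewrite !reduced_form_cls reduce_id; last exact: reduced_conjugate.
move=> /(congr1 size); rewrite size_cat size_rcons size_inverse_word.
have : size (reduce [:: Tagged F v]) <= 1 by rewrite /reduce /push /=; case: ifP.
move=> h1 h2; have g00 : g0 = [::] by apply: size0nil; lia.
subst g0; exists h; first by rewrite pcls1 mul1g.
by apply: fp_in_eq u'1 _; exact: E.
Qed.

End FreeProductTheory.

(** * Tuples up to conjugacy *)

Section ClassCount.
Variables (T : Type) (P : T -> Prop) (E : T -> T -> Prop).

(** The number of classes is a relation, given by a transversal, since the set of tuples in an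
    infinite group need not be finite. Its uniqueness comes from [class_count_le]. *)
Definition class_count (n : nat) : Prop :=
  exists rho : 'I_n -> T, [/\ forall j, P (rho j),
    forall j k, E (rho j) (rho k) -> j = k & forall x, P x -> exists j, E x (rho j)].

Lemma class_count_finType (J : finType) (rho : J -> T) :
  (forall j, P (rho j)) -> (forall j k, E (rho j) (rho k) -> j = k) ->
  (forall x, P x -> exists j, E x (rho j)) -> class_count #|J|.
Proof.
move=> h1 h2 h3; exists (fun i => rho (enum_val i)); split=> [j|j k /h2|x /h3[j]].
- exact: h1.
- exact: enum_val_inj.
- by exists (enum_rank j); rewrite enum_rankK.
Qed.

End ClassCount.

Lemma class_count_le (T T' : Type) (P : T -> Prop) (E : T -> T -> Prop)
  (P' : T' -> Prop) (E' : T' -> T' -> Prop) (f : T -> T') n n' :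
  class_count P E n -> class_count P' E' n' ->
  (forall x y, E' x y -> E' y x) -> (forall x y z, E' x y -> E' y z -> E' x z) ->
  (forall x, P x -> P' (f x)) ->
  (forall x y, P x -> P y -> E' (f x) (f y) -> E x y) -> n <= n'.
Proof.
move=> [rho [h1 h2 _]] [rho' [_ _ h3]] Es Et fP fE.
have [g gE] := choice (fun j => h3 _ (fP _ (h1 j))).
rewrite -(card_ord n) -(card_ord n'); apply: (@leq_card _ _ g) => j k gjk.
apply: h2; apply: fE => //; apply: Et (gE j) _.
by rewrite gjk; apply: Es.
Qed.

Section Tuples.
Local Open Scope group_scope.
Variables (R : nat).

Definition wval (G : groupType) (t : {ffun 'I_R -> G}) (v : seq 'I_R) : G :=
  \prod_(i <- v) t i.

(** Positive words suffice: in a finite group inverses are powers, so the generated submonoid is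
    already the subgroup. *)
Definition same_type (G H : groupType) (t : {ffun 'I_R -> G}) (s : {ffun 'I_R -> H}) :=
  forall v w, wval t v = wval t w <-> wval s v = wval s w.

(* Every element of the submonoid generated by t has length at most n. *)
Definition short (n : nat) (G : groupType) (t : {ffun 'I_R -> G}) : Prop :=
  forall v, size v <= n.+1 -> exists2 w, size w <= n & wval t v = wval t w.

Definition alike (n : nat) (G H : groupType) (t : {ffun 'I_R -> G})
    (s : {ffun 'I_R -> H}) : Prop :=
  forall v w, size v <= n.+1 -> size w <= n.+1 ->
  (wval t v = wval t w <-> wval s v = wval s w).

Definition conj_by (G : groupType) (g : G) (t : {ffun 'I_R -> G}) :=
  [ffun i => g * t i * g^-1].

Definition conjugate (G : groupType) (t s : {ffun 'I_R -> G}) : Prop :=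
  exists g, s = conj_by g t.

Lemma wval_nil (G : groupType) (t : {ffun 'I_R -> G}) : wval t [::] = 1.
Proof. exact: big_nil. Qed.

Lemma wval_cons (G : groupType) (t : {ffun 'I_R -> G}) i v :
  wval t (i :: v) = t i * wval t v.
Proof. exact: big_cons. Qed.

Lemma wval_cat (G : groupType) (t : {ffun 'I_R -> G}) v w :
  wval t (v ++ w) = wval t v * wval t w.
Proof.
by elim: v => [|i v IH]; rewrite ?wval_nil ?mul1g // cat_cons !wval_cons IH mulgA.
Qed.

Lemma wval_seq1 (G : groupType) (t : {ffun 'I_R -> G}) i : wval t [:: i] = t i.
Proof. by rewrite wval_cons wval_nil mulg1. Qed.

Lemma wval_conj (G : groupType) (g : G) (t : {ffun 'I_R -> G}) v :
  wval (conj_by g t) v = g * wval t v * g^-1.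
Proof.
elim: v => [|i v IH]; first by rewrite !wval_nil mulg1 mulgV.
by rewrite !wval_cons IH ffunE !mulgA mulgVK.
Qed.

Lemma wval_morph (G H : groupType) (f : G -> H) (t : {ffun 'I_R -> G}) v :
  {morph f : x y / x * y} -> wval [ffun i => f (t i)] v = f (wval t v).
Proof.
move=> fM; elim: v => [|i v IH]; first by rewrite !wval_nil (morph_one fM).
by rewrite !wval_cons IH ffunE fM.
Qed.

Lemma conjugate_refl (G : groupType) (t : {ffun 'I_R -> G}) : conjugate t t.
Proof. by exists 1; apply/ffunP => i; rewrite ffunE mul1g invg1 mulg1. Qed.

Lemma conjugate_sym (G : groupType) (t s : {ffun 'I_R -> G}) :
  conjugate t s -> conjugate s t.
Proof.
move=> [g ->]; exists g^-1; apply/ffunP => i.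
by rewrite !ffunE invgK !mulgA mulVg mul1g mulgVK.
Qed.

Lemma conjugate_trans (G : groupType) (t s u : {ffun 'I_R -> G}) :
  conjugate t s -> conjugate s u -> conjugate t u.
Proof.
move=> [g ->] [h ->]; exists (h * g); apply/ffunP => i.
by rewrite !ffunE invgM !mulgA.
Qed.

Lemma same_type_refl (G : groupType) (t : {ffun 'I_R -> G}) : same_type t t.
Proof. by []. Qed.

Lemma same_type_sym (G H : groupType) (t : {ffun 'I_R -> G}) (s : {ffun 'I_R -> H}) :
  same_type t s -> same_type s t.
Proof. by move=> ts v w; have := ts v w; tauto. Qed.

Lemma same_type_trans (G H K : groupType) (t : {ffun 'I_R -> G})
    (s : {ffun 'I_R -> H}) (u : {ffun 'I_R -> K}) :
  same_type t s -> same_type s u -> same_type t u.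
Proof. by move=> ts su v w; have := ts v w; have := su v w; tauto. Qed.

Lemma same_type_conj (G H : groupType) (t : {ffun 'I_R -> G})
    (s u : {ffun 'I_R -> H}) : conjugate s u -> same_type t s -> same_type t u.
Proof.
move=> [g ->] ts v w; rewrite (ts v w) !wval_conj.
by split=> [->//|/mulIg /mulgI].
Qed.

Lemma same_type_morph (G H : groupType) (f : G -> H) (t : {ffun 'I_R -> G}) :
  {morph f : x y / x * y} -> injective f -> same_type t [ffun i => f (t i)].
Proof. by move=> fM fI v w; rewrite !wval_morph //; split=> [->//|/fI]. Qed.

(** The relations shortening a letter followed by a word of length [n] hold for both tuples, so a
    word shortens to the same word of length at most [n] on both sides. This is why words of length
    [n.+1] are compared. *)
Lemma short_alike n (G H : groupType) (t : {ffun 'I_R -> G}) (s : {ffun 'I_R -> H}) :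
  short n t -> alike n t s -> same_type t s.
Proof.
move=> sh al.
have key v : exists w, [/\ size w <= n, wval t v = wval t w & wval s v = wval s w].
  elim: v => [|i v [w [wn tw sw]]]; first by exists [::].
  have [u un tu] := sh (i :: w) wn.
  exists u; split=> //; first by rewrite -tu !wval_cons tw.
  have := al (i :: w) u wn (leqW un); rewrite -tu => -[/(_ (erefl _)) <- _].
  by rewrite !wval_cons sw.
move=> v w; have [v' [v'n -> ->]] := key v; have [w' [w'n -> ->]] := key w.
by apply: al; apply: leqW.
Qed.

Lemma same_type_alike n (G H : groupType) (t : {ffun 'I_R -> G})
  (s : {ffun 'I_R -> H}) : same_type t s -> alike n t s.
Proof. by move=> ts v w _ _; apply: ts. Qed.

Lemma same_type_short n (G H : groupType) (t : {ffun 'I_R -> G})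
  (s : {ffun 'I_R -> H}) : same_type t s -> short n t -> short n s.
Proof. by move=> ts sh v /sh[w wn tw]; exists w => //; apply/ts. Qed.

Lemma short_all n (G : groupType) (t : {ffun 'I_R -> G}) v : short n t ->
  exists2 w, size w <= n & wval t v = wval t w.
Proof.
move=> sh; elim: v => [|i v [w wn tw]]; first by exists [::].
by have [u un tu] := sh (i :: w) wn; exists u; rewrite // -tu !wval_cons tw.
Qed.

Definition wordlist (n : nat) : seq (seq 'I_R) :=
  flatten [seq [seq tval v | v <- enum {: k.-tuple 'I_R}] | k <- iota 0 n.+1].

Lemma mem_wordlist n v : size v <= n -> v \in wordlist n.
Proof.
move=> vn; apply/flattenP; exists [seq tval v | v <- enum {: (size v).-tuple 'I_R}].
  by apply/mapP; exists (size v) => //; rewrite mem_iota.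
by apply/mapP; exists (in_tuple v) => //; rewrite mem_enum.
Qed.

Definition generated n (G : groupType) (t : {ffun 'I_R -> G}) : seq G :=
  map (wval t) (wordlist n).

Section Generated.
Variables (n : nat) (G : groupType) (t : {ffun 'I_R -> G}).
Hypothesis sh : short n t.

Lemma mem_generated v : wval t v \in generated n t.
Proof.
by have [w wn ->] := short_all v sh; apply/map_f/mem_wordlist.
Qed.

Lemma generatedP x : x \in generated n t -> exists v, x = wval t v.
Proof. by case/mapP => v _ ->; exists v. Qed.

Lemma generatedM x y : x \in generated n t -> y \in generated n t ->
  x * y \in generated n t.
Proof.
by move=> /generatedP[v ->] /generatedP[w ->]; rewrite -wval_cat mem_generated.
Qed.

(* Left multiplication by an element permutes the finite set generated. *)
Lemma generated_exp x : x \in generated n t ->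
  exists2 k, 0 < k & x ^+ k = 1.
Proof.
move=> /generatedP[v ->]; set x' := wval t v.
have pw k : x' ^+ k \in generated n t.
  elim: k => [|k IH]; first by rewrite expg0 -(wval_nil t) mem_generated.
  by rewrite expgS generatedM // mem_generated.
pose N := size (generated n t).
have [i [j [ij eij]]] : exists i j, i < j /\ x' ^+ i = x' ^+ j.
  apply: contrapT => H.
  have u : uniq (map (fun k => x' ^+ k) (iota 0 N.+1)).
    rewrite map_inj_in_uniq ?iota_uniq // => a b _ _ /eqP ab.
    case: (ltngtP a b) => // lt; case: H; first by exists a, b; rewrite (eqP ab).
    by exists b, a; rewrite (eqP ab).
  have sub : {subset map (fun k => x' ^+ k) (iota 0 N.+1) <= generated n t}.
    by move=> y /mapP[k _ ->].
  by have := uniq_leq_size u sub; rewrite size_map size_iota ltnn.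
exists (j - i); first by rewrite subn_gt0.
by rewrite expgnFr ?(ltnW ij) // eij mulgV.
Qed.

Lemma generatedV x : x \in generated n t -> x^-1 \in generated n t.
Proof.
move=> xg; have [[//|k] _ xk] := generated_exp xg.
have -> : x^-1 = x ^+ k by apply: mulg1_eq; rewrite -expgS.
elim: k {xk} => [|k IH]; first by rewrite expg0 -(wval_nil t) mem_generated.
by rewrite expgS generatedM.
Qed.

Lemma generated_torsion x : x \in generated n t -> torsion x.
Proof. by move=> /generated_exp[k k0 xk]; exists k. Qed.

End Generated.
End Tuples.

(** * Short generating tuples of finite groups *)

Section Cube.
Local Open Scope group_scope.
Variable A : finGroupType.

(* Babai and Erdos: as long as C^-1 C is not everything, adding a new factor
   doubles the set C of subproducts. *)
Fixpoint subproducts (s : seq A) : {set A} :=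
  if s is x :: s' then subproducts s' :|: [set c * x | c in subproducts s']
  else [set 1].

Lemma subproducts_word s c : c \in subproducts s ->
  exists w : seq A, [/\ size w <= size s, {subset w <= s} & c = \prod_(x <- w) x].
Proof.
elim: s c => [|x s IH] c /=.
  by rewrite inE => /eqP->; exists [::]; rewrite big_nil.
rewrite inE => /orP[/IH[w [ws wss ->]]|/imsetP[d /IH[w [ws wss ->]] ->]].
  exists w; split=> //; first exact: leqW.
  by move=> y /wss ys; rewrite inE ys orbT.
exists (rcons w x); split; first by rewrite size_rcons.
  by move=> y; rewrite mem_rcons !inE => /orP[->//|/wss ->]; rewrite orbT.
by rewrite -cats1 big_cat big_seq1.
Qed.

Definition covers (s : seq A) : Prop :=
  forall x, exists c d, [/\ c \in subproducts s, d \in subproducts s & x = c^-1 * d].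

Lemma cube_exists n : exists s, size s = n /\ (covers s \/ 2 ^ n <= #|subproducts s|).
Proof.
elim: n => [|n [s [sn IH]]].
  by exists [::]; split=> //; right; rewrite /= cards1.
case: (pselect (covers s)) => [cs|ncs].
  exists (1 :: s); split; [by rewrite /= sn|left] => x.
  by have [c [d [hc hd ->]]] := cs x; exists c, d; rewrite /= !inE hc hd.
case: IH => // IH.
(* For [x] outside [C^-1 C] the sets [C] and [C x] are disjoint. *)
have [x hx] : exists x, forall c d, c \in subproducts s -> d \in subproducts s ->
    x <> c^-1 * d.
  apply: contra_notP ncs => H x; apply: contrapT => H'.
  by apply: H; exists x => c d hc hd xE; apply: H'; exists c, d.
exists (x :: s); split; [by rewrite /= sn|right] => /=.
rewrite cardsU (_ : _ :&: _ = set0) ?cards0 ?subn0.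
  by rewrite expnS mul2n -addnn leq_add // card_imset //; exact: mulIg.
apply/setP => y; rewrite !inE; apply/negP => /andP[ys /imsetP[c cs yE]].
by apply: (hx c y) => //; rewrite yE mulKg.
Qed.

(** Words being positive, the [r] elements are listed together with their inverses: then [c^-1 * d]
    is a word of length at most [r + r]. *)
Lemma cube_tuple r : #|A| <= 2 ^ r ->
  exists a : {ffun 'I_(r + r) -> A}, forall x, exists2 v, size v <= r + r & wval a v = x.
Proof.
move=> Ar; have [s [sr cov]] := cube_exists r.
have {cov} cov : covers s.
  (* If the doubling never stopped, the subproducts already exhaust [A]. *)
  case: cov => // h x; exists 1, x; rewrite invg1 mul1g.
  have all y : y \in subproducts s.
    have /eqP -> : subproducts s == [set: A].
      by rewrite eqEcard subsetT cardsT (leq_trans Ar h).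
    by rewrite inE.
  by rewrite !all.
pose ss := s ++ [seq x^-1 | x <- s].
have sz : size ss = r + r by rewrite size_cat size_map sr.
pose a : {ffun 'I_(r + r) -> A} := [ffun i : 'I_(r + r) => nth 1 ss i].
have lift w : {subset w <= ss} -> exists2 v, size v = size w &
    wval a v = \prod_(x <- w) x.
  elim: w => [|x w IH] ws; first by exists [::]; rewrite ?wval_nil ?big_nil.
  have [|v vw vE] := IH; first by move=> y yw; apply: ws; rewrite inE yw orbT.
  have xs : x \in ss by apply: ws; rewrite inE eqxx.
  have xi : index x ss < r + r by rewrite -sz index_mem.
  exists (Ordinal xi :: v); first by rewrite /= vw.
  by rewrite wval_cons big_cons vE ffunE nth_index.
exists a => x; have [c [d [/subproducts_word[u [us uss ->]] /subproducts_word[w [ws wss ->]] ->]]] := cov x.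
have [|v1 s1 E1] := lift [seq y^-1 | y <- rev u].
  move=> y /mapP[z]; rewrite mem_rev => /uss zs ->.
  by rewrite mem_cat map_f ?orbT.
have [|v2 s2 E2] := lift w; first by move=> y /wss ys; rewrite mem_cat ys.
exists (v1 ++ v2).
  by rewrite size_cat s1 s2 size_map size_rev; apply: leq_add; rewrite -sr.
rewrite wval_cat E1 E2; congr (_ * _).
elim: (u) => [|y u' IH]; first by rewrite !big_nil invg1.
by rewrite rev_cons map_rcons -cats1 big_cat big_seq1 /= IH big_cons invgM.
Qed.

End Cube.

Lemma dependent_choice (I : Type) (T : I -> Type) (Q : forall i, T i -> Prop) :
  (forall i, exists y, Q i y) -> exists f : forall i, T i, forall i, Q i (f i).
Proof. by move=> h; exists (fun i => projT1 (cid (h i))) => i; case: cid. Qed.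

Lemma class_count_finite (T : finType) (P : T -> Prop) (E : T -> T -> Prop) :
  (forall x, E x x) -> (forall x y, E x y -> E y x) ->
  (forall x y z, E x y -> E y z -> E x z) -> (forall x y, E x y -> P x -> P y) ->
  exists n, class_count P E n.
Proof.
move=> Er Es Et EP; pose c x := odflt x [pick y | `[< E x y >]].
have cE x : E x (c x).
  by rewrite /c; case: pickP => [y /asboolP //|/(_ x)] /=; rewrite asboolT.
have cq x y : E x y -> c x = c y.
  move=> xy; have eqp : (fun z => `[< E x z >]) =1 (fun z => `[< E y z >]).
    move=> z; apply/asboolP/asboolP => h; first exact: Et (Es _ _ xy) h.
    exact: Et xy h.
  rewrite /c (eq_pick eqp); case: pickP => // /(_ y).
  by rewrite asboolT.
exists #|{: {x : T | `[< P x >] && (c x == x)}}|.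
apply: (@class_count_finType _ _ _ _ val) => [[x /= /andP[/asboolP //]]|x y xy|x Px].
- apply: val_inj; have /andP[_ /eqP <-] := valP x; have /andP[_ /eqP <-] := valP y.
  exact: cq.
have h : `[< P (c x) >] && (c (c x) == c x).
  rewrite asboolT; last exact: EP (cE x) Px.
  by rewrite -(cq x (c x) (cE x)) /= eqxx.
by exists (exist _ (c x) h); exact: cE.
Qed.

Section TorsionFreeInteger.
Local Open Scope group_scope.
Local Notation Zm := (Algebra.to_multiplicative int).

Lemma integer_exp (x : Zm) n : (x ^+ n)%g = ((x : int) *+ n)%R.
Proof. by elim: n => [|n IH] //; rewrite expgS IH mulrS. Qed.

Lemma integer_torsion (x : Zm) : torsion x -> x = 1.
Proof.
case=> n n0; rewrite integer_exp => /eqP; rewrite Num.Theory.mulrn_eq0.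
by case: n n0 => // n _ /= /eqP.
Qed.

Lemma integer_cyclic (x : Zm) :
  exists n, x = ((Posz 1) : Zm) ^+ n \/ x = (((Posz 1) : Zm) ^+ n)^-1.
Proof.
case: x => n; [exists n; left|exists n.+1; right]; rewrite integer_exp.
  by rewrite -natz.
by rewrite NegzE -natz.
Qed.

End TorsionFreeInteger.

(** * Invariants of free products of finite and infinite cyclic groups *)

Section PlainProduct.
Local Open Scope group_scope.
Variables (k m : nat) (H : 'I_k -> finGroupType).
Local Notation F := (@plain_factor k m H).
Local Notation P := (free_product F).
Local Notation fin i x := (@fp_in _ F (inl i) x).

Section ClassCounts.
Variables (R n : nat) (A : groupType) (a : {ffun 'I_R -> A}).
Hypothesis sh : short n a.
Hypothesis nontrivial : exists i, a i != 1.

(** A tuple generating a nontrivial finite group is conjugate into a factor. Malnormality makes this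
    factor unique and reduces conjugacy to conjugacy within it, so the classes form a disjoint
    union. *)
Lemma class_count_free_product (e : 'I_k -> nat) :
  (forall i, class_count (fun s : {ffun 'I_R -> H i} => same_type a s)
     (@conjugate R (H i)) (e i)) ->
  class_count (fun s : {ffun 'I_R -> P} => same_type a s)
     (@conjugate R P) (\sum_i e i).
Proof.
move=> /dependent_choice[rho rhoP].
have -> : \sum_i e i = #|{: {i : 'I_k & 'I_(e i)}}|.
  rewrite card_tagged sumnE big_map big_enum /=.
  by apply: eq_bigr => i _; rewrite card_ord.
pose inj i (s : {ffun 'I_R -> H i}) : {ffun 'I_R -> P} := [ffun x => fin i (s x)].
have inj_type i (s : {ffun 'I_R -> H i}) : same_type s (inj i s).
  exact: (@same_type_morph R (H i) P (fun y => fin i y) s (@fp_inM _ F (inl i))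
    (@fp_in_inj _ F (inl i))).
have [x0 ax0] := nontrivial.
have type1 (G : groupType) (s : {ffun 'I_R -> G}) : same_type a s -> s x0 != 1.
  move=> as_; apply: contra_neq ax0 => sx.
  by have [_] := as_ [:: x0] [::]; rewrite !wval_seq1 !wval_nil sx; apply.
apply: (@class_count_finType _ _ _ _ (fun j => inj (tag j) (rho (tag j) (tagged j)))).
- move=> [i j] /=; have [h _ _] := rhoP i.
  exact: same_type_trans (h j) (inj_type _ _).
- move=> [i j] [i' j'] /= [g gE].
  have [h1 h2 _] := rhoP i; have [h1' _ _] := rhoP i'.
  have gx x : g * fin i (rho i j x) * g^-1 = fin i' (rho i' j' x).
    by move/ffunP: gE => /(_ x); rewrite !ffunE.
  have [kk gk Ek] := @fp_malnormal _ F (inl i) (rho i j x0) (inl i') (rho i' j' x0) g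
    (type1 (H i) _ (h1 j)) (gx x0).
  have ii : i = i' by have := congr1 tag Ek => -[].
  subst i'; congr existT; apply: h2; exists kk; apply/ffunP => x; rewrite ffunE.
  apply: (@fp_in_inj _ F (inl i)); rewrite -gx gk.
  by rewrite !(@fp_inM _ F (inl i)) (@fp_inV _ F (inl i)).
move=> s as_.
have shs : short n s := same_type_short as_ sh.
have tor x : x \in generated n s -> torsion x := @generated_torsion _ _ _ _ shs x.
have gen x : s x \in generated n s by rewrite -wval_seq1 mem_generated.
have [i [g gP]] := @torsion_set_conjugate _ F (fun f => f \in generated n s)
  _ (gen x0) (type1 _ _ as_)
  (fun f f' Tf Tf' => tor _ (generatedM shs Tf Tf')) tor.
have [h hE] := choice (fun x => gP _ (gen x)).
have sE x : s x = g * fp_in (h x) * g^-1 by [].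
have hx0 : h x0 != 1.
  apply: contra_neq (type1 _ _ as_) => hx.
  by rewrite sE hx (@fp_in1 _ F i) mulg1 mulgV.
case: i g gP h hE sE hx0 => [i|z] g gP h hE sE hx0; last first.
  (* A factor Z has no nontrivial torsion, so it cannot contain the tuple. *)
  case/eqP: hx0; apply: integer_torsion.
  have [N N0 sN] := tor _ (gen x0); exists N => //.
  apply: (@fp_in_inj _ F (inr z)).
  rewrite (morph_exp (@fp_inM _ F (inr z))) (@fp_in1 _ F (inr z)).
  have E : s x0 ^ g = fp_in (h x0) by rewrite sE conjgE -!mulgA mulVg mulg1 mulKg.
  by rewrite -E -conjXg sN conj1g.
pose h' : {ffun 'I_R -> H i} := [ffun x => h x].
have sc : conjugate (inj i h') s.
  by exists g; apply/ffunP => x; rewrite !ffunE sE.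
have ah : same_type a h'.
  apply: same_type_trans (same_type_sym (inj_type i h')).
  exact: same_type_conj (conjugate_sym sc) as_.
have [_ _ h3] := rhoP i; have [j [c cE]] := h3 _ ah.
exists (existT _ i j) => /=; apply: conjugate_trans (conjugate_sym sc) _.
exists (fin i c); rewrite cE; apply/ffunP => x; rewrite !ffunE.
by rewrite !(@fp_inM _ F (inl i)) (@fp_inV _ F (inl i)).
Qed.

End ClassCounts.

Local Notation B := (Algebra.to_multiplicative 'Z_2).

Definition hom_count (G : groupType) (n : nat) : Prop :=
  class_count (fun f : G -> B => {morph f : x y / x * y}) (fun f g => f =1 g) n.

Lemma integer_hom (b : B) :
  {morph (fun z : Algebra.to_multiplicative int => ((b : 'Z_2) *~ (z : int))%R : B) :
    x y / x * y}.
Proof. by move=> x y; exact: mulrzDr. Qed.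

Lemma hom_count_free_product (h : 'I_k -> nat) :
  (forall i, hom_count (H i) (h i)) -> hom_count P (\prod_i h i * 2 ^ m).
Proof.
move=> /dependent_choice[rho rhoP].
pose J := ({dffun forall i : 'I_k, 'I_(h i)} * {ffun 'I_m -> 'Z_2})%type.
have -> : (\prod_i h i * 2 ^ m)%N = #|{: J}|.
  rewrite card_prod card_dep_ffun card_ffun !card_ord; congr (_ * _)%N.
  rewrite foldrE big_map big_enum /=.
  by apply: eq_bigr => i _; rewrite card_ord.
pose f (j : J) (i : 'I_k + 'I_m) : F i -> B :=
  match i with
  | inl i => rho i (j.1 i)
  | inr z => fun x : int => ((j.2 z) *~ x)%R
  end.
have fM j i : {morph f j i : x y / x * y}.
  case: i => [i|z]; last exact: integer_hom.
  by have [h1 _ _] := rhoP i; exact: h1.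
apply: (@class_count_finType _ _ _ _ (fun j => fp_lift (f j))) => [j|j j' jj|g gM].
- by apply: fp_liftM.
- have E i x : f j i x = f j' i x by have := jj (@fp_in _ F i x); rewrite !fp_lift_in.
  case: j j' E {jj} => [c b] [c' b'] E; congr pair.
    by apply/ffunP => i; have [_ h2 _] := rhoP i; apply: h2 => x; exact: (E (inl i) x).
  apply/ffunP => z; have := E (inr z) (Posz 1); rewrite /= !mulr1z //.
have /dependent_choice[c cE] : forall i : 'I_k, exists j, (fun x => g (fin i x)) =1 rho i j.
  move=> i; have [_ _ h3] := rhoP i; apply: h3 => x y.
  by rewrite (@fp_inM _ F (inl i)) gM.
pose b : {ffun 'I_m -> 'Z_2} := [ffun z => g (@fp_in _ F (inr z) (Posz 1))].
exists ([ffun i => c i], b); apply: fp_morph_ext => //; first exact: fp_liftM.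
move=> i x; rewrite fp_lift_in //; case: i x => [i|z] x /=.
  by rewrite ffunE -cE.
pose g' := g \o @fp_in _ F (inr z).
have g'M : {morph g' : x y / x * y} by move=> u v; rewrite /g' /= (@fp_inM _ F (inr z)) gM.
pose f' := fun x : Algebra.to_multiplicative int => ((b z) *~ (x : int))%R : B.
have f'M : {morph f' : x y / x * y} by exact: integer_hom.
rewrite -[LHS]/(g' x) -[RHS]/(f' x).
have g'1 : g' (Posz 1) = f' (Posz 1) by rewrite /f' /b ffunE mulr1z.
have [n [->|->]] := integer_cyclic x.
  by rewrite (morph_exp g'M) (morph_exp f'M) g'1.
by rewrite (morph_inv g'M) (morph_inv f'M) (morph_exp g'M) (morph_exp f'M) g'1.
Qed.

End PlainProduct.

Section CountInvariance.
Local Open Scope group_scope.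

Lemma class_count_morph R (T G G' : groupType) (a : {ffun 'I_R -> T})
  (f : G -> G') n n' : {morph f : x y / x * y} -> bijective f ->
  class_count (fun s : {ffun 'I_R -> G} => same_type a s) (@conjugate R G) n ->
  class_count (fun s : {ffun 'I_R -> G'} => same_type a s) (@conjugate R G') n' ->
  n <= n'.
Proof.
move=> fM [g fK gK] c c'; apply: (@class_count_le _ _ _ _ _ _
  (fun s : {ffun 'I_R -> G} => [ffun i => f (s i)]) _ _ c c').
- exact: conjugate_sym.
- exact: conjugate_trans.
- move=> s as_; apply: same_type_trans as_ _.
  by apply: same_type_morph => //; exact: can_inj fK.
move=> s s' _ _ [h hE]; exists (g h); apply/ffunP => i.
move/ffunP: hE => /(_ i); rewrite !ffunE => hE.
by apply: (can_inj fK); rewrite hE !fM (morph_inv fM) gK.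
Qed.

Lemma isomorphic_sym (G G' : groupType) : isomorphic G G' -> isomorphic G' G.
Proof.
move=> /isomorphicP[f [fM [g fK gK]]]; apply/isomorphicP; exists g; split; last by exists f.
by move=> x y; apply: (can_inj fK); rewrite fM !gK.
Qed.

Lemma isomorphic_trans (G1 G2 G3 : groupType) :
  isomorphic G1 G2 -> isomorphic G2 G3 -> isomorphic G1 G3.
Proof.
move=> /isomorphicP[f [fM fb]] /isomorphicP[g [gM gb]]; apply/isomorphicP.
by exists (g \o f); split; [move=> x y; rewrite /= fM gM|exact: bij_comp].
Qed.

Lemma class_count_iso R (T G G' : groupType) (a : {ffun 'I_R -> T}) n n' :
  isomorphic G G' ->
  class_count (fun s : {ffun 'I_R -> G} => same_type a s) (@conjugate R G) n ->
  class_count (fun s : {ffun 'I_R -> G'} => same_type a s) (@conjugate R G') n' ->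
  n = n'.
Proof.
move=> GG' c c'; apply/eqP; rewrite eqn_leq.
have /isomorphicP[f [fM fb]] := GG'.
have /isomorphicP[g [gM gb]] := isomorphic_sym GG'.
by rewrite (class_count_morph fM fb c c') (class_count_morph gM gb c' c).
Qed.

Lemma hom_count_iso (G G' : groupType) n n' : isomorphic G G' ->
  hom_count G n -> hom_count G' n' -> n = n'.
Proof.
have le (K K' : groupType) p p' : isomorphic K K' -> hom_count K p ->
    hom_count K' p' -> p' <= p.
  move=> /isomorphicP[f [fM [g fK gK]]] c c'.
  apply: (@class_count_le _ _ _ _ _ _ (fun s : K' -> _ => s \o f) _ _ c' c).
  - by move=> s s' ss x.
  - by move=> s s' s'' ss ss' x; rewrite ss ss'.
  - by move=> s sM x y; rewrite /= fM sM.
  - by move=> s s' _ _ ss x; have := ss (g x); rewrite /= gK.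
move=> GG' c c'; apply/eqP; rewrite eqn_leq (le _ _ _ _ GG' c c').
by rewrite (le _ _ _ _ (isomorphic_sym GG') c' c).
Qed.

Lemma hom_count_finite (A : finGroupType) : exists n, 0 < n /\ hom_count A n.
Proof.
pose hom (f : {ffun A -> 'Z_2}) := [forall x : A, forall y : A, f (x * y) == (f x + f y)%R].
have homP (f : {ffun A -> 'Z_2}) : reflect (forall x y, f (x * y) = (f x + f y)%R) (hom f).
  apply: (iffP forallP) => [h x y|h x]; first exact: (eqP (forallP (h x) y)).
  by apply/forallP => y; rewrite h.
have hom0 : hom [ffun=> 0%R].
  by apply/homP => x y; rewrite !ffunE GRing.addr0.
exists #|{: {f | hom f}}|; split.
  by apply/card_gt0P; exists (exist _ [ffun=> 0%R] hom0).
apply: (@class_count_finType _ _ _ _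
  (fun (j : {f | hom f}) => (fun x => sval j x) : A -> Algebra.to_multiplicative 'Z_2)).
- by move=> [f fM]; exact/homP.
- by move=> [f fM] [g gM] /= fg; apply: val_inj => /=; apply/ffunP => x; exact: fg.
move=> f fM.
have h : hom [ffun z => f z] by apply/homP => x y; rewrite !ffunE fM.
by exists (exist _ [ffun z => f z] h) => x; rewrite /= ffunE.
Qed.

End CountInvariance.

(** * Recovering the finite factors from the class counts *)

Section Matching.
Local Open Scope group_scope.
Variables (R n : nat).
Local Notation cc a G e := (class_count (fun s : {ffun 'I_R -> G} => same_type a s)
  (@conjugate R G) e).

Lemma class_count_transport (T G G' : groupType) (a : {ffun 'I_R -> T}) e :
  isomorphic G G' -> cc a G e -> cc a G' e.
Proof.
move=> /isomorphicP[f [fM [g fK gK]]] [rho [h1 h2 h3]].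
have fI := can_inj fK; have gI := can_inj gK.
have gM : {morph g : x y / x * y} by move=> x y; apply: fI; rewrite fM !gK.
exists (fun j => [ffun i => f (rho j i)]); split=> [j|j j' [h hE]|s as_].
- by apply: same_type_trans (h1 j) _; apply: same_type_morph.
- apply: h2; exists (g h); apply/ffunP => i.
  move/ffunP: hE => /(_ i); rewrite !ffunE => hE.
  by apply: fI; rewrite hE !fM (morph_inv fM) gK.
have [|j [h hE]] := h3 [ffun i => g (s i)].
  by apply: same_type_trans as_ _; apply: same_type_morph.
exists j, (f h); apply/ffunP => i; rewrite !ffunE.
move/ffunP: hE => /(_ i); rewrite !ffunE => ->.
by rewrite !fM (morph_inv fM) gK.
Qed.

Lemma class_count_same_type (T T' G : groupType) (a : {ffun 'I_R -> T})
  (b : {ffun 'I_R -> T'}) e : same_type a b -> cc a G e -> cc b G e.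
Proof.
move=> ab [rho [h1 h2 h3]]; exists rho; split=> // [j|s bs].
  exact: same_type_trans (same_type_sym ab) (h1 j).
by apply: h3; apply: same_type_trans ab bs.
Qed.

Lemma class_count_exists (T : groupType) (A : finGroupType) (a : {ffun 'I_R -> T}) :
  exists e, cc a A e.
Proof.
apply: class_count_finite.
- exact: conjugate_refl.
- exact: conjugate_sym.
- exact: conjugate_trans.
- by move=> x y xy; apply: same_type_conj.
Qed.

Section Full.
Variables (A : finGroupType) (a : {ffun 'I_R -> A}).
Hypothesis full : forall x, exists v, wval a v = x.

(** For a tuple reaching all of [A], the tuples of its type are the embeddings of [A]; a positive
    class count thus detects an embedding. *)
Lemma same_type_embedding (G : groupType) (s : {ffun 'I_R -> G}) : same_type a s ->
  exists f : A -> G, [/\ {morph f : x y / x * y}, injective f & forall v, f (wval a v) = wval s v].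
Proof.
move=> as_; have [w wE] := choice full.
have fE v : wval s (w (wval a v)) = wval s v by apply/as_.
exists (fun x => wval s (w x)); split=> // [x y|x y].
  have xyE : x * y = wval a (w x ++ w y) by rewrite wval_cat !wE.
  by rewrite xyE fE wval_cat.
by move/as_; rewrite !wE.
Qed.

Lemma class_count_embedding (G : groupType) e : cc a G e -> 0 < e ->
  exists f : A -> G, {morph f : x y / x * y} /\ injective f.
Proof.
case=> rho [h1 _ _]; case: e rho h1 => // e rho h1 _.
by have [f [fM fI _]] := same_type_embedding (h1 ord0); exists f.
Qed.

Lemma class_count_gt0 (G : groupType) e : isomorphic A G -> cc a G e -> 0 < e.
Proof.
move=> /isomorphicP[f [fM [g fK gK]]] [rho [_ _ h3]].
have [|j _] := h3 [ffun i => f (a i)]; last by case: e j {rho h3} => // -[].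
by apply: same_type_morph; last exact: can_inj fK.
Qed.

End Full.

Variables (k k' : nat) (H : 'I_k -> finGroupType) (H' : 'I_k' -> finGroupType).

Definition occurs (A : finGroupType) : Prop :=
  (exists i, isomorphic A (H i)) \/ (exists j, isomorphic A (H' j)).

(** The sums range over the factors not yet matched, which makes the condition stable under removal
    of an isomorphic pair. *)
Definition balanced (D : {set 'I_k}) (D' : {set 'I_k'}) : Prop :=
  forall (A : finGroupType) (a : {ffun 'I_R -> A}), occurs A -> 1 < #|A| ->
  short n a -> (forall x, exists v, wval a v = x) ->
  forall e e', (forall i, cc a (H i) (e i)) -> (forall j, cc a (H' j) (e' j)) ->
  \sum_(i in D) e i = \sum_(j in D') e' j.

Hypothesis full_tuple : forall A : finGroupType, occurs A ->
  exists a : {ffun 'I_R -> A}, short n a /\ forall x, exists v, wval a v = x.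

Lemma isomorphic_refl (G : groupType) : isomorphic G G.
Proof. by apply/isomorphicP; exists id; split=> //; exists id. Qed.

Lemma embedding_isomorphic (A B : finGroupType) (f : A -> B) :
  {morph f : x y / x * y} -> injective f -> #|B| <= #|A| -> isomorphic A B.
Proof.
by move=> fM fI BA; apply/isomorphicP; exists f; split=> //; apply: inj_card_bij.
Qed.

(* A nontrivial factor of maximal order embeds in no other factor than those
   isomorphic to it, so it has a partner. *)
Lemma find_pair D D' : balanced D D' ->
  (exists2 i, i \in D & 1 < #|H i|) \/ (exists2 j, j \in D' & 1 < #|H' j|) ->
  exists i j, [/\ i \in D, j \in D', 1 < #|H i| & isomorphic (H i) (H' j)].
Proof.
move=> bal ex.
pose Q c := [exists i in D, #|H i| == c] || [exists j in D', #|H' j| == c].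
have Qb c : Q c -> c <= \sum_i #|H i| + \sum_j #|H' j|.
  case/orP => /existsP[i /andP[_ /eqP<-]]; rewrite (bigD1 i) //=; last rewrite addnCA;
  by rewrite -?addnA leq_addr.
have QH i : i \in D -> Q #|H i|.
  by move=> iD; apply/orP; left; apply/existsP; exists i; rewrite iD eqxx.
have QH' j : j \in D' -> Q #|H' j|.
  by move=> jD; apply/orP; right; apply/existsP; exists j; rewrite jD eqxx.
have Qe : exists c, Q c.
  by case: ex => -[i iD _]; [exists #|H i|; apply: QH|exists #|H' i|; apply: QH'].
case: (ex_maxnP Qe Qb) => c Qc cmax.
have c1 : 1 < c.
  by case: ex => -[i iD h]; apply: leq_trans h (cmax _ _); [apply: QH|apply: QH'].
case/orP: Qc => /existsP[i /andP[iD /eqP iE]].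
  have oc : occurs (H i) by left; exists i; exact: isomorphic_refl.
  have [a [sh full]] := full_tuple oc.
  have [e eP] := dependent_choice (fun i => class_count_exists (H i) a).
  have [e' eP'] := dependent_choice (fun j => class_count_exists (H' j) a).
  have S := bal _ _ oc (ltac:(by rewrite iE)) sh full _ _ eP eP'.
  have ei : 0 < e i := class_count_gt0 (isomorphic_refl _) (eP i).
  have : 0 < \sum_(j in D') e' j.
    by rewrite -S (bigD1 i) //=; apply: leq_trans ei (leq_addr _ _).
  rewrite lt0n sum_nat_eq0 negb_forall => /existsP[j].
  rewrite negb_imply -lt0n => /andP[jD ej].
  have [f [fM fI]] := class_count_embedding full (eP' j) ej.
  exists i, j; split=> //; first by rewrite iE.
  by apply: embedding_isomorphic fM fI _; rewrite iE cmax // QH'.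
have oc : occurs (H' i) by right; exists i; exact: isomorphic_refl.
have [a [sh full]] := full_tuple oc.
have [e eP] := dependent_choice (fun i => class_count_exists (H i) a).
have [e' eP'] := dependent_choice (fun j => class_count_exists (H' j) a).
have S := bal _ _ oc (ltac:(by rewrite iE)) sh full _ _ eP eP'.
have ei : 0 < e' i := class_count_gt0 (isomorphic_refl _) (eP' i).
have : 0 < \sum_(j in D) e j.
  by rewrite S (bigD1 i) //=; apply: leq_trans ei (leq_addr _ _).
rewrite lt0n sum_nat_eq0 negb_forall => /existsP[j].
rewrite negb_imply -lt0n => /andP[jD ej].
have [f [fM fI]] := class_count_embedding full (eP j) ej.
have iso : isomorphic (H' i) (H j).
  by apply: embedding_isomorphic fM fI _; rewrite iE cmax // QH.
exists j, i; split=> //; last exact: isomorphic_sym.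
by apply: leq_trans c1 _; rewrite -iE; apply: leq_card fI.
Qed.

(** Isomorphic factors contribute equally to both sums, so balance survives their removal and the
    pairing can be repeated until only trivial factors are left. *)
Lemma matching D D' : balanced D D' -> exists l : seq ('I_k * 'I_k'),
  [/\ uniq (unzip1 l) /\ uniq (unzip2 l),
      forall p, p \in l -> [/\ p.1 \in D, p.2 \in D' & isomorphic (H p.1) (H' p.2)],
      forall i, i \in D -> i \notin unzip1 l -> #|H i| <= 1 &
      forall j, j \in D' -> j \notin unzip2 l -> #|H' j| <= 1].
Proof.
have [N] := ubnP #|D|; elim: N D D' => // N IH D D' DN bal.
case: (pselect ((exists2 i, i \in D & 1 < #|H i|) \/
                (exists2 j, j \in D' & 1 < #|H' j|))) => ex; last first.
  exists [::]; split=> // i iD _; rewrite leqNgt; apply/negP => h; apply: ex.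
    by left; exists i.
  by right; exists i.
have [i [j [iD jD i1 iso]]] := find_pair bal ex.
have [||l [[u1 u2] lP l1 l2]] := IH (D :\ i) (D' :\ j).
- by move: DN; rewrite (cardsD1 i) iD.
- move=> A a oc A1 sh full e e' eP eP'.
  have := bal A a oc A1 sh full e e' eP eP'.
  rewrite (big_setD1 i) //= (big_setD1 j) //=.
  by rewrite (class_count_iso iso (eP i) (eP' j)) => /addnI.
exists ((i, j) :: l); split.
- split; rewrite /= ?u1 ?u2 andbT.
    by apply/negP => /mapP[p /lP[+ _ _] E]; rewrite -E !inE eqxx.
  by apply/negP => /mapP[p /lP[_ + _] E]; rewrite -E !inE eqxx.
- move=> p; rewrite inE => /orP[/eqP->//|/lP[]].
  by rewrite !inE => /andP[_ ->] /andP[_ ->].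
- move=> x xD; rewrite inE negb_or => /andP[xi xl].
  by apply: l1 => //; rewrite !inE xi.
- move=> x xD; rewrite inE negb_or => /andP[xi xl].
  by apply: l2 => //; rewrite !inE xi.
Qed.

End Matching.

Lemma hom_count_transport (G G' : groupType) c :
  isomorphic G G' -> hom_count G c -> hom_count G' c.
Proof.
move=> /isomorphicP[f [fM [g fK gK]]] [rho [h1 h2 h3]].
have gM : {morph g : x y / (x * y)%g} by move=> x y; apply: (can_inj fK); rewrite fM !gK.
exists (fun j => rho j \o g); split=> [j x y|j j' E|s sM].
- by rewrite /= gM h1.
- by apply: h2 => x; have := E (f x); rewrite /= fK.
have [|j jE] := h3 (s \o f); first by move=> x y; rewrite /= fM sM.
by exists j => x; rewrite /= -jE /= gK.
Qed.

Section Assembly.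
Local Open Scope group_scope.
Variables (k k' m : nat) (H : 'I_k -> finGroupType) (H' : 'I_k' -> finGroupType).
Local Notation F := (@plain_factor k m H).
Local Notation F' := (@plain_factor k' m H').

Lemma trivial_group (A : finGroupType) (x : A) : #|A| <= 1 -> x = 1.
Proof.
move=> /card_le1P /(_ x isT) h; have := h 1.
by rewrite !inE => /esym /eqP.
Qed.

Variable l : seq ('I_k * 'I_k').
Hypothesis u1 : uniq (unzip1 l).
Hypothesis u2 : uniq (unzip2 l).
Hypothesis iso : forall p, p \in l -> isomorphic (H p.1) (H' p.2).
Hypothesis triv : forall i, i \notin unzip1 l -> #|H i| <= 1.
Hypothesis triv' : forall j, j \notin unzip2 l -> #|H' j| <= 1.

Definition partner (i : 'I_k) : option 'I_k' := ohead [seq p.2 | p <- l & p.1 == i].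
Definition partner' (j : 'I_k') : option 'I_k := ohead [seq p.1 | p <- l & p.2 == j].

Lemma partnerP i j : (partner i == Some j) = ((i, j) \in l).
Proof.
rewrite /partner; elim: l u1 => //= -[a b] s IH /andP[a_s us].
rewrite inE /= -(IH us); have [E|ai] := eqVneq a i; last first.
  by rewrite xpair_eqE [i == a]eq_sym (negPf ai).
subst a; rewrite /= xpair_eqE eqxx /= [j == b]eq_sym; apply/eqP/orP => [[->]|]; first by left.
case=> [/eqP->//|]; rewrite IH // => ijs.
by case/negP: a_s; apply/mapP; exists (i, j).
Qed.

Lemma partner'P i j : (partner' j == Some i) = ((i, j) \in l).
Proof.
rewrite /partner'; elim: l u2 => //= -[a b] s IH /andP[b_s us].
rewrite inE /= -(IH us); have [E|bj] := eqVneq b j; last first.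
  by rewrite xpair_eqE [j == b]eq_sym (negPf bj) andbF.
subst b; rewrite /= xpair_eqE eqxx andbT [i == a]eq_sym; apply/eqP/orP => [[->]|]; first by left.
case=> [/eqP->//|]; rewrite IH // => ijs.
by case/negP: b_s; apply/mapP; exists (i, j).
Qed.

Lemma partner_none i (x : H i) : partner i = None -> x = 1.
Proof.
move=> pi; apply: trivial_group; apply: triv; apply/negP => /mapP[[i' j] ij /= E].
by subst i'; move: ij; rewrite -partnerP pi.
Qed.

Lemma partner'_none j (x : H' j) : partner' j = None -> x = 1.
Proof.
move=> pj; apply: trivial_group; apply: triv'; apply/negP => /mapP[[i j'] ij /= E].
by subst j'; move: ij; rewrite -partner'P pj.
Qed.

(** The presentation of a free product may contain any number of trivial factors; those without a
    partner are sent to 1. *)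
Lemma free_products_isomorphic : isomorphic (free_product F) (free_product F').
Proof.
have /dependent_choice[phi phiP] : forall p : 'I_k * 'I_k',
    exists fg : (H p.1 -> H' p.2) * (H' p.2 -> H p.1),
    p \in l -> [/\ {morph fg.1 : x y / x * y}, {morph fg.2 : x y / x * y},
      cancel fg.1 fg.2 & cancel fg.2 fg.1].
  move=> p; have [pl|pl] := boolP (p \in l); last by exists (fun=> 1, fun=> 1).
  have /isomorphicP[f [fM [g fK gK]]] := iso pl; exists (f, g) => _; split=> //=.
  by move=> x y; apply: (can_inj fK); rewrite fM !gK.
pose f (i : 'I_k + 'I_m) : F i -> free_product F' :=
  match i with
  | inl i => fun x => if partner i is Some j
      then @fp_in _ F' (inl j) ((phi (i, j)).1 x) else 1
  | inr z => fun x => @fp_in _ F' (inr z) x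
  end.
pose g (j : 'I_k' + 'I_m) : F' j -> free_product F :=
  match j with
  | inl j => fun x => if partner' j is Some i
      then @fp_in _ F (inl i) ((phi (i, j)).2 x) else 1
  | inr z => fun x => @fp_in _ F (inr z) x
  end.
have fM i : {morph f i : x y / x * y}.
  case: i => [i|z] x y /=; last exact: (@fp_inM _ F' (inr z)).
  case E : (partner i) => [j|]; last by rewrite mulg1.
  have [h _ _ _] := phiP (i, j) (ltac:(by rewrite -partnerP E)).
  by rewrite h (@fp_inM _ F' (inl j)).
have gM j : {morph g j : x y / x * y}.
  case: j => [j|z] x y /=; last exact: (@fp_inM _ F (inr z)).
  case E : (partner' j) => [i|]; last by rewrite mulg1.
  have [_ h _ _] := phiP (i, j) (ltac:(by rewrite -partner'P E)).
  by rewrite h (@fp_inM _ F (inl i)).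
have fhM := fp_liftM fM; have ghM := fp_liftM gM.
apply/isomorphicP; exists (fp_lift f); split=> //; exists (fp_lift g).
- apply: (@fp_morph_ext _ F (free_product F) (fp_lift g \o fp_lift f) id) => //.
    by move=> x y; rewrite /= fhM ghM.
  move=> [i|z] x; rewrite /= fp_lift_in //=; last by rewrite (fp_lift_in gM (i := inr z)).
  case E : (partner i) => [j|].
    have ij : (i, j) \in l by rewrite -partnerP E.
    rewrite (fp_lift_in gM (i := inl j)) /=.
    have /eqP -> : partner' j == Some i by rewrite partner'P.
    by have [_ _ -> _] := phiP _ ij.
  by rewrite (partner_none x E) (@fp_in1 _ F (inl i)) (morph_one ghM).
apply: (@fp_morph_ext _ F' (free_product F') (fp_lift f \o fp_lift g) id) => //.
  by move=> x y; rewrite /= ghM fhM.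
move=> [j|z] x; rewrite /= fp_lift_in //=; last by rewrite (fp_lift_in fM (i := inr z)).
case E : (partner' j) => [i|].
  have ij : (i, j) \in l by rewrite -partner'P E.
  rewrite (fp_lift_in fM (i := inl i)) /=.
  have /eqP -> : partner i == Some j by rewrite partnerP.
  by have [_ _ _ ->] := phiP _ ij.
by rewrite (partner'_none x E) (@fp_in1 _ F' (inl j)) (morph_one fhM).
Qed.

End Assembly.

(** * Sufficiency of the invariants *)

Section PlainIsomorphism.
Local Open Scope group_scope.
Variables (G G' : groupType) (k k' m m' : nat).
Variables (H : 'I_k -> finGroupType) (H' : 'I_k' -> finGroupType).
Hypothesis GP : isomorphic G (free_product (@plain_factor k m H)).
Hypothesis GP' : isomorphic G' (free_product (@plain_factor k' m' H')).
Variable r : nat.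
Hypothesis small : forall i, #|H i| <= 2 ^ r.
Hypothesis small' : forall j, #|H' j| <= 2 ^ r.
Local Notation R := (r + r)%N.
Local Notation cc t G e := (class_count (fun s : {ffun 'I_R -> G} => same_type t s)
  (@conjugate R G) e).

Hypothesis counts : forall t : {ffun 'I_R -> G}, short R t ->
  forall e e', cc t G e -> cc t G' e' -> e = e'.
Hypothesis counts' : forall t : {ffun 'I_R -> G'}, short R t ->
  forall e e', cc t G e -> cc t G' e' -> e = e'.
Hypothesis homs : forall c c', hom_count G c -> hom_count G' c' -> c = c'.

Lemma plain_full_tuple (A : finGroupType) : occurs H H' A ->
  exists a : {ffun 'I_R -> A}, short R a /\ forall x, exists v, wval a v = x.
Proof.
move=> oc; have Ar : #|A| <= 2 ^ r.
  by case: oc => -[i /isomorphicP[f [_ /bij_inj fI]]];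
    apply: leq_trans (leq_card _ fI) _.
have [a aP] := cube_tuple Ar; exists a; split=> [v _|x].
  by have [w wR wE] := aP (wval a v); exists w.
by have [v _ vx] := aP x; exists v.
Qed.

Lemma embed_tuple (K : groupType) (A : finGroupType) (B : finGroupType)
  kk mm (HH : 'I_kk -> finGroupType) i (a : {ffun 'I_R -> A}) :
  isomorphic K (free_product (@plain_factor kk mm HH)) -> isomorphic A (HH i) ->
  exists t : {ffun 'I_R -> K}, same_type a t.
Proof.
move=> /isomorphic_sym /isomorphicP[f [fM /bij_inj fI]].
move=> /isomorphicP[g [gM /bij_inj gI]].
exists [ffun x => f (@fp_in _ (@plain_factor kk mm HH) (inl i) (g (a x)))].
apply: (@same_type_morph R A K (fun y => f (@fp_in _ (@plain_factor kk mm HH) (inl i) (g y)))).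
  by move=> x y; rewrite gM (@fp_inM _ (@plain_factor kk mm HH) (inl i)) fM.
by move=> x y /fI /(@fp_in_inj _ (@plain_factor kk mm HH) (inl i)) /gI.
Qed.

(** The reference tuple must live in a group that contains [A]. A factor may at first be known in
    only one of the two groups, which is why [counts] and [counts'] are both assumed. *)
Lemma plain_balanced : @balanced R R k k' H H' [set: 'I_k] [set: 'I_k'].
Proof.
move=> A a oc A1 sh full e e' eP eP'.
have sumT (K : finType) (f : K -> nat) : \sum_(i in [set: K]) f i = \sum_i f i.
  by apply: eq_bigl => i; rewrite inE.
rewrite !sumT {sumT}.
have nontrivial : exists i, a i != 1.
  apply: contrapT => H0; have a1 v : wval a v = 1.
    rewrite /wval big1 // => i _; apply: contrapT => ai; apply: H0.
    by exists i; apply/eqP.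
  move: A1; rewrite ltnNge => /negP; apply; apply/card_le1P => x _ y.
  have [v <-] := full x; have [w <-] := full y.
  by rewrite !a1 !inE eqxx.
have c := class_count_transport (isomorphic_sym GP)
  (@class_count_free_product k m H R R A a sh nontrivial e eP).
have c' := class_count_transport (isomorphic_sym GP')
  (@class_count_free_product k' m' H' R R A a sh nontrivial e' eP').
case: oc => -[i iso].
  have [t at_] := @embed_tuple _ _ A _ _ _ _ a GP iso.
  apply: (counts (same_type_short at_ sh)); exact: (class_count_same_type at_).
have [t at_] := @embed_tuple _ _ A _ _ _ _ a GP' iso.
apply: (counts' (same_type_short at_ sh)); exact: (class_count_same_type at_).
Qed.

Lemma plain_isomorphic : isomorphic G G'.
Proof.
have [l [[u1 u2] lP l1 l2]] := matching plain_full_tuple plain_balanced.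
have iso p : p \in l -> isomorphic (H p.1) (H' p.2) by case/lP.
have triv i : i \notin unzip1 l -> #|H i| <= 1 by apply: l1; rewrite inE.
have triv' i : i \notin unzip2 l -> #|H' i| <= 1 by apply: l2; rewrite inE.
have [h hP] := choice (fun i => hom_count_finite (H i)).
have [h' hP'] := choice (fun i => hom_count_finite (H' i)).
have c := hom_count_transport (isomorphic_sym GP)
  (@hom_count_free_product k m H h (fun i => (hP i).2)).
have c' := hom_count_transport (isomorphic_sym GP')
  (@hom_count_free_product k' m' H' h' (fun i => (hP' i).2)).
have E := homs c c'.
have h1 (A : finGroupType) n : #|A| <= 1 -> hom_count A n -> n = 1%N.
  move=> A1; have c1 : hom_count A 1.
    exists (fun _ _ => 1); split=> [j x y|j j'|f fM]; first by rewrite mulg1.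
      by rewrite !ord1.
    by exists ord0 => x; rewrite (trivial_group x A1) (morph_one fM).
  have refl : isomorphic A A by exact: isomorphic_refl.
  by move=> cn; apply: hom_count_iso refl cn c1.
have prodE (p : nat) (K : 'I_p -> nat) (s : seq 'I_p) : uniq s ->
    (forall i, i \notin s -> K i = 1%N) -> (\prod_i K i = \prod_(i <- s) K i)%N.
  move=> us Ks; rewrite [RHS]big_uniq //= [LHS](bigID (mem s)) /=.
  by rewrite [X in (_ * X)%N]big1 ?muln1 // => i /Ks.
have P1 := prodE _ h _ u1 (fun i ni => h1 _ _ (triv i ni) (hP i).2).
have P2 := prodE _ h' _ u2 (fun i ni => h1 _ _ (triv' i ni) (hP' i).2).
(* Matched factors have equally many homomorphisms, and trivial factors have one. *)
have PP : (\prod_i h i = \prod_i h' i)%N.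
  rewrite P1 P2 !big_map big_seq [RHS]big_seq; apply: eq_bigr => p pl.
  exact: hom_count_iso (iso p pl) (hP _).2 (hP' _).2.
(* The positive product of the finite factors cancels, leaving [2 ^ m = 2 ^ m']. *)
have mm : m = m'.
  apply/eqP; rewrite -(eqn_exp2l m m' (isT : 1 < 2)); apply/eqP.
  have hpos : 0 < (\prod_i h i)%N by rewrite prodn_gt0 // => i; have [] := hP i.
  by move: E; rewrite PP => /eqP; rewrite eqn_pmul2l -?PP // => /eqP.
move: GP'; rewrite -mm => GP2.
exact: isomorphic_trans (isomorphic_trans GP (free_products_isomorphic m u1 u2 iso triv triv'))
  (isomorphic_sym GP2).
Qed.

End PlainIsomorphism.

(** * Computable functions *)

Fixpoint rename (r : nat -> nat) (e : expr) : expr :=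
  let up r i := if i is j.+1 then (r j).+1 else 0 in
  match e with
  | Var i => Var (r i)
  | Const n => Const n
  | Add a b => Add (rename r a) (rename r b)
  | Sub a b => Sub (rename r a) (rename r b)
  | Mul a b => Mul (rename r a) (rename r b)
  | Let a b => Let (rename r a) (rename (up r) b)
  | Rec c n x s =>
      Rec (rename r c) (rename r n) (rename r x) (rename (up (up r)) s)
  end.

Lemma eval_rename e r v : eval (rename r e) v = eval e (v \o r).
Proof.
elim: e r v => [i|n|a IHa b IHb|a IHa b IHb|a IHa b IHb|a IHa b IHb|c IHc n IHn x IHx s IHs] r v //=.
- by rewrite IHa IHb.
- by rewrite IHa IHb.
- by rewrite IHa IHb.
- by rewrite IHb IHa; congr eval; apply: funext => -[|i].
- rewrite IHc IHn IHx; congr capped_rec; apply: funext => i; apply: funext => y.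
  by rewrite IHs; congr eval; apply: funext => -[|[|j]].
Qed.

Fixpoint substitute (s : nat -> expr) (e : expr) : expr :=
  let up s i := if i is j.+1 then rename succn (s j) else Var 0 in
  match e with
  | Var i => s i
  | Const n => Const n
  | Add a b => Add (substitute s a) (substitute s b)
  | Sub a b => Sub (substitute s a) (substitute s b)
  | Mul a b => Mul (substitute s a) (substitute s b)
  | Let a b => Let (substitute s a) (substitute (up s) b)
  | Rec c n x f => Rec (substitute s c) (substitute s n) (substitute s x)
      (substitute (up (up s)) f)
  end.

Lemma eval_substitute e s v :
  eval (substitute s e) v = eval e (fun i => eval (s i) v).
Proof.
elim: e s v => [i|n|a IHa b IHb|a IHa b IHb|a IHa b IHb|a IHa b IHb|c IHc n IHn x IHx f IHf] s v //=.
- by rewrite IHa IHb.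
- by rewrite IHa IHb.
- by rewrite IHa IHb.
- rewrite IHb IHa; congr eval; apply: funext => -[|i] //=.
  by rewrite eval_rename; congr eval; apply: funext.
- rewrite IHc IHn IHx; congr capped_rec; apply: funext => i; apply: funext => y.
  rewrite IHf; congr eval; apply: funext => -[|[|j]] //=.
  by rewrite !eval_rename; congr eval; apply: funext.
Qed.

(** Only the existence of an expression is recorded: the machine needs some expression, never its
    shape. *)
Definition computable (f : (nat -> nat) -> nat) : Prop :=
  exists e, forall v, eval e v = f v.

Lemma computable_eq f g : computable f -> f =1 g -> computable g.
Proof. by move=> [e eE] fg; exists e => v; rewrite eE fg. Qed.

Lemma computable_comp g (s : nat -> (nat -> nat) -> nat) : computable g ->
  (forall i, computable (s i)) -> computable (fun v => g (fun i => s i v)).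
Proof.
move=> [e eE] /choice[es esE]; exists (substitute es e) => v.
by rewrite eval_substitute eE; congr g; apply: funext.
Qed.

Lemma computable_var i : computable (fun v => v i).
Proof. by exists (Var i). Qed.

Lemma computable_const n : computable (fun _ => n).
Proof. by exists (Const n). Qed.

Section Apply.
Variables a1 a2 a3 a4 a5 a6 a7 a8 a9 : (nat -> nat) -> nat.
Hypotheses (h1 : computable a1) (h2 : computable a2) (h3 : computable a3)
  (h4 : computable a4) (h5 : computable a5) (h6 : computable a6)
  (h7 : computable a7) (h8 : computable a8) (h9 : computable a9).

Lemma computable2 (g : nat -> nat -> nat) : computable (fun v => g (v 0) (v 1)) ->
  computable (fun v => g (a1 v) (a2 v)).
Proof.
move=> hg; apply: (computable_comp (s := nth a1 [:: a1; a2]) hg).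
by case=> [|[|[|i]]].
Qed.

Lemma computable3 (g : nat -> nat -> nat -> nat) :
  computable (fun v => g (v 0) (v 1) (v 2)) ->
  computable (fun v => g (a1 v) (a2 v) (a3 v)).
Proof.
move=> hg; apply: (computable_comp (s := nth a1 [:: a1; a2; a3]) hg).
by case=> [|[|[|[|i]]]].
Qed.

Lemma computable5 (g : nat -> nat -> nat -> nat -> nat -> nat) :
  computable (fun v => g (v 0) (v 1) (v 2) (v 3) (v 4)) ->
  computable (fun v => g (a1 v) (a2 v) (a3 v) (a4 v) (a5 v)).
Proof.
move=> hg; apply: (computable_comp (s := nth a1 [:: a1; a2; a3; a4; a5]) hg).
by case=> [|[|[|[|[|[|i]]]]]].
Qed.

Lemma computable6 (g : nat -> nat -> nat -> nat -> nat -> nat -> nat) :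
  computable (fun v => g (v 0) (v 1) (v 2) (v 3) (v 4) (v 5)) ->
  computable (fun v => g (a1 v) (a2 v) (a3 v) (a4 v) (a5 v) (a6 v)).
Proof.
move=> hg; apply: (computable_comp (s := nth a1 [:: a1; a2; a3; a4; a5; a6]) hg).
by case=> [|[|[|[|[|[|[|i]]]]]]].
Qed.

Lemma computable7 (g : nat -> nat -> nat -> nat -> nat -> nat -> nat -> nat) :
  computable (fun v => g (v 0) (v 1) (v 2) (v 3) (v 4) (v 5) (v 6)) ->
  computable (fun v => g (a1 v) (a2 v) (a3 v) (a4 v) (a5 v) (a6 v) (a7 v)).
Proof.
move=> hg; apply: (computable_comp (s := nth a1 [:: a1; a2; a3; a4; a5; a6; a7]) hg).
by case=> [|[|[|[|[|[|[|[|i]]]]]]]].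
Qed.

Lemma computable8 (g : nat -> nat -> nat -> nat -> nat -> nat -> nat -> nat -> nat) :
  computable (fun v => g (v 0) (v 1) (v 2) (v 3) (v 4) (v 5) (v 6) (v 7)) ->
  computable (fun v => g (a1 v) (a2 v) (a3 v) (a4 v) (a5 v) (a6 v) (a7 v) (a8 v)).
Proof.
move=> hg; apply: (computable_comp (s := nth a1 [:: a1; a2; a3; a4; a5; a6; a7; a8]) hg).
by case=> [|[|[|[|[|[|[|[|[|i]]]]]]]]].
Qed.

Lemma computable_add : computable (fun v => a1 v + a2 v).
Proof. by have [[e eE] [e' eE']] := (h1, h2); exists (Add e e') => v; rewrite /= eE eE'. Qed.

Lemma computable_sub : computable (fun v => a1 v - a2 v).
Proof. by have [[e eE] [e' eE']] := (h1, h2); exists (Sub e e') => v; rewrite /= eE eE'. Qed.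

Lemma computable_mul : computable (fun v => a1 v * a2 v).
Proof. by have [[e eE] [e' eE']] := (h1, h2); exists (Mul e e') => v; rewrite /= eE eE'. Qed.

Lemma computable_succ : computable (fun v => (a1 v).+1).
Proof. by have [e eE] := h1; exists (Add (Const 1) e) => v; rewrite /= eE. Qed.

Lemma computable_pred : computable (fun v => (a1 v).-1).
Proof. by have [e eE] := h1; exists (Sub e (Const 1)) => v; rewrite /= eE subn1. Qed.

Lemma computable_rec (s : (nat -> nat) -> nat -> nat -> nat) :
  computable (fun v => s (fun k => v k.+2) (v 0) (v 1)) ->
  computable (fun v => capped_rec (a1 v) (a2 v) (a3 v) (fun i y => s v i y)).
Proof.
have [[[e1 E1] [e2 E2]] [e3 E3]] := (h1, h2, h3); move=> [e4 E4].
exists (Rec e1 e2 e3 e4) => v; rewrite /= E1 E2 E3; congr capped_rec.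
by apply: funext => i; apply: funext => y; rewrite E4; congr s; apply: funext.
Qed.

End Apply.

Lemma computable_negb (b : (nat -> nat) -> bool) :
  computable (fun v => b v) -> computable (fun v => ~~ b v).
Proof.
move=> hb; apply: computable_eq (computable_sub (computable_const 1) hb) _ => v.
by case: (b v).
Qed.

Lemma computable_andb (b b' : (nat -> nat) -> bool) :
  computable (fun v => b v) -> computable (fun v => b' v) ->
  computable (fun v => b v && b' v).
Proof.
move=> hb hb'; apply: computable_eq (computable_mul hb hb') _ => v.
by rewrite mulnb.
Qed.

Lemma computable_implb (b b' : (nat -> nat) -> bool) :
  computable (fun v => b v) -> computable (fun v => b' v) ->
  computable (fun v => b v ==> b' v).
Proof.
move=> hb hb'.
apply: computable_eq (computable_negb (computable_andb hb (computable_negb hb'))) _ => v.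
by case: (b v); case: (b' v).
Qed.

Lemma computable_leq a b : computable a -> computable b ->
  computable (fun v => a v <= b v).
Proof.
move=> ha hb.
apply: computable_eq (computable_sub (computable_const 1) (computable_sub ha hb)) _ => v.
by rewrite /leq; case: (a v - b v).
Qed.

Lemma computable_ltn a b : computable a -> computable b ->
  computable (fun v => a v < b v).
Proof. by move=> ha hb; apply: computable_leq => //; apply: computable_succ. Qed.

Lemma computable_eqn a b : computable a -> computable b ->
  computable (fun v => a v == b v).
Proof.
move=> ha hb.
apply: computable_eq (computable_andb (computable_leq ha hb) (computable_leq hb ha)) _ => v.
by rewrite eqn_leq.
Qed.

Lemma computable_eqb (b b' : (nat -> nat) -> bool) :
  computable (fun v => b v) -> computable (fun v => b' v) ->
  computable (fun v => b v == b' v).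
Proof.
move=> hb hb'; apply: computable_eq (computable_eqn hb hb') _ => v.
by case: (b v); case: (b' v).
Qed.

Lemma computable_if (b : (nat -> nat) -> bool) x y :
  computable (fun v => b v) -> computable x -> computable y ->
  computable (fun v => if b v then x v else y v).
Proof.
move=> hb hx hy.
apply: computable_eq (computable_add (computable_mul hb hx)
  (computable_mul (computable_negb hb) hy)) _ => v.
by case: (b v); rewrite ?mul1n ?mul0n ?addn0.
Qed.

Lemma computable_minn a b : computable a -> computable b ->
  computable (fun v => minn (a v) (b v)).
Proof.
move=> ha hb; apply: computable_eq (computable_if (computable_ltn ha hb) ha hb) _ => v.
by rewrite /minn.
Qed.

Lemma iota_rcons n : iota 0 n.+1 = rcons (iota 0 n) n.
Proof. by rewrite -[in LHS]addn1 iotaD add0n cats1. Qed.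

Lemma capped_rec_all n (P : nat -> bool) :
  capped_rec 1 n 1 (fun i y => y * P i) = all P (iota 0 n).
Proof.
elim: n => // n IH; rewrite iota_rcons all_rcons [LHS]/= IH mulnb andbC.
by case: (_ && _).
Qed.

Lemma capped_rec_count n (P : nat -> bool) :
  capped_rec n n 0 (fun i y => y + P i) = count P (iota 0 n).
Proof.
have key m : m <= n -> capped_rec n m 0 (fun i y => y + P i) = count P (iota 0 m).
  elim: m => [|m IH] mn; first by rewrite /= min0n.
  rewrite iota_rcons -cats1 count_cat [LHS]/= IH ?(ltnW mn) //= addn0.
  apply/minn_idPl; have := count_size P (iota 0 m); rewrite size_iota.
  by case: (P _); lia.
exact: key.
Qed.

Lemma computable_all n (P : (nat -> nat) -> nat -> bool) : computable n ->
  computable (fun v => P (fun k => v k.+1) (v 0)) ->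
  computable (fun v => all (fun i => P v i) (iota 0 (n v))).
Proof.
move=> hn hP; apply: computable_eq (_ : computable (fun v =>
  capped_rec 1 (n v) 1 (fun i y => y * P v i))) _; last first.
  by move=> v; rewrite capped_rec_all.
apply: computable_rec => //; try exact: computable_const.
apply: computable_mul; first exact: computable_var.
apply: (@computable_comp (fun v => P (fun k => v k.+1) (v 0) : nat)
  (fun i v => if i is j.+1 then v j.+2 else v 0)) => // -[|i]; exact: computable_var.
Qed.

Lemma computable_count n (P : (nat -> nat) -> nat -> bool) : computable n ->
  computable (fun v => P (fun k => v k.+1) (v 0)) ->
  computable (fun v => count (fun i => P v i) (iota 0 (n v))).
Proof.
move=> hn hP; apply: computable_eq (_ : computable (fun v =>
  capped_rec (n v) (n v) 0 (fun i y => y + P v i))) _; last first.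
  by move=> v; rewrite capped_rec_count.
apply: computable_rec => //; try exact: computable_const.
apply: computable_add; first exact: computable_var.
apply: (@computable_comp (fun v => P (fun k => v k.+1) (v 0) : nat)
  (fun i v => if i is j.+1 then v j.+2 else v 0)) => // -[|i]; exact: computable_var.
Qed.

Lemma computable_has n (P : (nat -> nat) -> nat -> bool) : computable n ->
  computable (fun v => P (fun k => v k.+1) (v 0)) ->
  computable (fun v => has (fun i => P v i) (iota 0 (n v))).
Proof.
move=> hn hP; apply: computable_eq (computable_negb (computable_all
  (P := fun v i => ~~ P v i) hn (computable_negb hP))) _ => v.
have -> : all (fun i => ~~ P v i) (iota 0 (n v)) = ~~ has (P v) (iota 0 (n v)).
  by rewrite -all_predC.
by rewrite negbK.
Qed.

(** Division is not a primitive of the language; it counts multiples, slowly but in little space. *)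
Lemma divn_count x y :
  x %/ y = (0 < y) * count (fun z => z.+1 * y <= x) (iota 0 x).
Proof.
case: y => [|y]; first by rewrite divn0.
rewrite mul1n; set P := fun z => _.
have H m n : count P (iota m n) = minn n (x %/ y.+1 - m).
  elim: n m => [|n IH] m /=; first by rewrite min0n.
  by rewrite IH /P -leq_divRL //; case: (ltnP m (x %/ y.+1)); lia.
by rewrite H subn0; apply/esym/minn_idPr; exact: leq_div.
Qed.

Lemma computable_div a b : computable a -> computable b ->
  computable (fun v => a v %/ b v).
Proof.
move=> ha hb; apply: (computable2 ha hb (g := divn)).
apply: computable_eq (_ : computable (fun v => (0 < v 1) *
  count (fun z => z.+1 * v 1 <= v 0) (iota 0 (v 0)))) _; last first.
  by move=> v; rewrite divn_count.
apply: computable_mul.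
  by apply: computable_ltn; [exact: computable_const|exact: computable_var].
apply: (computable_count (P := fun v z => z.+1 * v 1 <= v 0)).
  exact: computable_var.
apply: computable_leq; last exact: computable_var.
by apply: computable_mul; [apply: computable_succ|]; exact: computable_var.
Qed.

Lemma computable_mod a b : computable a -> computable b ->
  computable (fun v => a v %% b v).
Proof.
move=> ha hb; apply: computable_eq (computable_sub ha (computable_mul
  (computable_div ha hb) hb)) _ => v.
by rewrite {1}(divn_eq (a v) (b v)) addKn.
Qed.

Ltac computable_step := cbv beta; first
  [ assumption
  | apply: computable_const
  | apply: computable_var
  | apply: computable_succ
  | apply: computable_pred
  | apply: computable_add
  | apply: computable_sub
  | apply: computable_mul
  | apply: computable_div
  | apply: computable_mod
  | apply: computable_minn
  | apply: computable_leq
  | apply: computable_eqn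
  | apply: computable_eqb
  | apply: computable_negb
  | apply: computable_andb
  | apply: computable_implb
  | apply: computable_if
  | apply: computable_all
  | apply: computable_has
  | apply: computable_count
  | apply: computable_rec ].

(* Powers and sums are truncated at c, so that their values stay bounded. *)
Definition powc (c b e : nat) : nat := capped_rec c e 1 (fun _ y => b * y).

Lemma powcE c b e : 0 < b -> b ^ e <= c -> powc c b e = b ^ e.
Proof.
move=> b0; rewrite /powc; elim: e => [|e IH] h /=; first by apply/minn_idPl.
rewrite IH -?expnS; first exact/minn_idPl.
by apply: leq_trans h; rewrite leq_pexp2l.
Qed.

Lemma computable_powc c b e : computable c -> computable b -> computable e ->
  computable (fun v => powc (c v) (b v) (e v)).
Proof.
move=> hc hb he; apply: (computable3 hc hb he (g := powc)).
by rewrite /powc; repeat computable_step.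
Qed.

Definition dig (c b x i : nat) : nat := (x %/ powc c b i) %% b.

Section CappedFold.
Variables (m c : nat) (init : nat -> nat) (step : nat -> nat -> (nat -> nat) -> nat).

(** A loop whose state has [m] fields. As [Rec] has a single accumulator, the fields, none above
    [c], become digits in base [c.+1]. *)
Fixpoint capped_fold (n : nat) : seq nat :=
  if n is i.+1 then mkseq (fun k => minn (step k i (nth 0 (capped_fold i))) c) m
  else mkseq (fun k => minn (init k) c) m.

Definition pack (s : seq nat) : nat := foldr (fun a y => a + c.+1 * y) 0 s.

Lemma pack_lt s : all (leq^~ c) s -> pack s < c.+1 ^ size s.
Proof. by elim: s => //= a s IH /andP[ac /IH]; rewrite expnS; nia. Qed.

Lemma pack_nth s i : all (leq^~ c) s -> (pack s %/ c.+1 ^ i) %% c.+1 = nth 0 s i.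
Proof.
elim: s i => [|a s IH] i; first by rewrite div0n mod0n nth_nil.
case: i => [|i] /= /andP[ac sc].
  by rewrite divn1 addnC mulnC modnMDl modn_small.
rewrite expnS divnMA [a + _]addnC mulnC divnMDl // [a %/ _]divn_small // addn0.
exact: IH.
Qed.

Lemma capped_fold_le n : all (leq^~ c) (capped_fold n).
Proof. by case: n => [|n]; apply/allP => x /mapP[k _ ->]; exact: geq_minr. Qed.

Lemma size_capped_fold n : size (capped_fold n) = m.
Proof. by case: n => [|n]; rewrite size_mkseq. Qed.

Lemma pack_capped_fold n : pack (capped_fold n) =
  capped_rec (c.+1 ^ m) n (pack (mkseq (fun k => minn (init k) c) m))
   (fun i y => pack (mkseq (fun k =>
      minn (step k i (nth 0 (mkseq (fun l => (y %/ c.+1 ^ l) %% c.+1) m))) c) m)).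
Proof.
have lt n' : pack (capped_fold n') <= c.+1 ^ m.
  by have := pack_lt (capped_fold_le n'); rewrite size_capped_fold; exact: ltnW.
elim: n => [|n IH]; first by apply/esym/minn_idPl; exact: (lt 0).
rewrite [RHS]/= -IH -[LHS](minn_idPl (lt n.+1)) /=; congr minn; congr pack.
apply: eq_mkseq => k; congr (minn (step k n _) c); apply: funext => l.
have [lm|ml] := ltnP l m; last by rewrite !nth_default ?size_mkseq ?size_capped_fold.
by rewrite nth_mkseq // pack_nth //; exact: capped_fold_le.
Qed.

End CappedFold.

Lemma computable_exp c m : computable c -> computable (fun v => c v ^ m).
Proof.
move=> hc; elim: m => [|m IH]; first exact: computable_const.
apply: computable_eq (computable_mul hc IH) _ => v; by rewrite expnS.
Qed.

Lemma computable_pack c (s : nat -> (nat -> nat) -> nat) l : computable c ->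
  (forall k, computable (s k)) ->
  computable (fun v => pack (c v) [seq s k v | k <- l]).
Proof.
move=> hc hs; elim: l => [|k l IH] /=; first exact: computable_const.
apply: computable_add => //; apply: computable_mul => //; exact: computable_succ.
Qed.

(** In the context of the step, variable 0 is the index, the next [m] are the fields and the
    parameters come after them. *)
Lemma computable_fold m j c n (init : nat -> (nat -> nat) -> nat)
    (step : (nat -> nat) -> nat -> nat -> (nat -> nat) -> nat) :
  j < m -> computable c -> computable n -> (forall k, computable (init k)) ->
  (forall k, computable (fun v => step (fun x => v (m.+1 + x)) k (v 0)
     (nth 0 (mkseq (fun l => v l.+1) m)))) ->
  computable (fun v => nth 0 (capped_fold m (c v) (init^~ v) (step v) (n v)) j).
Proof.
move=> jm hc hn hi hs.
pose p v := pack (c v) (capped_fold m (c v) (init^~ v) (step v) (n v)).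
apply: computable_eq (_ : computable (fun v => (p v %/ (c v).+1 ^ j) %% (c v).+1)) _;
  last by move=> v; rewrite pack_nth //; exact: capped_fold_le.
apply: computable_mod; last exact: computable_succ.
apply: computable_div; last by apply: computable_exp; exact: computable_succ.
apply: computable_eq (_ : computable _) (fun v => esym (pack_capped_fold _ _ _ _ _)).
apply: computable_rec => //.
- by apply: computable_exp; exact: computable_succ.
- apply: (@computable_pack c (fun k v => minn (init k v) (c v))) => // k.
  exact: computable_minn.
have hc2 : computable (fun v => c (fun k => v k.+2)).
  by apply: (computable_comp (s := fun i v => v i.+2) hc) => i; exact: computable_var.
apply: (@computable_pack (fun v => c (fun k => v k.+2)) (fun k v => minn (step
  (fun k => v k.+2) k (v 0)
  (nth 0 (mkseq (fun l => (v 1 %/ (c (fun k => v k.+2)).+1 ^ l) %% (c (fun k => v k.+2)).+1) m)))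
  (c (fun k => v k.+2)))) => // k.
apply: computable_minn => //.
pose s (i : nat) (v : nat -> nat) := if i is l.+1 then
  if l < m then (v 1 %/ (c (fun k => v k.+2)).+1 ^ l) %% (c (fun k => v k.+2)).+1
  else v (l - m).+2 else v 0.
have hsi i : computable (s i).
  rewrite /s; case: i => [|i]; first exact: computable_var.
  case: (i < m); last exact: computable_var.
  apply: computable_mod; last exact: computable_succ.
  apply: computable_div; first exact: computable_var.
  by apply: computable_exp; exact: computable_succ.
apply: computable_eq (computable_comp (hs k) hsi) _ => v.
congr step.
- by apply: funext => x; rewrite /s /= ltnNge leq_addr /= addKn.
- apply: funext => l; have [lm|ml] := ltnP l m; last by rewrite !nth_default ?size_mkseq.
  by rewrite !nth_mkseq // /s lm.
Qed.

(** * The decision algorithm *)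

(* A rewriting system is given by q, one more than the number of letters, the
   number J of rules, and a table T in base b whose entries 4j, ..., 4j+3 are
   the left-hand side of rule j, its length, its right-hand side and its
   length. Words are numbers in base q, least significant digit first; the
   digit d > 0 is the letter number d - 1 and the digit 0 is a void letter,
   which an additional rule number J erases. *)
Section Algorithm.
Variables (c b D : nat).

(** For [j = J] the fields are 0, 1, 0, 0: the one-digit word 0 is replaced by the empty word. *)
Definition rule_field (J T j f : nat) : nat :=
  if j < J then dig c b T (4 * j + f) else f == 1.

Definition rewrite_at (q l a r d x i : nat) : nat :=
  if (x %/ powc c q i) %% powc c q a == l then
    x %% powc c q i + r * powc c q i + (x %/ powc c q (i + a)) * powc c q (i + d)
  else x.

(** Each sweep tries every rule at every position. A rewriting that has an effect lowers the number,
    so [x.+1] sweeps are enough, whatever the order of the rules. *)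
Definition normalize (q J T x : nat) : nat :=
  capped_rec c (x.+1 * (D * J.+1)) x (fun z y =>
    rewrite_at q (rule_field J T (z %% J.+1) 0) (rule_field J T (z %% J.+1) 1)
      (rule_field J T (z %% J.+1) 2) (rule_field J T (z %% J.+1) 3)
      y ((z %/ J.+1) %% D)).

Definition same_element (q J T x y : nat) : bool :=
  normalize q J T x == normalize q J T y.

Definition tuple_entry (Q t d : nat) : nat :=
  if d == 0 then 0 else dig c Q t d.-1.

(** With [Q] the power of [q] for entries of [K] digits, shorter entries are padded by void letters,
    so that the product of entries is a concatenation of blocks. *)
Definition evaluate (Q R t w n : nat) : nat :=
  capped_rec c n 0 (fun k y => y + tuple_entry Q t (dig c R.+1 w k) * powc c Q k).

Variables (K R L : nat).

Definition short_test (q J T t : nat) : bool :=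
  all (fun w => has (fun w' => same_element q J T
         (evaluate (powc c q K) R t w R.+1) (evaluate (powc c q K) R t w' R.+1))
       (iota 0 (powc c R.+1 R)))
    (iota 0 (powc c R.+1 R.+1)).

Definition alike_test (q J T t q' J' T' t' : nat) : bool :=
  all (fun w => all (fun w' =>
         same_element q J T
           (evaluate (powc c q K) R t w R.+1) (evaluate (powc c q K) R t w' R.+1) ==
         same_element q' J' T'
           (evaluate (powc c q' K) R t' w R.+1) (evaluate (powc c q' K) R t' w' R.+1))
       (iota 0 (powc c R.+1 R.+1)))
    (iota 0 (powc c R.+1 R.+1)).

(** Conjugacy is tested as [g * t i = t' i * g], which avoids computing inverses. *)
Definition conjugate_test (q J T t t' : nat) : bool :=
  has (fun g => all (fun i => same_element q J T
      (g + dig c (powc c q K) t i * powc c q L)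
      (dig c (powc c q K) t' i + g * powc c q K)) (iota 0 R))
    (iota 0 (powc c q L)).

(** A class is counted at its least code. *)
Definition class_number (q J T t q' J' T' : nat) : nat :=
  count (fun t' => alike_test q J T t q' J' T' t' &&
      ~~ has (fun t'' => conjugate_test q' J' T' t'' t') (iota 0 t'))
    (iota 0 (powc c (powc c q' K) R)).

Definition classes_test (q J T q1 J1 T1 q2 J2 T2 : nat) : bool :=
  all (fun t => short_test q J T t ==>
      (class_number q J T t q1 J1 T1 == class_number q J T t q2 J2 T2))
    (iota 0 (powc c (powc c q K) R)).

(** The binary digits of [f] are the images of the letters in Z/2; the result is the image of the
    word. *)
Definition parity (q f x : nat) : nat :=
  capped_rec c D 0 (fun k y => y +
    (if dig c q x k == 0 then 0 else dig c 2 f (dig c q x k).-1)) %% 2.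

Definition hom_number (q J T : nat) : nat :=
  count (fun f => all (fun j =>
      parity q f (rule_field J T j 0) == parity q f (rule_field J T j 2)) (iota 0 J))
    (iota 0 (powc c 2 q.-1)).

End Algorithm.

(** The radius [4 * C + 1] of [bounded_centre], where normal forms branch with [C = 2 * n]. *)
Definition ball_radius (n : nat) := 8 * n + 1.
(** This is [r + r] with [r = n * ball_radius n]: a finite subgroup fits in a ball coded by fewer
    than [2 ^ n] digit values in [ball_radius n] places. *)
Definition tuple_size (n : nat) := n * ball_radius n + n * ball_radius n.
(** The bound of [conjugator_bound] for [C = 2 * n]; elements generated by a short tuple of the ball
    have length at most [tuple_size n * ball_radius n]. *)
Definition conjugator_length (n : nat) :=
  5 * (tuple_size n * ball_radius n) + 4 * n.
(** Room for a conjugator followed by one entry, and for a product of [(tuple_size n).+1]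
    entries. *)
Definition word_length (n : nat) :=
  conjugator_length n + ball_radius n * (tuple_size n + 2).

Definition isomorphism_test (c n q J T q' J' T' : nat) : bool :=
  let b := powc c 2 (n * n) in
  let D := word_length n in
  let K := ball_radius n in
  let R := tuple_size n in
  let L := conjugator_length n in
  [&& hom_number c b D q J T == hom_number c b D q' J' T',
      classes_test c b D K R L q J T q J T q' J' T' &
      classes_test c b D K R L q' J' T' q J T q' J' T'].

Lemma computable_dig c b x i : computable c -> computable b -> computable x ->
  computable i -> computable (fun v => dig (c v) (b v) (x v) (i v)).
Proof.
move=> hc hb hx hi; rewrite /dig; apply: computable_mod => //.
by apply: computable_div => //; apply: computable_powc.
Qed.

Ltac compute_step :=
  cbv beta;
  lazymatch goal with
  | |- computable (fun v => v ?n) => exact: (computable_var n)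
  | |- computable (fun _ => powc _ _ _) => apply: computable_powc
  | |- computable (fun _ => dig _ _ _ _) => apply: computable_dig
  | |- computable (fun _ => capped_rec _ _ _ _) => apply: computable_rec
  | |- computable (fun _ => S _) => apply: computable_succ
  | |- computable (fun _ => _.-1) => apply: computable_pred
  | |- computable (fun _ => _ + _) => apply: computable_add
  | |- computable (fun _ => _ - _) => apply: computable_sub
  | |- computable (fun _ => _ * _) => apply: computable_mul
  | |- computable (fun _ => _ %/ _) => apply: computable_div
  | |- computable (fun _ => _ %% _) => apply: computable_mod
  | |- computable (fun _ => if _ then _ else _) => apply: computable_if
  | |- computable (fun _ => nat_of_bool (_ <= _)) => apply: computable_leq
  | |- computable (fun _ => nat_of_bool (@eq_op _ _ _)) =>
      first [apply: computable_eqn | apply: computable_eqb]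
  | |- computable (fun _ => nat_of_bool (~~ _)) => apply: computable_negb
  | |- computable (fun _ => nat_of_bool (_ && _)) => apply: computable_andb
  | |- computable (fun _ => nat_of_bool (_ ==> _)) => apply: computable_implb
  | |- computable (fun _ => nat_of_bool (all _ _)) => apply: computable_all
  | |- computable (fun _ => nat_of_bool (has _ _)) => apply: computable_has
  | |- computable (fun _ => count _ _) => apply: computable_count
  | |- _ => first [assumption | exact: computable_const]
  end.

Lemma computable_normalize c b D q J T x : computable c -> computable b ->
  computable D -> computable q -> computable J -> computable T -> computable x ->
  computable (fun v => normalize (c v) (b v) (D v) (q v) (J v) (T v) (x v)).
Proof.
move=> hc hb hD hq hJ hT hx; apply: (computable7 hc hb hD hq hJ hT hx (g := normalize)).
by rewrite /normalize /rewrite_at /rule_field; repeat compute_step.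
Qed.

Lemma computable_evaluate c Q R t w n : computable c -> computable Q ->
  computable R -> computable t -> computable w -> computable n ->
  computable (fun v => evaluate (c v) (Q v) (R v) (t v) (w v) (n v)).
Proof.
move=> hc hQ hR ht hw hn; apply: (computable6 hc hQ hR ht hw hn (g := evaluate)).
by rewrite /evaluate /tuple_entry; repeat compute_step.
Qed.

Lemma computable_parity c D q f x : computable c -> computable D ->
  computable q -> computable f -> computable x ->
  computable (fun v => parity (c v) (D v) (q v) (f v) (x v)).
Proof.
move=> hc hD hq hf hx; apply: (computable5 hc hD hq hf hx (g := parity)).
by rewrite /parity; repeat compute_step.
Qed.

Ltac compute_step' :=
  cbv beta;
  lazymatch goal with
  | |- computable (fun _ => normalize _ _ _ _ _ _ _) => apply: computable_normalize
  | |- computable (fun _ => evaluate _ _ _ _ _ _) => apply: computable_evaluate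
  | |- computable (fun _ => parity _ _ _ _ _) => apply: computable_parity
  | |- _ => compute_step
  end.

Lemma computable_hom_number c b D q J T : computable c -> computable b ->
  computable D -> computable q -> computable J -> computable T ->
  computable (fun v => hom_number (c v) (b v) (D v) (q v) (J v) (T v)).
Proof.
move=> hc hb hD hq hJ hT; apply: (computable6 hc hb hD hq hJ hT (g := hom_number)).
by rewrite /hom_number /rule_field; repeat compute_step'.
Qed.

Lemma computable_isomorphism_test c n q J T q' J' T' : computable c ->
  computable n -> computable q -> computable J -> computable T ->
  computable q' -> computable J' -> computable T' ->
  computable (fun v => isomorphism_test (c v) (n v) (q v) (J v) (T v)
    (q' v) (J' v) (T' v)).
Proof.
move=> hc hn hq hJ hT hq' hJ' hT'.
apply: (computable8 hc hn hq hJ hT hq' hJ' hT'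
  (g := fun c n q J T q' J' T' => isomorphism_test c n q J T q' J' T')).
rewrite /isomorphism_test /classes_test /class_number /conjugate_test /alike_test.
rewrite /short_test /same_element.
rewrite /word_length /conjugator_length /tuple_size /ball_radius.
repeat lazymatch goal with
  | |- computable (fun _ => hom_number _ _ _ _ _ _) => apply: computable_hom_number
  | |- _ => compute_step'
  end.
Qed.

(* The fields of the state while reading one of the two systems: the number of
   systems already read, whether the size of the alphabet is known, the current
   number, the current word and its length, then q, T and the number of entries
   of T. *)
Definition read_token (c b target t : nat) (k : nat) (st : nat -> nat) : nat :=
  if st 0 == target then
    if t == 0 then (if k == 2 then (st 2).+1 else st k)
    else if t == 1 then
      if st 1 == 0 then
        match k with 1 => 1 | 2 => 0 | 5 => (st 2).+1 | _ => st k end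
      else
        match k with
        | 2 => 0
        | 3 => st 3 + (st 2).+1 * powc c (st 5) (st 4)
        | 4 => (st 4).+1
        | _ => st k
        end
    else if t == 2 then
      match k with
      | 3 | 4 => 0
      | 6 => st 6 + st 3 * powc c b (st 7) + st 4 * powc c b (st 7).+1
      | 7 => (st 7).+2
      | _ => st k
      end
    else if k == 0 then (st 0).+1 else st k
  else if (t == 3) && (k == 0) then (st 0).+1 else st k.

(** The first token is the most significant digit. *)
Definition input_token (c a n i : nat) : nat := dig c 4 a (n - i.+1).

Definition read_field (c a n target j : nat) : nat :=
  nth 0 (capped_fold 8 c (fun _ => 0) (fun k i st =>
    read_token c (powc c 2 (n * n)) target (input_token c a n i) k st) n) j.

Lemma computable_read_field target j : j < 8 ->
  computable (fun v => read_field (v 2) (v 0) (v 1) target j).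
Proof.
move=> j8.
apply: (@computable_fold 8 j (fun v => v 2) (fun v => v 1) (fun _ _ => 0)
  (fun v k i st => read_token (v 2) (powc (v 2) 2 (v 1 * v 1)) target
     (input_token (v 2) (v 0) (v 1) i) k st)) => //.
- exact: computable_var.
- exact: computable_var.
- by move=> k; exact: computable_const.
move=> k; rewrite /read_token /input_token /=.
have [|k8] := ltnP k 8; last first.
  by move: k k8; do 8 case=> //; move=> k _ /=; repeat compute_step.
by move: k; do 8 (case; first by move=> _ /=; repeat compute_step).
Qed.

Definition decision (a n c : nat) : bool :=
  isomorphism_test c n
    (read_field c a n 0 5) (read_field c a n 0 7 %/ 4) (read_field c a n 0 6)
    (read_field c a n 1 5) (read_field c a n 1 7 %/ 4) (read_field c a n 1 6).

Lemma computable_decision : computable (fun v => decision (v 0) (v 1) (v 2)).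
Proof.
apply: computable_isomorphism_test; try exact: computable_var.
- exact: computable_read_field.
- by apply: computable_div (computable_const 4); exact: computable_read_field.
- exact: computable_read_field.
- exact: computable_read_field.
- by apply: computable_div (computable_const 4); exact: computable_read_field.
- exact: computable_read_field.
Qed.

(** * Words as numbers *)

Section Digits.
Variables (T : finType) (a0 : T).
Local Notation q := #|T|.+1.

Lemma letters_gt1 : 1 < q.
Proof. by rewrite ltnS; apply/card_gt0P; exists a0. Qed.

Definition nth_letter (k : nat) : T := nth a0 (enum T) k.

Lemma nth_letter_rank a : nth_letter (enum_rank a) = a.
Proof. exact: nth_enum_rank. Qed.

Definition digit_word (d : nat) : seq T := if d == 0 then [::] else [:: nth_letter d.-1].

Fixpoint digits_word (D x : nat) : seq T :=
  if D is D'.+1 then digit_word (x %% q) ++ digits_word D' (x %/ q) else [::].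

Definition number_word (x : nat) : seq T := digits_word x x.

Fixpoint word_number (w : seq T) : nat :=
  if w is a :: w' then (enum_rank a).+1 + q * word_number w' else 0.

Lemma digits_word_fuel D D' x : x < q ^ D -> x < q ^ D' ->
  digits_word D x = digits_word D' x.
Proof.
have q1 := letters_gt1.
elim: D D' x => [|D IH] [|D'] x //=.
- rewrite expn0 ltnS leqn0 => /eqP-> _.
  by elim: D' => //= D' IH'; rewrite mod0n div0n.
- rewrite expn0 ltnS leqn0 => _ /eqP->.
  by elim: D {IH} => //= D' IH'; rewrite mod0n div0n.
by rewrite !expnSr => h h'; congr (_ ++ _); apply: IH; rewrite ltn_divLR.
Qed.

Lemma number_word_fuel D x : x < q ^ D -> digits_word D x = number_word x.
Proof. by move=> h; apply: digits_word_fuel => //; apply: ltn_expl; exact: letters_gt1. Qed.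

Lemma number_word_step x :
  number_word x = digit_word (x %% q) ++ number_word (x %/ q).
Proof.
have q1 := letters_gt1.
have xq : x < q ^ x.+1 by apply: leq_trans (ltn_expl x q1) _; rewrite leq_exp2l.
rewrite -(number_word_fuel xq) /=; congr (_ ++ _); apply: number_word_fuel.
by rewrite ltn_divLR // -expnSr.
Qed.

Lemma number_word_cat a u v : u < q ^ a ->
  number_word (u + q ^ a * v) = number_word u ++ number_word v.
Proof.
have q1 := letters_gt1.
elim: a u => [|a IH] u; first by rewrite expn0 ltnS leqn0 => /eqP->; rewrite mul1n.
move=> ua; rewrite number_word_step [number_word u]number_word_step -catA.
have -> : (u + q ^ a.+1 * v) %% q = u %% q.
  by rewrite expnS -mulnA addnC mulnC modnMDl.
congr (_ ++ _); have -> : (u + q ^ a.+1 * v) %/ q = u %/ q + q ^ a * v.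
  by rewrite expnS -mulnA addnC mulnC divnMDl // addnC.
by apply: IH; rewrite ltn_divLR // -expnSr.
Qed.

Lemma word_number_lt w : word_number w < q ^ size w.
Proof.
elim: w => //= a w IH; rewrite expnS.
have ha : (enum_rank a).+1 <= #|T| := ltn_ord _.
apply: leq_trans (_ : q * (word_number w).+1 <= _); last by rewrite leq_mul2l IH orbT.
by rewrite mulnS ltn_add2r.
Qed.

Lemma word_number_ge w : w != [::] -> q ^ (size w).-1 <= word_number w.
Proof.
elim: w => //= a [|b w] IH _; first by rewrite expn0.
by have := IH isT; rewrite /= expnS => h; apply: leq_trans (leq_addl _ _); rewrite leq_mul2l h orbT.
Qed.

Lemma word_numberK w : number_word (word_number w) = w.
Proof.
elim: w => // a w IH; rewrite number_word_step /=.
have ha : (enum_rank a).+1 < q by rewrite ltnS; exact: ltn_ord.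
rewrite addnC mulnC modnMDl divnMDl // modn_small // divn_small // addn0 IH.
by rewrite /digit_word /= nth_letter_rank.
Qed.

Lemma digits_wordK D w : size w <= D -> digits_word D (word_number w) = w.
Proof.
move=> wD; rewrite number_word_fuel ?word_numberK //.
apply: leq_trans (word_number_lt w) _.
by rewrite leq_exp2l // letters_gt1.
Qed.

Lemma size_digits_word D x : size (digits_word D x) <= D.
Proof.
elim: D x => //= D IH x; rewrite size_cat.
by have := IH (x %/ q); rewrite /digit_word; case: (_ == 0) => /=; lia.
Qed.

Lemma digits_word_rcons D x : digits_word D.+1 x =
  digits_word D x ++ digit_word ((x %/ q ^ D) %% q).
Proof.
elim: D x => [|D IH] x; first by rewrite /= cats0 expn0 divn1.
by rewrite -/(digits_word _) [LHS]/= -/(digits_word D.+1 _) IH catA -divnMA -expnS.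
Qed.

(** Void letters make the coding of words by numbers many-to-one; the hypothesis, no void digit
    below a nonzero one, singles out the canonical number. *)
Lemma number_wordK D x : x < q ^ D ->
  (forall i, i < D -> (x %/ q ^ i) %% q = 0 -> x %/ q ^ i.+1 = 0) ->
  word_number (number_word x) = x.
Proof.
have q1 := letters_gt1.
elim: D x => [|D IH] x; first by rewrite expn0 ltnS leqn0 => /eqP->.
move=> xD h; rewrite number_word_step /digit_word.
have xE := divn_eq x q.
have IHx : word_number (number_word (x %/ q)) = x %/ q.
  apply: IH; first by rewrite ltn_divLR // -expnSr.
  by move=> i iD; rewrite -!divnMA -!expnS; exact: h.
case: eqP => [x0|/eqP x0].
  have := h 0 isT; rewrite expn0 divn1 expn1 x0 => /(_ (erefl _)) h0.
  by rewrite h0 cat0s; move: xE; rewrite h0 x0.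
rewrite /= IHx; have [k kE] : exists k : 'I_#|T|, x %% q = k.+1.
  have xq : (x %% q).-1 < #|T| by have := ltn_pmod x (isT : 0 < q); lia.
  by exists (Ordinal xq); rewrite /= prednK // lt0n.
rewrite kE /= /nth_letter.
have -> : nth a0 (enum T) k = enum_val k by exact: (esym (@enum_val_nth _ _ _ k)).
by rewrite enum_valK -kE [RHS]xE mulnC addnC.
Qed.

End Digits.

Section Normalization.
Local Open Scope group_scope.
Variables (S : icfclr_system) (M : nat).
Local Notation X := (letter S).
Let reducing : forall l r, rule_rel (S := S) l r -> size r < size l :=
  fun l r lr => @rules_reducing S (l, r) lr.
Hypothesis bounded : forall l r, rule_rel (S := S) l r -> size l <= M.
Let confl := (system_convergent S).2.
Local Notation G := (presented_by S).
Local Notation cls := (@class_of X (@rule_rel S) (@system_inverse_closed S)).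
Local Notation nform := (@normal_form X (@rule_rel S) reducing (@system_inverse_closed S)).
Variable a0 : X.
Local Notation q := #|X|.+1.
Local Notation number_word := (number_word a0).

Definition element_of (x : nat) : G := cls (number_word x).

Lemma element_of_cat a u v : u < q ^ a ->
  element_of (u + q ^ a * v) = element_of u * element_of v.
Proof. by move=> ua; rewrite /element_of number_word_cat // class_ofM. Qed.

Lemma element_of0 : element_of 0 = 1.
Proof. by []. Qed.

Lemma element_of_word w : element_of (word_number w) = cls w.
Proof. by rewrite /element_of word_numberK. Qed.

Variables (c b D T : nat).
Local Notation J := (size (rules S)).
Local Notation rule j := (nth ([::], [::]) (rules S) j).
Hypothesis D0 : 0 < D.
Hypothesis c_large : q ^ (D + M) <= c.
Hypothesis table : forall j, j < J -> [/\ dig c b T (4 * j) = word_number (rule j).1,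
  dig c b T (4 * j + 1) = size (rule j).1,
  dig c b T (4 * j + 2) = word_number (rule j).2 &
  dig c b T (4 * j + 3) = size (rule j).2].

Local Notation field := (rule_field c b J T).
Local Notation act j y i := (rewrite_at c q (field j 0) (field j 1) (field j 2) (field j 3) y i).

Lemma powq e : e <= D + M -> powc c q e = (q ^ e)%N.
Proof.
move=> eD; apply: powcE => //; apply: leq_trans c_large.
by rewrite leq_exp2l // (letters_gt1 a0).
Qed.

Lemma rule_mem j : j < J -> rule_rel (S := S) (rule j).1 (rule j).2.
Proof. by move=> jJ; rewrite /rule_rel -surjective_pairing mem_nth. Qed.

Lemma field_rule j : j < J -> [/\ field j 0 = word_number (rule j).1,
  field j 1 = size (rule j).1, field j 2 = word_number (rule j).2 &
  field j 3 = size (rule j).2].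
Proof. by move=> jJ; rewrite /rule_field jJ addn0; exact: table. Qed.

Lemma field_void : [/\ field J 0 = 0, field J 1 = 1, field J 2 = 0 & field J 3 = 0]%N.
Proof. by rewrite /rule_field ltnn. Qed.

Lemma rewrite_at_match l a r d y i : i + a <= D + M -> i + d <= D + M ->
  (((y %/ q ^ i) %% q ^ a <> l)%N /\ (rewrite_at c q l a r d y i = y)%N) \/
  exists lo hi, [/\ lo < q ^ i, (hi = y %/ q ^ (i + a))%N,
    (y = lo + q ^ i * (l + q ^ a * hi))%N &
    (rewrite_at c q l a r d y i = lo + q ^ i * (r + q ^ d * hi))%N].
Proof.
move=> ia id; rewrite /rewrite_at !powq //; try lia.
case: eqP => [h|h]; last by left.
right; exists (y %% q ^ i)%N, (y %/ q ^ (i + a))%N; split=> //.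
- by rewrite ltn_pmod // expn_gt0.
- rewrite {1}(divn_eq y (q ^ i)) addnC; congr (_ + _)%N; rewrite mulnC; congr (_ * _)%N.
  by rewrite {1}(divn_eq (y %/ q ^ i) (q ^ a)) h expnD divnMA addnC mulnC.
rewrite [(q ^ (i + d))%N]expnD mulnDr addnA; congr (_ + _ + _)%N.
  by rewrite mulnC.
by rewrite mulnC -mulnA.
Qed.

(** For the void rule, fixing the number means that a digit 0 occurs only above all nonzero
    digits. *)
Definition rewrite_fixed y i j : Prop :=
  if j < J then ((y %/ q ^ i) %% q ^ size (rule j).1 <> word_number (rule j).1)%N
  else ((y %/ q ^ i) %% q = 0 -> y %/ q ^ i.+1 = 0)%N.

(** The left-hand side is longer and its top digit is nonzero, so it is the larger number, whatever
    the letters. The number itself thus measures the progress of rewriting. *)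
Lemma rewrite_at_spec y i j : i < D -> 0 < M -> j <= J ->
  [/\ act j y i <= y, element_of (act j y i) = element_of y &
      (act j y i = y)%N -> rewrite_fixed y i j].
Proof.
move=> iD M0 jJ; have q1 := letters_gt1 a0; rewrite /rewrite_fixed.
have qi e : 0 < q ^ e by rewrite expn_gt0.
case: ltnP => [jJ'|Jj].
  have [-> -> -> ->] := field_rule jJ'.
  have rm := rule_mem jJ'; have lM := bounded rm; have rl := reducing rm.
  move: (rule j).1 (rule j).2 rm lM rl => l r rm lM rl.
  have l0 : l != [::] by case: (l) rl.
  have lt : word_number r < word_number l.
    apply: leq_trans (word_number_lt r) _; apply: leq_trans (word_number_ge l0).
    by rewrite leq_exp2l // -ltnS prednK; [exact: rl | exact: leq_ltn_trans rl].
  have [[nm ->]//|[lo [hi [lolt _ yE ->]]]] := @rewrite_at_match (word_number l) (size l)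
      (word_number r) (size r) y i (ltac:(lia)) (ltac:(lia)).
  have lt2 : lo + q ^ i * (word_number r + q ^ size r * hi) < y.
    rewrite yE ltn_add2l ltn_pmul2l //.
    apply: leq_trans (_ : word_number l + q ^ size r * hi <= _).
      by rewrite ltn_add2r.
    by rewrite leq_add2l leq_mul2r leq_exp2l // ltnW ?orbT.
  split; first exact: (ltnW lt2); last first.
    move=> E; by move: lt2; rewrite E ltnn.
  rewrite yE !element_of_cat ?word_number_lt // !element_of_word.
  congr (_ * (_ * _)); apply: esym; apply: class_of_rewrites; apply: rt_step.
  by have := RewriteStep [::] [::] rm; rewrite !cat0s !cats0.
have -> : j = J by lia.
have [-> -> -> ->] := field_void.
have [[nm ->]|[lo [hi [lolt hiE yE ->]]]] := @rewrite_at_match 0 1 0 0 y i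
    (ltac:(lia)) (ltac:(lia)).
  by split=> // _; rewrite expn1 in nm.
rewrite !add0n expn1 expn0 mul1n in yE *.
split.
- by rewrite [X in _ <= X]yE leq_add2l leq_mul2l leq_pmull ?orbT.
- rewrite [in RHS]yE !element_of_cat //.
  congr (_ * _); have := @element_of_cat 1 0 hi isT.
  by rewrite add0n expn1 element_of0 mul1g.
move=> E _; rewrite addn1 in hiE; rewrite -hiE.
move: E; rewrite [X in _ = X]yE => /addnI /eqP; rewrite eqn_pmul2l // => /eqP E.
by case: (posnP hi) => // hi0; move: E hi0 q1; clear; nia.
Qed.

Lemma fixed_normal_form y : y < q ^ D -> (forall i j, i < D -> j <= J -> rewrite_fixed y i j) ->
  y = word_number (nform (element_of y)).
Proof.
move=> yD fixed; have q1 := letters_gt1 a0.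
have yE : word_number (number_word y) = y.
  apply: (number_wordK a0 yD) => i iD; have := fixed i J iD (leqnn _).
  by rewrite /rewrite_fixed ltnn.
pose w := number_word y; rewrite /element_of -/w.
have wD : size w <= D.
  by rewrite /w -(number_word_fuel a0 yD); exact: size_digits_word.
suff iw : irreducible (@rule_rel S) w.
  rewrite -[LHS]yE -/w; congr word_number.
  apply: (irreducible_unique confl _ iw); last exact: normal_form_irreducible.
  by apply/(class_ofP (@system_inverse_closed S)); rewrite class_of_normal_form.
move=> w' /rewrite_stepP[p [l [r [s [lr wE _]]]]].
have [j jJ jE] : exists2 j, j < J & rule j = (l, r).
  by exists (index (l, r) (rules S)); rewrite ?index_mem // nth_index.
have l0 : 0 < size l by have := reducing lr; case: (size l).
have pD : size p < D.
  by move: wD l0; rewrite wE !size_cat; move: (size p) (size l) (size s) => n1 n2 n3; lia.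
have := fixed (size p) j pD (ltnW jJ); rewrite /rewrite_fixed jJ jE /=; apply.
rewrite -yE -/w wE.
have catE (u v : seq X) : word_number (u ++ v) = (word_number u + q ^ size u * word_number v)%N.
  elim: u => [|a u IH] /=; first by rewrite expn0 mul1n.
  by rewrite IH expnS mulnDr addSn addnA mulnA.
rewrite !catE divnDr ?dvdn_mulr // divn_small ?word_number_lt // add0n.
by rewrite mulKn ?expn_gt0 // addnC mulnC modnMDl modn_small // word_number_lt.
Qed.

(** A sweep without effect certifies that no rule applies anywhere; confluence then identifies the
    result as the normal form. *)
Lemma normalize_correct x : 0 < M -> x < q ^ D ->
  normalize c b D q J T x = word_number (nform (element_of x)).
Proof.
move=> M0 xD; rewrite /normalize.
pose N := (D * J.+1)%N; have N0 : 0 < N by rewrite muln_gt0 D0.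
pose st z y := act (z %% J.+1) y ((z %/ J.+1) %% D).
pose y z := capped_rec c z x st.
rewrite -/(st) -/N -/(y _).
have idx z : (z %/ J.+1) %% D < D /\ z %% J.+1 <= J.
  by rewrite ltn_pmod // -ltnS ltn_pmod.
have stP z u : [/\ st z u <= u, element_of (st z u) = element_of u &
    (st z u = u)%N -> rewrite_fixed u ((z %/ J.+1) %% D) (z %% J.+1)].
  by have [h1 h2] := idx z; apply: rewrite_at_spec.
have xc : x <= c.
  apply: leq_trans (ltnW xD) (leq_trans _ c_large).
  by rewrite leq_exp2l ?leq_addr // (letters_gt1 a0).
have yx z : y z <= x /\ y z.+1 = st z (y z).
  elim: z => [|z [IH1 IH2]].
    have y0 : y 0 = x by apply/minn_idPl.
    split; first by rewrite y0.
    by apply/minn_idPl; have [h _ _] := stP 0 (y 0); apply: leq_trans h _; rewrite y0.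
  have h1 : y z.+1 <= x by rewrite IH2; have [h _ _] := stP z (y z); exact: leq_trans h IH1.
  split=> //; apply/minn_idPl.
  by have [h _ _] := stP z.+1 (y z.+1); apply: leq_trans h (leq_trans h1 xc).
have yS z : y z.+1 = st z (y z) by have [] := yx z.
have mono z k : y (z + k) <= y z.
  elim: k => [|k IH]; first by rewrite addn0.
  by rewrite addnS yS; have [h _ _] := stP (z + k)%N (y (z + k)%N); exact: leq_trans h IH.
have yel z : element_of (y z) = element_of x.
  elim: z => [|z IH]; first by congr element_of; apply/minn_idPl.
  by rewrite yS; have [_ -> _] := stP z (y z).
(* The number starts at [x] and cannot decrease in each of [x.+1] sweeps. *)
have [t tx yt] : exists2 t, t <= x & y ((t.+1) * N)%N = y (t * N)%N.
  apply: contrapT => H.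
  have dec t : t <= x.+1 -> y (t * N)%N + t <= x.
    elim: t => [|t IH] tx; first by rewrite addn0; have [] := yx 0.
    have := IH (ltnW tx); have := mono (t * N)%N N; rewrite addnC -mulSn => h1 h2.
    have : y (t.+1 * N)%N != y (t * N)%N by apply/eqP => E; apply: H; exists t.
    by move: h1 h2; move: (y (t.+1 * N)%N) (y (t * N)%N) => u v; lia.
  by have := dec x.+1 (leqnn _); lia.
have const k : k <= N -> y (t * N + k)%N = y (t * N)%N.
  move=> kN; apply/eqP; rewrite eqn_leq mono /=.
  by have := mono (t * N + k)%N (N - k)%N; rewrite -addnA subnKC // addnC -mulSn yt.
have fixed i j : i < D -> j <= J -> rewrite_fixed (y (t * N)%N) i j.
  move=> iD jJ; pose z := (i * J.+1 + j)%N.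
  have zN : z < N.
    rewrite /N /z; apply: leq_trans (_ : i.+1 * J.+1 <= _); last by rewrite leq_mul2r iD orbT.
    by rewrite mulSn addnC ltn_add2r ltnS.
  have zj : ((t * N + z) %% J.+1 = j)%N.
    by rewrite /N /z mulnA addnA -mulnDl modnMDl modn_small.
  have zi : (((t * N + z) %/ J.+1) %% D = i)%N.
    rewrite /N /z mulnA addnA -mulnDl divnMDl // [j %/ _]divn_small // addn0.
    by rewrite modnMDl modn_small.
  have := const z.+1 zN; rewrite addnS yS const => [E|]; last exact: ltnW.
  by have [_ _ /(_ E)] := stP (t * N + z)%N (y (t * N)%N); rewrite zj zi.
(* The schedule of rules and positions has period [N], so an idle sweep is followed by idle sweeps
   only. *)
have final k : y (t * N + k)%N = y (t * N)%N.
  elim: k => [|k IH]; first by rewrite addn0.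
  rewrite addnS yS IH.
  have := const (k %% N).+1 (ltn_pmod _ N0); rewrite addnS yS.
  rewrite (const _ (ltnW (ltn_pmod k N0))).
  rewrite /st; congr (_ = _).
  have -> : ((t * N + k) %% J.+1 = (t * N + k %% N) %% J.+1)%N.
    by rewrite {1}(divn_eq k N) addnA -mulnDl /N !mulnA !modnMDl.
  have -> : ((t * N + k) %/ J.+1 %% D = (t * N + k %% N) %/ J.+1 %% D)%N.
    by rewrite {1}(divn_eq k N) addnA -mulnDl /N !mulnA !divnMDl // !modnMDl.
  by [].
have -> : (x.+1 * N = t * N + (x.+1 - t) * N)%N by rewrite -mulnDl subnKC // ltnW.
rewrite final -(yel (t * N)%N); apply: fixed_normal_form => //.
by have [h _] := yx (t * N)%N; exact: leq_ltn_trans h xD.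
Qed.

Lemma same_elementP x y : 0 < M -> x < q ^ D -> y < q ^ D ->
  same_element c b D q J T x y <-> element_of x = element_of y.
Proof.
move=> M0 xD yD; rewrite /same_element !normalize_correct //; split=> [/eqP|->//].
move=> /(congr1 (number_word)); rewrite !word_numberK => E.
by rewrite -(class_of_normal_form reducing (element_of x)) E class_of_normal_form.
Qed.

End Normalization.

Lemma digits_exists B m (e : nat -> nat) : (forall i, i < m -> e i < B) ->
  exists2 t, t < B ^ m & forall i, i < m -> (t %/ B ^ i) %% B = e i.
Proof.
elim: m e => [|m IH] e eB; first by exists 0.
have [t tB tE] := IH (fun i => e i.+1) (fun i => eB i.+1).
have e0 := eB 0 isT; exists (t * B + e 0) => [|[|i] im].
- by rewrite expnSr; nia.
- by rewrite divn1 modnMDl modn_small.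
by rewrite expnS divnMA divnMDl ?(leq_ltn_trans _ e0) // (divn_small e0) addn0 tE.
Qed.

Lemma digits_inj B m t t' : t < B ^ m -> t' < B ^ m ->
  (forall i, i < m -> (t %/ B ^ i) %% B = (t' %/ B ^ i) %% B) -> t = t'.
Proof.
elim: m t t' => [|m IH] t t'.
  by rewrite !expn0 !ltnS !leqn0 => /eqP-> /eqP->.
case: B IH => [|B] IH; first by rewrite exp0n.
rewrite !expnSr => tm tm' h; rewrite (divn_eq t B.+1) (divn_eq t' B.+1).
have := h 0 isT; rewrite !divn1 => ->; congr (_ * _ + _).
apply: IH; rewrite ?ltn_divLR // => i im.
by rewrite -!divnMA -!expnS; exact: h.
Qed.

Lemma class_count_filter (X : Type) (P : X -> Prop) (E : X -> X -> Prop)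
  (N : nat) (p : pred nat) (rho : nat -> X) :
  (forall j, j < N -> p j -> P (rho j)) ->
  (forall j k, j < N -> k < N -> p j -> p k -> E (rho j) (rho k) -> j = k) ->
  (forall x, P x -> exists j, [/\ j < N, p j & E x (rho j)]) ->
  class_count P E (count p (iota 0 N)).
Proof.
move=> h1 h2 h3; rewrite -size_filter; set s := filter _ _.
have sP j : j \in s = p j && (j < N) by rewrite mem_filter mem_iota.
have ms (i : 'I_(size s)) : p (nth 0 s i) && (nth 0 s i < N) by rewrite -sP mem_nth.
exists (fun i : 'I_(size s) => rho (nth 0 s i)); split=> [i|i j ij|x /h3[j [jN pj xj]]].
- by have /andP[pi iN] := ms i; exact: h1.
- have /andP[pi iN] := ms i; have /andP[pj jN] := ms j.
  apply: val_inj; apply/eqP; rewrite -(nth_uniq 0 (ltn_ord i) (ltn_ord j)).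
    by apply/eqP; exact: h2 ij.
  by rewrite filter_uniq // iota_uniq.
have js : j \in s by rewrite sP pj.
have ji : index j s < size s by rewrite index_mem.
by exists (Ordinal ji); rewrite /= nth_index.
Qed.

(** * Correctness of the tests on one system *)

Definition first_letter (S : lr_system) : letter S := enum_val (Ordinal (letter_gt0 S)).

Record coded (S : icfclr_system) (c b n T : nat) : Prop := Coded {
  coded_bounded : forall l r, rule_rel (S := S) l r -> size l <= n;
  coded_letters : #|letter S| < n;
  coded_table : forall j, j < size (rules S) ->
    let lr := nth ([::], [::]) (rules S) j in
    [/\ dig c b T (4 * j) = word_number lr.1, dig c b T (4 * j + 1) = size lr.1,
        dig c b T (4 * j + 2) = word_number lr.2 & dig c b T (4 * j + 3) = size lr.2]
}.

Section CodedSystem.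
Variables (S : icfclr_system) (c b n T : nat).
Local Notation q := #|letter S|.+1.
Local Notation J := (size (rules S)).
Local Notation K := (ball_radius n).
Local Notation R := (tuple_size n).
Local Notation L := (conjugator_length n).
Local Notation D := (word_length n).
Hypothesis cap_words : 2 ^ (n * (D + n)) <= c.
Hypothesis cap_tuples : R.+1 ^ R.+1 <= c.
Hypothesis SH : coded S c b n T.
Local Notation G := (presented_by S).
Local Notation elem := (element_of (first_letter S)).

Definition shrinking (l r : seq (letter S)) : rule_rel (S := S) l r -> size r < size l :=
  fun lr => @rules_reducing S (l, r) lr.

Local Notation nf := (@normal_form _ (@rule_rel S) shrinking (@system_inverse_closed S)).
Local Notation len := (glen nf).
Local Notation gen := (@letter_class _ (@rule_rel S) (@system_inverse_closed S)).

Lemma normal_form_geometry : [/\ forall g, word_value gen (nf g) = g,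
  forall w, size (nf (word_value gen w)) <= size w,
  forall w, size w = size (nf (word_value gen w)) -> w = nf (word_value gen w),
  forall a, exists a', gen a' = (gen a)^-1%g &
  forall g a, size (nf g) <= common_prefix (nf g) (nf (g * gen a)%g) + 2 * n].
Proof.
have [h1 h2 h3 h4 h5] := normal_form_spec shrinking (coded_bounded SH)
  (system_convergent S).2 (@system_inverse_closed S).
by split=> // g; rewrite word_valueE.
Qed.

Lemma coded_gt0 : 0 < n.
Proof. exact: leq_ltn_trans (coded_letters SH). Qed.

Lemma cap_letters : q ^ (D + n) <= c.
Proof.
apply: leq_trans cap_words; rewrite expnM leq_exp2r; last by have := coded_gt0; lia.
by apply: leq_trans (coded_letters SH) (ltnW (ltn_expl n _)).
Qed.

Lemma tuple_size_gt0 : 0 < R.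
Proof. by have := coded_gt0; rewrite /tuple_size /ball_radius; nia. Qed.

Lemma word_length_conjugator : L + K <= D.
Proof. by rewrite /word_length leq_add2l leq_pmulr // addn2. Qed.

Lemma word_length_tuple : K * R.+1 <= D.
Proof. by rewrite /word_length; nia. Qed.

Lemma word_length_gt : n < D.
Proof.
have := word_length_conjugator; rewrite /conjugator_length /ball_radius.
by have := coded_gt0; lia.
Qed.

Lemma power_letters e : e <= D + n -> powc c q e = q ^ e.
Proof.
move=> eD; apply: powcE => //; apply: leq_trans cap_letters.
by rewrite leq_exp2l // (letters_gt1 (first_letter S)).
Qed.

Lemma same_elementE x y : x < q ^ D -> y < q ^ D ->
  same_element c b D q J T x y <-> elem x = elem y.
Proof.
have D0 : 0 < D by apply: leq_ltn_trans word_length_gt.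
apply: (same_elementP (coded_bounded SH) (first_letter S) D0 cap_letters _ coded_gt0).
by move=> j jJ; exact: coded_table SH j jJ.
Qed.

Lemma number_exists m g : len g <= m -> exists x, x < q ^ m /\ elem x = g.
Proof.
move=> gm; exists (word_number (nf g)); split.
  apply: leq_trans (word_number_lt _) _.
  by rewrite leq_exp2l // (letters_gt1 (first_letter S)).
by rewrite element_of_word class_of_normal_form.
Qed.

Lemma len_elem m x : x < q ^ m -> len (elem x) <= m.
Proof.
move=> xm; rewrite /element_of -(number_word_fuel _ xm) -word_valueE.
apply: leq_trans (size_digits_word (first_letter S) m x).
by have [_ h _ _ _] := normal_form_geometry; exact: h.
Qed.

Definition coded_tuple (t : nat) : {ffun 'I_R -> G} := [ffun i => elem (dig c (q ^ K) t (val i))].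

Lemma dig_tuple t i : i <= R -> dig c (q ^ K) t i = (t %/ (q ^ K) ^ i) %% q ^ K.
Proof.
move=> iR; rewrite /dig powcE ?expn_gt0 // -expnM; apply: leq_trans cap_letters.
rewrite leq_exp2l ?(letters_gt1 (first_letter S)) //.
by have := word_length_tuple; nia.
Qed.

Lemma dig_tuple_lt t i : dig c (q ^ K) t i < q ^ K.
Proof. by rewrite ltn_pmod // expn_gt0. Qed.

Lemma coded_tuple_exists (s : {ffun 'I_R -> G}) : (forall i, len (s i) <= K) ->
  exists2 t, t < (q ^ K) ^ R & coded_tuple t = s.
Proof.
move=> sK; have [e eP] := choice (fun i => number_exists (sK i)).
pose e' k := if insub k is Some i then e i else 0.
have e'E (i : 'I_R) : e' i = e i by rewrite /e' valK.
have [|t tR tE] := @digits_exists (q ^ K) R e'.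
  by move=> i iR; rewrite -[i]/(val (Ordinal iR)) e'E; have [] := eP (Ordinal iR).
exists t => //; apply/ffunP => i; rewrite ffunE dig_tuple; last exact: ltnW (ltn_ord i).
by have [_ <-] := eP i; congr element_of; rewrite tE; [exact: e'E | exact: ltn_ord].
Qed.

Lemma len_coded_tuple t i : len (coded_tuple t i) <= K.
Proof. by rewrite ffunE; apply: len_elem; exact: dig_tuple_lt. Qed.

Definition first_index : 'I_R := Ordinal tuple_size_gt0.
Local Notation word m w := (digits_word first_index m w).

Lemma evaluate_spec t w m : m <= R.+1 ->
  evaluate c (q ^ K) R t w m < (q ^ K) ^ m /\
  elem (evaluate c (q ^ K) R t w m) = wval (coded_tuple t) (word m w).
Proof.
rewrite /evaluate; elim: m => [|m IH] mR /=.
  by rewrite min0n wval_nil.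
have [IH1 IH2] := IH (ltnW mR).
move: (capped_rec c m 0 _) IH1 IH2 => y ym yE.
have Qm : (q ^ K) ^ m.+1 <= c.
  apply: leq_trans cap_letters; rewrite -expnM leq_exp2l ?(letters_gt1 (first_letter S)) //.
  by have := word_length_tuple; nia.
have Qm' : powc c (q ^ K) m = (q ^ K) ^ m.
  rewrite powcE ?expn_gt0 //; apply: leq_trans Qm.
  by rewrite leq_pexp2l ?expn_gt0.
have dE : dig c R.+1 w m = (w %/ R.+1 ^ m) %% R.+1.
  by rewrite /dig powcE //; apply: leq_trans cap_tuples; rewrite leq_pexp2l // ltnW.
set z := tuple_entry _ _ _ _; have zQ : z < q ^ K.
  by rewrite /z /tuple_entry; case: ifP => _; rewrite ?expn_gt0 ?dig_tuple_lt.
have lt : y + z * powc c (q ^ K) m < (q ^ K) ^ m.+1.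
  rewrite Qm' expnS; apply: leq_trans (_ : z.+1 * (q ^ K) ^ m <= _).
    by rewrite mulSn ltn_add2r.
  by rewrite leq_mul2r zQ orbT.
rewrite (minn_idPl (ltnW (leq_trans lt Qm))); split=> //.
rewrite Qm' mulnC -expnM element_of_cat; last by rewrite expnM.
rewrite yE -/(word m.+1 w) digits_word_rcons wval_cat card_ord; congr (_ * _)%g.
rewrite /z /tuple_entry dE /digit_word; case: eqP => [_|/eqP d0].
  by rewrite wval_nil element_of0.
rewrite wval_seq1 ffunE /nth_letter /= nth_enum_ord //.
by have := ltn_pmod (w %/ R.+1 ^ m) (isT : 0 < R.+1); lia.
Qed.

Local Notation ev t w := (evaluate c (q ^ K) R t w R.+1).

Lemma evaluate_lt t w : ev t w < q ^ D.
Proof.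
have [h _] := evaluate_spec t w (leqnn _); apply: leq_trans h _.
by rewrite -expnM leq_exp2l ?(letters_gt1 (first_letter S)) // word_length_tuple.
Qed.

Lemma same_evaluation t w w' :
  same_element c b D q J T (ev t w) (ev t w') <->
  wval (coded_tuple t) (word R.+1 w) = wval (coded_tuple t) (word R.+1 w').
Proof.
rewrite same_elementE ?evaluate_lt //.
by have [_ ->] := evaluate_spec t w (leqnn _); have [_ ->] := evaluate_spec t w' (leqnn _).
Qed.

Lemma powcK : powc c q K = q ^ K.
Proof. by apply: power_letters; have := word_length_conjugator; lia. Qed.

Lemma powcR m : m <= R.+1 -> powc c R.+1 m = R.+1 ^ m.
Proof. by move=> mR; apply: powcE => //; apply: leq_trans cap_tuples; rewrite leq_pexp2l. Qed.

(* The numbers below (R + 1)^m represent the words of length at most m. *)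
Lemma word_codeP (m : nat) (P : seq 'I_R -> Prop) : m <= R.+1 ->
  (forall w, w < R.+1 ^ m -> P (word R.+1 w)) <-> (forall v, size v <= m -> P v).
Proof.
move=> mR; split=> h v vm.
  rewrite -(@digits_wordK _ first_index R.+1 v) ?(leq_trans vm) //; apply: h.
  apply: leq_trans (word_number_lt v) _; rewrite card_ord.
  by rewrite leq_exp2l // ltnS tuple_size_gt0.
apply: h; rewrite -(@digits_word_fuel _ first_index m) ?size_digits_word ?card_ord //.
by apply: leq_trans vm _; rewrite leq_exp2l // ltnS tuple_size_gt0.
Qed.

Lemma short_testP t :
  short_test c b D K R q J T t <-> short R (coded_tuple t).
Proof.
rewrite /short_test powcK !powcR //.
(* The existential is written as a negated universal because [word_codeP] translates universal
   statements. *)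
have allE : short R (coded_tuple t) <-> forall w, w < R.+1 ^ R.+1 -> ~ forall w', w' < R.+1 ^ R ->
    wval (coded_tuple t) (word R.+1 w) <> wval (coded_tuple t) (word R.+1 w').
  rewrite (word_codeP (fun v => ~ forall w', w' < R.+1 ^ R ->
    wval (coded_tuple t) v <> wval (coded_tuple t) (word R.+1 w')) (leqnn _)).
  split=> h v vR; first rewrite (word_codeP (fun v' => wval _ _ <> wval _ v') (leqnSn _)).
    by have [v' v'R E] := h v vR; move/(_ v' v'R).
  have := h v vR; rewrite (word_codeP (fun v' => wval _ _ <> wval _ v') (leqnSn _)) => H.
  by apply: contrapT => H'; apply: H => v' v'R E; apply: H'; exists v'.
rewrite allE; split=> [/allP h w wR|h].
  have /h/hasP[w' w'R /same_evaluation E] : w \in iota 0 (R.+1 ^ R.+1) by rewrite mem_iota.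
  by move/(_ w'); apply=> //; move: w'R; rewrite mem_iota.
apply/allP => w; rewrite mem_iota /= => /h H; apply/hasP; apply: contrapT => H'.
apply: H => w' w'R /same_evaluation E; apply: H'; exists w' => //.
by rewrite mem_iota.
Qed.

Lemma len_wval (s : {ffun 'I_R -> G}) v : (forall i, len (s i) <= K) ->
  len (wval s v) <= size v * K.
Proof.
have [h1 h2 _ _ _] := normal_form_geometry.
move=> sK; elim: v => [|i v IH]; first by rewrite wval_nil (glen1 h2).
by rewrite wval_cons /= mulSn (leq_trans (glenM h1 h2 _ _)) // leq_add.
Qed.

Lemma powcL : powc c q L = q ^ L.
Proof. by apply: power_letters; have := word_length_conjugator; lia. Qed.

Lemma conjugate_testP t t' : conjugate_test c b D K R L q J T t t' <->
  exists2 g, len g <= L & coded_tuple t' = conj_by g (coded_tuple t).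
Proof.
rewrite /conjugate_test powcK powcL.
have bound u v x y : x + y <= D -> u < q ^ x -> v < q ^ y -> u + v * q ^ x < q ^ D.
  move=> xy ux vy; apply: leq_trans (_ : v.+1 * q ^ x <= _).
    by rewrite mulSn ltn_add2r.
  apply: leq_trans (_ : q ^ y * q ^ x <= _); first by rewrite leq_mul2r vy orbT.
  by rewrite -expnD leq_exp2l ?(letters_gt1 (first_letter S)) // addnC.
have LK := word_length_conjugator.
have key g i : g < q ^ L -> same_element c b D q J T
    (g + dig c (q ^ K) t i * q ^ L) (dig c (q ^ K) t' i + g * q ^ K) <->
    (elem g * elem (dig c (q ^ K) t i) = elem (dig c (q ^ K) t' i) * elem g)%g.
  move=> gL; rewrite same_elementE; first last.
  - by apply: (bound _ _ K L) => //; rewrite ?dig_tuple_lt // addnC.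
  - by apply: (bound _ _ L K) => //; exact: dig_tuple_lt.
  by rewrite ![_ * q ^ _]mulnC !element_of_cat ?dig_tuple_lt.
split=> [/hasP[g]|[g gL E]].
  rewrite mem_iota /= => gL /allP h; exists (elem g); first exact: len_elem.
  apply/ffunP => i; rewrite !ffunE.
  have iR : val i \in iota 0 R by rewrite mem_iota /= ltn_ord.
  by have /(key g _ gL) -> := h _ iR; rewrite mulgK.
have [x [xL xg]] := number_exists gL.
apply/hasP; exists x; first by rewrite mem_iota.
apply/allP => i; rewrite mem_iota /= => iR; apply/key => //.
have := congr1 (fun s : {ffun 'I_R -> G} => s (Ordinal iR)) E.
by rewrite !ffunE /= xg => ->; rewrite mulgVK.
Qed.

(** A conjugator longer than the bound forces the generated group to be trivial, and then 1
    conjugates as well. *)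
Lemma conjugate_test_complete t t' : short R (coded_tuple t') ->
  conjugate (coded_tuple t) (coded_tuple t') -> conjugate_test c b D K R L q J T t t'.
Proof.
have [h1 h2 h3 h4 h5] := normal_form_geometry.
move=> sh [g E]; apply/conjugate_testP.
case: (leqP (len g) L) => [gL|gL]; first by exists g.
have trivial f : f \in generated R (coded_tuple t') -> f = 1%g.
  have short_word x : x \in generated R (coded_tuple t') ->
      exists2 v, size v <= R & x = wval (coded_tuple t') v.
    by move=> /generatedP[v ->]; have [w wR ->] := short_all v sh; exists w.
  apply: (conjugator_bound h1 h2 h3 h4 h5 (x := g) (K := R * K)).
  - by move=> x y; exact: generatedM.
  - move=> x /short_word[v vR ->]; apply: leq_trans (len_wval _ (len_coded_tuple t')) _.
    by rewrite leq_mul2r vR orbT.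
  - move=> x /short_word[v vR ->]; rewrite E wval_conj !mulgA mulVg mul1g mulgVK.
    apply: leq_trans (len_wval _ (len_coded_tuple t)) _.
    by rewrite leq_mul2r vR orbT.
  by apply: leq_trans (ltnW gL); rewrite /conjugator_length; lia.
have t'1 i : coded_tuple t' i = 1%g.
  by apply: trivial; rewrite -wval_seq1 mem_generated.
exists 1%g; first by rewrite (glen1 h2).
apply/ffunP => i; rewrite [RHS]ffunE mul1g invg1 mulg1 t'1.
have := t'1 i; rewrite E ffunE => /(congr1 (fun x => g^-1 * x * g)%g).
by rewrite mulg1 !mulgA mulVg mul1g mulgVK.
Qed.

(** A short tuple generates a finite group, so [bounded_centre] conjugates its entries into the
    ball. *)
Lemma coded_tuple_conjugate (s : {ffun 'I_R -> G}) : short R s ->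
  exists2 t, t < (q ^ K) ^ R & conjugate s (coded_tuple t).
Proof.
have [h1 h2 h3 h4 h5] := normal_form_geometry => sh.
have [||x xF] := bounded_centre h1 h2 h4 h5 (F := generated R s).
- by rewrite -(wval_nil s) mem_generated.
- by move=> f y /(generatedV sh) f' /(generatedM sh f').
have [|t tR tE] := @coded_tuple_exists (conj_by x^-1%g s).
  move=> i; rewrite ffunE invgK /ball_radius (_ : 8 * n = 4 * (2 * n)); last by lia.
  by apply: xF; rewrite -wval_seq1 mem_generated.
by exists t => //; exists x^-1%g.
Qed.

(** Conjugated into the ball, distinct elements have distinct codes below [q ^ K], which is at most
    [2 ^ (n * K)]. *)
Lemma finite_subgroup_bound (A : finGroupType) (f : A -> G) :
  {morph f : x y / (x * y)%g} -> injective f -> #|A| <= 2 ^ (n * K).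
Proof.
have [h1 h2 h3 h4 h5] := normal_form_geometry => fM fI.
have [||x xF] := bounded_centre h1 h2 h4 h5 (F := codom f).
- by rewrite -(morph_one fM) codom_f.
- by move=> _ _ /codomP[a ->] /codomP[a' ->]; rewrite -(morph_inv fM) -fM codom_f.
have lK a : len (x^-1 * f a * x)%g <= K.
  rewrite /ball_radius (_ : 8 * n = 4 * (2 * n)); last by lia.
  by apply: xF; exact: codom_f.
have [e eP] := choice (fun a => number_exists (lK a)).
have eI : injective (fun a => Ordinal (eP a).1).
  move=> a a' /(congr1 val) /= ee; apply: fI.
  have [_ ea] := eP a; have [_] := eP a'; rewrite -ee ea => /mulIg /mulgI.
  by [].
have := leq_card _ eI; rewrite card_ord => h; apply: leq_trans h _.
rewrite expnM leq_exp2r; last by rewrite /ball_radius addn1.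
by apply: leq_trans (coded_letters SH) (ltnW (ltn_expl n _)).
Qed.

End CodedSystem.

(** * Homomorphisms to the group of order two *)

Section HomCount.
Variables (S : icfclr_system) (c b n T : nat).
Local Notation q := #|letter S|.+1.
Local Notation J := (size (rules S)).
Local Notation D := (word_length n).
Hypothesis cap_words : 2 ^ (n * (D + n)) <= c.
Hypothesis cap_tuples : (tuple_size n).+1 ^ (tuple_size n).+1 <= c.
Hypothesis SH : coded S c b n T.
Local Notation G := (presented_by S).
Local Notation Z2 := (Algebra.to_multiplicative 'Z_2).
Local Notation pcls := (@pcls _ _ (inverse_closed_right_invertible (@system_inverse_closed S))).

Definition bit (f : nat) (a : letter S) : nat := (f %/ 2 ^ enum_rank a) %% 2.

Definition sign (f : nat) (a : letter S) : Z2 := ((bit f a)%:R : 'Z_2)%R.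

Lemma sign_prod f (w : seq (letter S)) :
  (\prod_(a <- w) sign f a)%g = ((\sum_(a <- w) bit f a)%:R : 'Z_2)%R :> Z2.
Proof.
elim: w => [|a w IH]; first by rewrite !big_nil.
by rewrite !big_cons IH GRing.natrD.
Qed.

Lemma val_mod2 (m : nat) : val (m%:R : 'Z_2)%R = m %% 2.
Proof. exact: val_Zp_nat. Qed.

Lemma sign_prod_eq f u v : (\prod_(a <- u) sign f a = \prod_(a <- v) sign f a)%g <->
  (\sum_(a <- u) bit f a) %% 2 = (\sum_(a <- v) bit f a) %% 2.
Proof.
rewrite !sign_prod; split=> [/(congr1 (fun x : 'Z_2 => val x))|E].
  by rewrite !val_mod2.
by apply: (@val_inj _ _ 'Z_2); rewrite !val_mod2.
Qed.

(** The accumulator is at most [D], which is below [c], so the cap never acts. *)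
Lemma parityE f w : size w <= D -> parity c D q f (word_number w) = (\sum_(a <- w) bit f a) %% 2.
Proof.
have n0 := coded_gt0 SH; have q1 := letters_gt1 (first_letter S).
have Dc : D < c.
  apply: leq_trans (ltn_expl D (isT : 1 < 2)) (leq_trans _ cap_words).
  by rewrite leq_exp2l //; nia.
move=> wD; rewrite -{2}(digits_wordK (first_letter S) wD) /parity.
move: (word_number w) => x {w wD}; congr (_ %% 2).
suff H m : m <= D -> capped_rec c m 0 (fun k y => y +
    (if dig c q x k == 0 then 0 else dig c 2 f (dig c q x k).-1)) =
    \sum_(a <- digits_word (first_letter S) m x) bit f a /\
    \sum_(a <- digits_word (first_letter S) m x) bit f a <= m.
  by have [] := H D (leqnn _).
elim: m => [|m IH] mD; first by rewrite /= min0n big_nil.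
have [IH1 IH2] := IH (ltnW mD).
rewrite [capped_rec _ _ _ _]/= IH1 digits_word_rcons big_cat /=.
have dE : dig c q x m = (x %/ q ^ m) %% q.
  by rewrite /dig (power_letters cap_words cap_tuples SH) //; lia.
have -> : (if dig c q x m == 0 then 0 else dig c 2 f (dig c q x m).-1) =
    \sum_(a <- digit_word (first_letter S) ((x %/ q ^ m) %% q)) bit f a.
  rewrite dE /digit_word; case: eqP => [_|/eqP d0]; first by rewrite big_nil.
  set d := _ %% _ in d0 *; have dq : d.-1 < #|letter S|.
    by have := ltn_pmod (x %/ q ^ m) (isT : 0 < q); rewrite -/d; lia.
  rewrite big_seq1 /bit.
  have -> : enum_rank (nth_letter (first_letter S) d.-1) = Ordinal dq.
    rewrite /nth_letter; have -> : nth (first_letter S) (enum (letter S)) d.-1 = enum_val (Ordinal dq).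
      exact: (esym (@enum_val_nth _ _ _ (Ordinal dq))).
    exact: enum_valK.
  rewrite /dig powcE //=; apply: leq_trans cap_words; rewrite leq_exp2l //.
  by have := coded_letters SH; nia.
have b1 : \sum_(a <- digit_word (first_letter S) ((x %/ q ^ m) %% q)) bit f a <= 1.
  rewrite /digit_word; case: eqP => _; rewrite ?big_nil // big_seq1.
  by rewrite -ltnS ltn_pmod.
split; last by rewrite -[m.+1]addn1 leq_add.
apply/minn_idPl; apply: leq_trans (leq_add IH2 b1) _.
by rewrite addn1; apply: leq_trans mD (ltnW Dc).
Qed.

Lemma parity_rulesP f :
  all (fun j => parity c D q f (rule_field c b J T j 0) ==
                parity c D q f (rule_field c b J T j 2)) (iota 0 J) <->
  forall l r, rule_rel (S := S) l r ->
    (\prod_(a <- l) sign f a = \prod_(a <- r) sign f a)%g.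
Proof.
have fieldE j : j < J -> let lr := nth ([::], [::]) (rules S) j in
    (parity c D q f (rule_field c b J T j 0) == parity c D q f (rule_field c b J T j 2)) <->
    (\prod_(a <- lr.1) sign f a = \prod_(a <- lr.2) sign f a)%g.
  move=> jJ lr; have lrS : rule_rel (S := S) lr.1 lr.2.
    by rewrite /rule_rel -surjective_pairing mem_nth.
  have lD := leq_trans (coded_bounded SH lrS) (ltnW (word_length_gt cap_words cap_tuples SH)).
  have rD := leq_trans (ltnW (shrinking lrS)) lD.
  have [E1 _ E2 _] := coded_table SH jJ.
  rewrite /rule_field jJ addn0 E1 E2 !parityE // sign_prod_eq.
  by split=> [/eqP|->].
split=> [/allP h l r lr|h].
  have jJ : index (l, r) (rules S) < J by rewrite index_mem.
  have := (fieldE _ jJ).1 (h _ _); rewrite mem_iota nth_index //=.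
  by apply.
by apply/allP => j; rewrite mem_iota /= => jJ; apply/fieldE => //; apply: h;
  rewrite /rule_rel -surjective_pairing mem_nth.
Qed.

Lemma hom_numberP : hom_count G (hom_number c b D q J T).
Proof.
have two : powc c 2 q.-1 = 2 ^ q.-1.
  apply: powcE => //; apply: leq_trans cap_words; rewrite leq_exp2l //=.
  apply: leq_trans (ltnW (coded_letters SH)) _.
  by rewrite leq_pmulr // ltn_addl // (coded_gt0 SH).
rewrite /hom_number two /=.
pose hom f : G -> Z2 := presented_lift (sign f).
apply: (@class_count_filter (G -> Z2) _ _ _ _ hom) => [f _|f g fN gN|h hM].
- by move=> /parity_rulesP fP; exact: presented_liftM.
- move=> /parity_rulesP fP /parity_rulesP gP fg; apply: (digits_inj fN gN) => i iq.
  have := fg (pcls [:: enum_val (Ordinal iq)]).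
  rewrite /hom !presented_lift_class // !big_seq1 /sign /bit enum_valK /=.
  by move=> /(congr1 (fun x : 'Z_2 => val x)); rewrite !val_mod2 !modn_mod.
pose e i := val (h (pcls [:: nth_letter (first_letter S) i]) : 'Z_2).
have [|f fN fE] := @digits_exists 2 #|letter S| e; first by move=> i _; exact: ltn_ord.
have sE a : sign f a = h (pcls [:: a]).
  apply: (@val_inj _ _ 'Z_2); rewrite val_mod2 /bit fE; last exact: ltn_ord.
  by rewrite /e nth_letter_rank modn_small //; exact: ltn_ord.
have vE w : (\prod_(a <- w) sign f a)%g = h (pcls w).
  by rewrite pcls_prod (morph_prod hM); apply: eq_bigr.
have rP : forall l r, rule_rel (S := S) l r ->
    (\prod_(a <- l) sign f a = \prod_(a <- r) sign f a)%g.
  move=> l r lr; rewrite !vE; congr h; apply/pclsP; apply: rst_step.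
  by have := RewriteStep [::] [::] lr; rewrite !cat0s !cats0.
exists f; split=> //; first by apply/parity_rulesP.
apply: (morph_ext hM); first exact: presented_liftM.
by move=> a; rewrite /hom presented_lift_class // big_seq1 sE.
Qed.

End HomCount.

(** * Comparison of two systems *)

Section TwoSystems.
Variables (c b n : nat).
Local Notation letters S := #|letter S|.+1.
Local Notation K := (ball_radius n).
Local Notation R := (tuple_size n).
Local Notation L := (conjugator_length n).
Local Notation D := (word_length n).
Hypothesis cap_words : 2 ^ (n * (D + n)) <= c.
Hypothesis cap_tuples : R.+1 ^ R.+1 <= c.

Section Counting.
Variables (S S' : icfclr_system) (T T' : nat).
Hypotheses (SH : coded S c b n T) (SH' : coded S' c b n T').
Local Notation G := (presented_by S).
Local Notation G' := (presented_by S').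
Local Notation q := (letters S).
Local Notation q' := (letters S').
Local Notation J := (size (rules S)).
Local Notation J' := (size (rules S')).
Local Notation tup := (coded_tuple S c n).
Local Notation tup' := (coded_tuple S' c n).

Lemma alike_testP t t' : alike_test c b D K R q J T t q' J' T' t' <->
  alike R (tup t) (tup' t').
Proof.
rewrite /alike_test (powcK cap_words cap_tuples SH) (powcK cap_words cap_tuples SH') (powcR cap_tuples) //.
have iE : first_index cap_words cap_tuples SH' = first_index cap_words cap_tuples SH by apply: val_inj.
have wordP := word_codeP cap_words cap_tuples SH.
have allE : alike R (tup t) (tup' t') <-> forall w, w < R.+1 ^ R.+1 ->
    forall w', w' < R.+1 ^ R.+1 ->
    (wval (tup t) (digits_word (first_index cap_words cap_tuples SH) R.+1 w) =
     wval (tup t) (digits_word (first_index cap_words cap_tuples SH) R.+1 w') <->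
     wval (tup' t') (digits_word (first_index cap_words cap_tuples SH) R.+1 w) =
     wval (tup' t') (digits_word (first_index cap_words cap_tuples SH) R.+1 w')).
  rewrite (wordP _ (fun v => forall w', w' < R.+1 ^ R.+1 -> (wval (tup t) v = _ <->
    wval (tup' t') v = _)) (leqnn _)).
  split=> h v.
    move=> vR; rewrite (wordP _ (fun v' => (wval _ _ = wval _ v' <->
      wval _ _ = wval _ v')) (leqnn _)).
    by move=> v' v'R; exact: h.
  move=> v' vR; have := h v vR; rewrite (wordP _ (fun v' => (wval _ _ = wval _ v' <->
      wval _ _ = wval _ v')) (leqnn _)).
  exact.
have eqbP (x y : bool) : (x == y) <-> (x <-> y).
  by case: x y => [] []; split=> // [[h1 h2]]; [have := h1 isT | have := h2 isT].
rewrite allE; split=> [/allP h w wR w' w'R|h].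
  have /h/allP/(_ w') : w \in iota 0 (R.+1 ^ R.+1) by rewrite mem_iota.
  rewrite mem_iota => /(_ w'R)/eqbP.
  rewrite (same_evaluation cap_words cap_tuples SH) (same_evaluation cap_words cap_tuples SH').
  by rewrite iE.
apply/allP => w; rewrite mem_iota /= => wR; apply/allP => w'; rewrite mem_iota /= => w'R.
apply/eqbP; rewrite (same_evaluation cap_words cap_tuples SH) (same_evaluation cap_words cap_tuples SH').
by rewrite iE; exact: h.
Qed.

(** Tuples of the type of a short tuple are short, so each class has a coded member and conjugacy of
    codes is decided by bounded conjugators. *)
Lemma class_numberP t : short R (tup t) ->
  class_count (fun s : {ffun 'I_R -> G'} => same_type (tup t) s) (@conjugate R G')
    (class_number c b D K R L q J T t q' J' T').
Proof.
move=> sh; rewrite /class_number (powcK cap_words cap_tuples SH').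
have -> : powc c (letters S' ^ K) R = (letters S' ^ K) ^ R.
  rewrite powcE ?expn_gt0 // -expnM; apply: leq_trans _ (cap_letters cap_words cap_tuples SH').
  rewrite leq_exp2l ?(letters_gt1 (first_letter S')) //.
  by have := word_length_tuple cap_words cap_tuples; nia.
have same s : alike R (tup t) s <-> same_type (tup t) s.
  by split=> [|ts]; [exact: short_alike | exact: same_type_alike].
apply: (@class_count_filter _ _ _ _ _ tup') => [t' _ /andP[/alike_testP/same]//|t1 t2|s ts].
  move=> _ _ /andP[/alike_testP/same s1 n1] /andP[/alike_testP/same s2 n2] c12.
  have half u v : same_type (tup t) (tup' u) -> same_type (tup t) (tup' v) ->
      conjugate (tup' u) (tup' v) -> u < v ->
      has (fun t'' => conjugate_test c b D K R L q' J' T' t'' v) (iota 0 v).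
    move=> su sv uv lt; apply/hasP; exists u; first by rewrite mem_iota.
    by apply: (conjugate_test_complete cap_words cap_tuples SH') => //; exact: same_type_short sv sh.
  case: (ltngtP t1 t2) => // lt; first by rewrite (half t1) in n2.
  by rewrite (half t2) // in n1; exact: conjugate_sym.
have [t0 t0N st0] := coded_tuple_conjugate cap_words cap_tuples SH' (same_type_short ts sh).
have ex : exists u, `[< u < (q' ^ K) ^ R /\ conjugate s (tup' u) >].
  by exists t0; apply/asboolP.
case: (ex_minnP ex) => u /asboolP[uN su] umin.
exists u; split=> //; apply/andP; split.
  by apply/alike_testP/same; exact: same_type_conj su ts.
apply/hasP => -[v]; rewrite mem_iota /= => vu.
move=> /(conjugate_testP cap_words cap_tuples SH')[g _ E].
suff : u <= v by rewrite leqNgt vu.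
apply: umin; apply/asboolP; split; first exact: ltn_trans uN.
by apply: conjugate_trans su (conjugate_sym _); exists g.
Qed.

End Counting.

(** The counts depend only on the type of the reference tuple, and every short tuple has the type of
    a coded one, so testing coded tuples covers all. *)
Lemma classes_testP (S S' S1 : icfclr_system) (T T' T1 : nat) :
  coded S c b n T -> coded S' c b n T' -> coded S1 c b n T1 ->
  classes_test c b D K R L (letters S1) (size (rules S1)) T1
    (letters S) (size (rules S)) T (letters S') (size (rules S')) T' <->
  forall t : {ffun 'I_R -> presented_by S1}, short R t -> forall e e',
  class_count (fun s : {ffun 'I_R -> presented_by S} => same_type t s)
    (@conjugate R _) e ->
  class_count (fun s : {ffun 'I_R -> presented_by S'} => same_type t s)
    (@conjugate R _) e' -> e = e'.
Proof.
move=> SH SH' SH1; rewrite /classes_test (powcK cap_words cap_tuples SH1).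
have -> : powc c (letters S1 ^ K) R = (letters S1 ^ K) ^ R.
  rewrite powcE ?expn_gt0 // -expnM; apply: leq_trans _ (cap_letters cap_words cap_tuples SH1).
  rewrite leq_exp2l ?(letters_gt1 (first_letter S1)) //.
  by have := word_length_tuple cap_words cap_tuples; nia.
split=> [/allP h s ss e e' se se'|h]; last first.
  apply/allP => t _; apply/implyP => /(short_testP cap_words cap_tuples SH1) sh.
  by apply/eqP/(h _ sh); [exact: class_numberP SH1 SH _ sh | exact: class_numberP SH1 SH' _ sh].
have [t tN st] := coded_tuple_conjugate cap_words cap_tuples SH1 ss.
have tt := same_type_conj st (same_type_refl s).
have sh := same_type_short tt ss.
have /h/implyP/(_ ((short_testP cap_words cap_tuples SH1 t).2 sh))/eqP E :
  t \in iota 0 ((letters S1 ^ K) ^ R) by rewrite mem_iota.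
have unique (H : groupType) k k' : class_count (fun s' : {ffun 'I_R -> H} => same_type s s')
    (@conjugate R H) k -> class_count (fun s' : {ffun 'I_R -> H} => same_type s s')
    (@conjugate R H) k' -> k = k'.
  apply: (@class_count_iso R _ H H s k k').
  by exact: isomorphic_refl.
have c1 := class_count_same_type (same_type_sym tt) (class_numberP SH1 SH sh).
have c2 := class_count_same_type (same_type_sym tt) (class_numberP SH1 SH' sh).
by rewrite (unique _ _ _ se c1) (unique _ _ _ se' c2) E.
Qed.

(** Plainness bounds the problem: the finite factors embed in the groups, hence have order at most
    [2 ^ (n * K)] and short generating tuples of the size examined. *)
Lemma isomorphism_test_correct (S S' : icfclr_system) (T T' : nat) :
  b = powc c 2 (n * n) -> coded S c b n T -> coded S' c b n T' ->
  plain (presented_by S) -> plain (presented_by S') ->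
  isomorphism_test c n (letters S) (size (rules S)) T (letters S') (size (rules S')) T' <->
  isomorphic (presented_by S) (presented_by S').
Proof.
move=> bE SH SH' [k [m [H GP]]] [k' [m' [H' GP']]].
rewrite /isomorphism_test -bE.
have h := hom_numberP cap_words cap_tuples SH.
have h' := hom_numberP cap_words cap_tuples SH'.
have bound (S0 : icfclr_system) T0 k0 m0 (H0 : 'I_k0 -> finGroupType) i :
    coded S0 c b n T0 ->
    isomorphic (presented_by S0) (free_product (@plain_factor k0 m0 H0)) ->
    #|H0 i| <= 2 ^ (n * K).
  move=> SH0 /isomorphic_sym/isomorphicP[f [fM /bij_inj fI]].
  apply: (finite_subgroup_bound cap_words cap_tuples SH0
    (f := fun x => f (@fp_in _ (@plain_factor k0 m0 H0) (inl i) x))).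
    by move=> x y; rewrite (@fp_inM _ (@plain_factor k0 m0 H0) (inl i)) fM.
  by move=> x y /fI/(@fp_in_inj _ (@plain_factor k0 m0 H0) (inl i)).
split=> [/and3P[/eqP hE t1 t2]|iso].
  apply: (plain_isomorphic GP GP' (r := n * K)).
  - by move=> i; exact: bound SH GP.
  - by move=> i; exact: bound SH' GP'.
  - by apply/(classes_testP SH SH' SH).
  - by apply/(classes_testP SH SH' SH').
  move=> e e' he he'.
  rewrite (hom_count_iso (isomorphic_refl _) he h) hE.
  exact: (hom_count_iso (isomorphic_refl _) h' he').
apply/and3P; split.
- by apply/eqP; exact: hom_count_iso iso h h'.
- by apply/(classes_testP SH SH' SH) => t _ e e'; exact: class_count_iso.
- by apply/(classes_testP SH SH' SH') => t _ e e'; exact: class_count_iso.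
Qed.

End TwoSystems.

(** * Reading the input *)

Lemma token_valueE t :
  token_value t = match t with Tick => 0 | EndNumber => 1 | EndWord => 2 | EndSystem => 3 end.
Proof. by case: t; rewrite /token_value /= inordK. Qed.

Lemma tokens_value_digit w i : i < size w ->
  (tokens_value w %/ 4 ^ (size w - i.+1)) %% 4 = token_value (nth Tick w i).
Proof.
elim/last_ind: w i => // w t IH i; rewrite size_rcons ltnS => iw.
rewrite /tokens_value foldl_rcons -/(tokens_value w) subSS nth_rcons.
have t4 : token_value t < 4 by rewrite token_valueE; case: t.
case: (ltngtP i (size w)) iw => // [lt _|-> _].
  rewrite -(IH i lt); have -> : size w - i = (size w - i.+1).+1 by lia.
  by rewrite expnS divnMA mulnC divnMDl // [token_value t %/ 4]divn_small // addn0.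
by rewrite subnn divn1 mulnC modnMDl modn_small.
Qed.

Definition rule_digits (X : finType) (rs : seq (seq X * seq X)) : seq nat :=
  flatten [seq [:: word_number lr.1; size lr.1; word_number lr.2; size lr.2] | lr <- rs].

Lemma size_rule_digits (X : finType) (rs : seq (seq X * seq X)) : size (rule_digits rs) = 4 * size rs.
Proof. by elim: rs => //= lr rs IH; rewrite IH mulnS. Qed.

Lemma nth_rule_digits (X : finType) (rs : seq (seq X * seq X)) j f : j < size rs -> f < 4 ->
  let lr := nth ([::], [::]) rs j in
  nth 0 (rule_digits rs) (4 * j + f) =
  nth 0 [:: word_number lr.1; size lr.1; word_number lr.2; size lr.2] f.
Proof.
elim: rs j => [|lr rs IH] [|j] // jr f4; first by case: f f4 {IH} => [|[|[|[|]]]].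
have -> : 4 * j.+1 + f = (4 * j + f).+4 by lia.
exact: IH.
Qed.

Section Parser.
Variables (c b target : nat).
Hypothesis b1 : 1 < b.
Hypothesis target_c : target < c.

Definition read_next (s : seq nat) (t : token) : seq nat :=
  mkseq (fun k => minn (read_token c b target (token_value t) k (nth 0 s)) c) 8.

Lemma read_nextE s t r : all (leq^~ c) r -> size r = 8 ->
  (forall k, k < 8 -> read_token c b target (token_value t) k (nth 0 s) = nth 0 r k) ->
  read_next s t = r.
Proof.
move=> rc r8 h; rewrite /read_next -[RHS](mkseq_nth 0) r8; apply/eq_in_map => k.
rewrite mem_iota /= => k8; rewrite h //; apply/minn_idPl.
by apply: (allP rc); rewrite mem_nth ?r8.
Qed.

Ltac field_cases := do 8 (case; first by []); by [].

(* The eight fields of the state, in the order of [read_token]. *)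
Definition state (h cur w wl q T F : nat) : seq nat := [:: target; h; cur; w; wl; q; T; F].

Lemma read_ticks h cur w wl q T F m : all (leq^~ c) (state h (cur + m) w wl q T F) ->
  foldl read_next (state h cur w wl q T F) (nseq m Tick) = state h (cur + m) w wl q T F.
Proof.
elim: m cur => [|m IH] cur; first by rewrite addn0.
rewrite addnS -addSn => fits /=; rewrite -(IH cur.+1) //; congr foldl.
apply: read_nextE => //.
  by move: fits; rewrite /= => /and5P[-> -> h1 -> h2]; rewrite h2 (leq_trans _ h1) ?leq_addr.
by rewrite /read_token token_valueE /= eqxx; field_cases.
Qed.

(** The input is read once for each system; outside its target a reader reacts only to
    [EndSystem]. *)
Lemma read_inactive s0 s u : s0 != target -> size s = 7 -> all (leq^~ c) (s0 :: s) ->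
  EndSystem \notin u -> foldl read_next (s0 :: s) u = s0 :: s.
Proof.
move=> s0t s7 sc; elim: u => // t u IH; rewrite inE negb_or => /andP[tE uE] /=.
rewrite -{2}(IH uE); congr foldl; apply: read_nextE => //; first by rewrite /= s7.
move=> k _; rewrite /read_token /= (negbTE s0t) token_valueE.
by case: t tE => //; rewrite eqxx.
Qed.

Lemma read_end_inactive s0 s : s0 != target -> size s = 7 -> all (leq^~ c) (s0.+1 :: s) ->
  read_next (s0 :: s) EndSystem = s0.+1 :: s.
Proof.
move=> s0t s7 sc; apply: read_nextE => //=; first by rewrite s7.
move=> k _; rewrite /read_token /= (negbTE s0t) token_valueE /=.
by case: k.
Qed.

Section Words.
Variable X : finType.
Variable a0 : X.
Local Notation q := #|X|.+1.

Lemma read_letters (u : seq X) w wl T F : w < q ^ wl -> q ^ (wl + size u) <= c ->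
  T <= c -> F <= c ->
  foldl read_next (state 1 0 w wl q T F) (flatten [seq encode_number (enum_rank a) | a <- u]) =
  state 1 0 (w + q ^ wl * word_number u) (wl + size u) q T F.
Proof.
have q1 := letters_gt1 a0.
elim: u w wl => [|a u IH] w wl wq uc Tc Fc; first by rewrite /= !muln0 !addn0.
have uc' : q ^ wl.+1 <= c.
  by apply: leq_trans uc; rewrite leq_exp2l //= addnS ltnS leq_addr.
have qc : q <= c by apply: leq_trans uc'; rewrite -{1}(expn1 q) leq_exp2l.
have wlc : wl.+1 <= c by apply: leq_trans (ltnW (ltn_expl _ q1)) uc'.
have aq : (enum_rank a).+1 < q by rewrite ltnS; exact: ltn_ord.
have lt : w + (enum_rank a).+1 * q ^ wl < q ^ wl.+1.
  rewrite expnS; apply: leq_trans (_ : (enum_rank a).+2 * q ^ wl <= _).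
    by rewrite [X in _ <= X]mulSn ltn_add2r.
  by rewrite leq_mul2r aq orbT.
have wc : w <= c.
  by apply: leq_trans (ltnW wq) (leq_trans _ uc'); rewrite leq_exp2l.
rewrite [flatten _]/= foldl_cat foldl_rcons read_ticks; last first.
  rewrite /= add0n (ltnW target_c) wc Tc Fc qc (ltnW wlc) (leq_trans (ltnW (ltnW aq)) qc).
  by rewrite (leq_trans _ wlc).
rewrite add0n (@read_nextE _ _ (state 1 0 (w + (enum_rank a).+1 * q ^ wl) wl.+1 q T F)) //.
- rewrite IH //; last by rewrite addSnnS.
  by rewrite /= addSnnS expnS mulnDr; congr (state _ _ _ _ _ _ _); nia.
- rewrite /= (ltnW target_c) wlc qc Tc Fc (leq_trans (ltnW lt) uc') !andbT.
  exact: leq_trans wlc.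
rewrite /read_token token_valueE /= eqxx powcE //; first by field_cases.
by apply: leq_trans uc'; rewrite leq_exp2l.
Qed.

Lemma read_word (u : seq X) ds : q <= c -> q ^ size u <= c -> b ^ (size ds + 2) <= c ->
  all (leq^~ b.-1) ds -> word_number u < b -> size u < b ->
  foldl read_next (state 1 0 0 0 q (pack b.-1 ds) (size ds)) (encode_word u) =
  state 1 0 0 0 q (pack b.-1 (ds ++ [:: word_number u; size u])) (size ds + 2).
Proof.
move=> qc uc bc dsb ub sb; have q1 := letters_gt1 a0.
have bE : b.-1.+1 = b by rewrite prednK // ltnW.
have ds' : all (leq^~ b.-1) (ds ++ [:: word_number u; size u]).
  have small x : x < b -> x <= b.-1 by rewrite -[x <= _]ltnS bE.
  by rewrite all_cat dsb /= !small.
have lt := pack_lt ds'; rewrite bE size_cat /= in lt.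
have lt0 := pack_lt dsb; rewrite bE in lt0.
have szc : size ds + 2 <= c by apply: leq_trans (ltnW (ltn_expl _ b1)) bc.
have c2 : 1 < c by apply: leq_trans szc; rewrite addn2.
have dsc : size ds <= c by apply: leq_trans szc; rewrite leq_addr.
have Tc : pack b.-1 ds <= c.
  by apply: leq_trans (ltnW lt0) (leq_trans _ bc); rewrite leq_exp2l // leq_addr.
have pE : pack b.-1 (ds ++ [:: word_number u; size u]) =
    pack b.-1 ds + word_number u * b ^ size ds + size u * b ^ (size ds).+1.
  rewrite expnS; elim: (ds) => [|d ds1 IH] /=; first by rewrite bE; nia.
  by rewrite IH bE expnS; nia.
rewrite foldl_rcons read_letters ?expn0 //= !add0n mul1n.
have wc : word_number u <= c by apply: leq_trans (ltnW (word_number_lt u)) uc.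
have sc : size u <= c by apply: leq_trans (ltnW (ltn_expl _ q1)) uc.
apply: read_nextE => //.
  rewrite /= (ltnW target_c) (ltnW c2) qc szc /= andbT.
  exact: leq_trans (ltnW lt) bc.
rewrite /read_token token_valueE /= eqxx !powcE ?(ltnW b1) //.
- by rewrite pE addn2; field_cases.
- by apply: leq_trans bc; rewrite leq_exp2l // addn2.
by apply: leq_trans bc; rewrite leq_exp2l // leq_addr.
Qed.

Definition readable (u : seq X) : bool :=
  [&& q ^ size u <= c, word_number u < b & size u < b].

Lemma read_rules rs ds : q <= c -> b ^ (size ds + 4 * size rs) <= c ->
  all (leq^~ b.-1) ds -> (forall lr, lr \in rs -> readable lr.1 && readable lr.2) ->
  foldl read_next (state 1 0 0 0 q (pack b.-1 ds) (size ds))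
    (flatten [seq encode_word lr.1 ++ encode_word lr.2 | lr <- rs]) =
  state 1 0 0 0 q (pack b.-1 (ds ++ rule_digits rs)) (size (ds ++ rule_digits rs)).
Proof.
move=> qc; have bE : b.-1.+1 = b by rewrite prednK // ltnW.
elim: rs ds => [|lr rs IH] ds bc dsb ok; first by rewrite /= cats0.
have /andP[/and3P[h1 h2 h3] /and3P[h4 h5 h6]] := ok lr (mem_head _ _).
rewrite [flatten _]/= !foldl_cat read_word //; last first.
  by apply: leq_trans bc; rewrite leq_exp2l // leq_add2l /=; lia.
have small x : x < b -> x <= b.-1 by rewrite -[x <= _]ltnS bE.
rewrite (_ : size ds + 2 = size (ds ++ [:: word_number lr.1; size lr.1])); last first.
  by rewrite size_cat.
rewrite read_word //; first last.
- by rewrite all_cat dsb /= !small.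
- by apply: leq_trans bc; rewrite leq_exp2l // size_cat /=; lia.
rewrite -[in X in state _ _ _ _ _ _ X](@size_cat _ _ [:: word_number lr.2; size lr.2]).
rewrite IH.
- by rewrite /= -!catA.
- by apply: leq_trans bc; rewrite leq_exp2l // !size_cat /=; lia.
- by rewrite !all_cat dsb /= !small.
by move=> lr' h; apply: ok; rewrite inE h orbT.
Qed.

End Words.

Lemma read_system (S : lr_system) (a0 : letter S) :
  #|letter S|.+1 <= c -> b ^ (4 * size (rules S)) <= c ->
  (forall lr, lr \in rules S -> readable lr.1 && readable lr.2) ->
  foldl read_next (state 0 0 0 0 0 0 0) (encode_system S) =
  [:: target.+1; 1; 0; 0; 0; #|letter S|.+1;
      pack b.-1 (rule_digits (rules S)); 4 * size (rules S)].
Proof.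
move=> qc bc ok; have bE : b.-1.+1 = b by rewrite prednK // ltnW.
have c0 : 0 < c by apply: leq_trans qc.
rewrite /encode_system foldl_cat !foldl_rcons read_ticks; last first.
  by rewrite /= (ltnW target_c) add0n (ltnW qc).
have -> : read_next (state 0 (0 + #|letter S|) 0 0 0 0 0) EndNumber =
    state 1 0 0 0 #|letter S|.+1 0 0.
  apply: read_nextE => //; first by rewrite /= (ltnW target_c) qc c0.
  by rewrite /read_token token_valueE /= eqxx; field_cases.
have rsb : all (leq^~ b.-1) (rule_digits (rules S)).
  apply/allP => x /flattenP[s /mapP[lr lrS ->]] xs.
  have /andP[/and3P[_ h2 h3] /and3P[_ h5 h6]] := ok lr lrS.
  by move: xs; rewrite !inE -[x <= _]ltnS bE => /or4P[] /eqP->.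
have := read_rules (rs := rules S) a0 (ds := [::]) qc bc isT ok.
rewrite /= => ->; rewrite size_rule_digits.
have lt := pack_lt rsb; rewrite bE size_rule_digits in lt.
apply: read_nextE => //.
  rewrite /= target_c c0 qc (leq_trans (ltnW lt) bc) /= andbT.
  exact: leq_trans (ltnW (ltn_expl _ b1)) bc.
by rewrite /read_token token_valueE /= eqxx; field_cases.
Qed.

End Parser.

Lemma encode_number_system_free m : EndSystem \notin encode_number m.
Proof.
have ne t : t != EndSystem -> (EndSystem == t) = false by rewrite eq_sym => /negbTE.
rewrite mem_rcons inE mem_nseq !ne ?andbF //;
  by rewrite -(inj_eq (can_inj token_codeK)) -val_eqE /= !inordK.
Qed.

Lemma encode_word_system_free (X : finType) (u : seq X) : EndSystem \notin encode_word u.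
Proof.
rewrite mem_rcons inE negb_or; apply/andP; split.
  by rewrite -(inj_eq (can_inj token_codeK)) -val_eqE /= !inordK.
apply/flattenP => -[s /mapP[a _ ->]].
exact/negP/encode_number_system_free.
Qed.

Lemma encode_systemE (S : lr_system) :
  exists2 u, encode_system S = rcons u EndSystem & EndSystem \notin u.
Proof.
exists (encode_number #|letter S| ++
  flatten [seq encode_word lr.1 ++ encode_word lr.2 | lr <- rules S]).
  by rewrite rcons_cat.
rewrite mem_cat negb_or encode_number_system_free /=.
apply/flattenP => -[s /mapP[lr _ ->]]; rewrite mem_cat.
by rewrite !(negbTE (encode_word_system_free _)).
Qed.

(** * Correctness and space bound *)

Lemma size_encode_word (X : finType) (u : seq X) : size u < size (encode_word u).
Proof.
rewrite size_rcons ltnS; elim: u => //= a u IH.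
by rewrite size_cat size_rcons addSn ltnS (leq_trans IH) // leq_addl.
Qed.

Lemma size_encode_system (S : lr_system) :
  [/\ #|letter S| < size (encode_system S), 2 * size (rules S) <= size (encode_system S) &
      forall lr, lr \in rules S -> size lr.1 + size lr.2 < size (encode_system S)].
Proof.
rewrite /encode_system size_cat size_rcons size_rcons size_nseq.
set f := flatten _; have fE : 2 * size (rules S) <= size f /\
    forall lr, lr \in rules S -> size lr.1 + size lr.2 <= size f.
  rewrite /f; elim: (rules S) => //= lr rs [IH1 IH2]; rewrite !size_cat.
  have h1 := size_encode_word lr.1; have h2 := size_encode_word lr.2.
  split; first by lia.
  move=> lr'; rewrite inE => /orP[/eqP->|/IH2 h]; first by lia.
  by apply: leq_trans h _; rewrite leq_addl.
case: fE => f1 f2; split; [by lia | by lia |] => lr /f2 h.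
by move: h; lia.
Qed.

Lemma size_encode_system_le (S : lr_system) :
  size (encode_system S) <= (system_size S + 2) ^ 2.
Proof.
rewrite /encode_system /system_size size_cat !size_rcons size_nseq.
set s := \sum_(lr <- _) _; set f := flatten _.
have word (u : seq (letter S)) : size (encode_word u) <= size u * #|letter S| + 1.
  rewrite size_rcons addn1 ltnS; elim: u => //= a u IH.
  rewrite size_cat size_rcons size_nseq mulSn.
  exact: leq_add (ltn_ord (enum_rank a)) IH.
(* A left-hand side is nonempty, so each rule contributes at least 1 to [s]; this pays for its two
   markers [EndWord]. *)
have fE : size f <= s * #|letter S| + 2 * s.
  rewrite /f /s; have := @rules_reducing S; elim: (rules S) => [|lr rs IH] red.
    by rewrite big_nil.
  rewrite big_cons /= size_cat size_cat.
  have {}IH := IH (fun lr' h => red lr' (mem_behead (s := lr :: rs) h)).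
  have h1 := word lr.1; have h2 := word lr.2; have := red lr (mem_head _ _).
  by rewrite !size_cat; move: (size _) (size _) (size _) (size _) (size _) h1 h2 IH;
    move: (bigop _ _ _) #|letter S|; nia.
by rewrite expnS expn1; nia.
Qed.

Section Reading.
Variables (c n : nat).
Local Notation b := (powc c 2 (n * n)).
Hypothesis cap_table : 2 ^ (2 * (n * (n * n))) <= c.
Hypothesis n1 : 1 < n.

Lemma bE : b = 2 ^ (n * n).
Proof.
apply: powcE => //; apply: leq_trans cap_table; rewrite leq_exp2l //.
by nia.
Qed.

Lemma b_gt1 : 1 < b.
Proof. by rewrite bE -{1}(expn0 2) ltn_exp2l //; nia. Qed.

(** A table has four entries per rule, and the encoding has at least two tokens per rule. *)
Lemma b_table m : 2 * m <= n -> b ^ (4 * m) <= c.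
Proof.
move=> mn; apply: leq_trans cap_table; rewrite bE -expnM leq_exp2l //.
by nia.
Qed.

(** At most [n] digits in a base of at most [2 ^ n] explain the table base [2 ^ (n * n)]. *)
Lemma readable_word (X : finType) (u : seq X) : #|X| < n -> size u <= n -> readable c b u.
Proof.
move=> Xn un; have qb : #|X|.+1 ^ size u < b.
  rewrite bE; case: (size u) un => [|k] un.
    by rewrite expn0 -{1}(expn0 2) ltn_exp2l //; nia.
  apply: (@leq_trans ((2 ^ n) ^ k.+1)); last by rewrite -expnM leq_exp2l //; nia.
  by rewrite ltn_exp2r //; apply: leq_ltn_trans Xn (ltn_expl _ _).
have bc : b <= c.
  by have := @b_table 1 n1; apply: leq_trans; rewrite -{1}(expn1 b) leq_exp2l // b_gt1.
rewrite /readable (leq_trans (ltnW qb) bc) (ltn_trans (word_number_lt u) qb) /=.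
rewrite bE; apply: leq_ltn_trans un (ltn_trans (ltn_expl n (isT : 1 < 2)) _).
by rewrite ltn_exp2l //; nia.
Qed.

Lemma readable_rules (S : lr_system) : size (encode_system S) <= n ->
  forall lr, lr \in rules S -> readable c b lr.1 && readable c b lr.2.
Proof.
have [h1 _ h3] := size_encode_system S; move=> Sn lr /h3/ltnW h.
have Xn := leq_trans h1 Sn; have {}h := leq_trans h Sn.
by rewrite !readable_word // (leq_trans _ h) ?leq_addr ?leq_addl.
Qed.

Lemma coded_rules (S : icfclr_system) : size (encode_system S) <= n ->
  coded S c b n (pack b.-1 (rule_digits (rules S))).
Proof.
have [h1 h2 h3] := size_encode_system S; move=> Sn.
have bE' : b.-1.+1 = b by rewrite prednK // ltnW // b_gt1.
have ok := readable_rules Sn.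
split=> [l r lr||j jJ lr].
- by apply: leq_trans Sn; apply: leq_trans (ltnW (h3 _ lr)); exact: leq_addr.
- exact: leq_trans Sn.
have rsb : all (leq^~ b.-1) (rule_digits (rules S)).
  apply/allP => x /flattenP[s /mapP[lr' lrS ->]] xs.
  have /andP[/and3P[_ r2 r3] /and3P[_ r5 r6]] := ok lr' lrS.
  by move: xs; rewrite !inE -[x <= _]ltnS bE' => /or4P[] /eqP->.
have digE f : f < 4 -> dig c b (pack b.-1 (rule_digits (rules S))) (4 * j + f) =
    nth 0 [:: word_number lr.1; size lr.1; word_number lr.2; size lr.2] f.
  move=> f4; rewrite -(nth_rule_digits jJ f4) -(pack_nth _ rsb) bE' /dig.
  rewrite (powcE (ltnW b_gt1)) //; apply: leq_trans (b_table (leq_trans h2 Sn)).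
  by rewrite leq_exp2l ?b_gt1 //; move: jJ f4; lia.
by split; rewrite ?digE // -[4 * j]addn0 digE.
Qed.

Lemma read_fieldE w target j : size w = n -> 
  read_field c (tokens_value w) n target j = nth 0 (foldl (read_next c b target) (nseq 8 0) w) j.
Proof.
move=> wn; rewrite /read_field; congr (nth 0 _ j).
suff H m : m <= n -> capped_fold 8 c (fun _ => 0) (fun k i st =>
    read_token c b target (input_token c (tokens_value w) n i) k st) m =
    foldl (read_next c b target) (nseq 8 0) (take m w).
  by rewrite H // -wn take_size.
elim: m => [|m IH] mn; first by rewrite take0 /= /mkseq /= !min0n.
rewrite [LHS]/= (IH (ltnW mn)) (take_nth Tick) ?wn // foldl_rcons /read_next.
apply: eq_mkseq => k; congr (minn (read_token _ _ _ _ _ _) _).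
rewrite /input_token /dig powcE //; first by rewrite -wn tokens_value_digit // wn.
apply: leq_trans cap_table; rewrite (_ : 4 = 2 ^ 2) // -expnM leq_exp2l //.
by have := leq_subr m.+1 n; nia.
Qed.

Lemma read_systems (S S' : icfclr_system) (w := encode_system S ++ encode_system S') :
  size w = n ->
  foldl (read_next c b 0) (nseq 8 0) w =
    [:: 2; 1; 0; 0; 0; #|letter S|.+1; pack b.-1 (rule_digits (rules S)); 4 * size (rules S)] /\
  foldl (read_next c b 1) (nseq 8 0) w =
    [:: 2; 1; 0; 0; 0; #|letter S'|.+1; pack b.-1 (rule_digits (rules S')); 4 * size (rules S')].
Proof.
rewrite /w size_cat => wn; have b1 := b_gt1.
have [h1 h2 h3] := size_encode_system S; have [h1' h2' h3'] := size_encode_system S'.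
have nc : n < c.
  by apply: leq_trans (ltn_expl n (isT : 1 < 2)) (leq_trans _ cap_table); rewrite leq_exp2l //; nia.
have ok := @readable_rules S (ltac:(lia)).
have ok' := @readable_rules S' (ltac:(lia)).
have bc : b ^ (4 * size (rules S)) <= c by apply: b_table; lia.
have bc' : b ^ (4 * size (rules S')) <= c by apply: b_table; lia.
rewrite !(foldl_cat _ _ (encode_system S)); split.
  have E0 := @read_system c b 0 b1 (ltac:(lia)) S (first_letter S) (ltac:(lia)) bc ok.
  rewrite -[nseq 8 0]/(state 0 0 0 0 0 0 0 0).
  rewrite E0; have [u -> uE] := encode_systemE S'.
  move: (pack _ _) (4 * _) E0 => T F E0.
  have fits : all (leq^~ c) [:: 1; 1; 0; 0; 0; #|letter S|.+1; T; F].
    have [v vE _] := encode_systemE S; rewrite -E0 vE foldl_rcons.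
    by apply/allP => x /mapP[k _ ->]; exact: geq_minr.
  rewrite foldl_rcons read_inactive //; apply: read_end_inactive => //.
  by move: fits => /= /andP[_ ->]; rewrite (leq_trans _ nc) // ltnW.
have [u -> uE] := encode_systemE S.
have E := @read_inactive c b 1 0 (nseq 7 0) u isT erefl; rewrite foldl_rcons E //.
have E' := @read_end_inactive c b 1 0 (nseq 7 0) isT erefl; rewrite E'; last by rewrite /=; lia.
exact: @read_system c b 1 b1 (ltac:(lia)) S' (first_letter S') (ltac:(lia)) bc' ok'.
Qed.

End Reading.

(** Origin of the exponent 20: in powers of [m = n + 2] a sum costs one factor and a small constant
    two. The word length gets exponent 14, and the largest one reached is 16. *)
Lemma caps n (c := 2 ^ (n + 2) ^ 20) : 1 < n ->
  [/\ 2 ^ (n * (word_length n + n)) <= c, (tuple_size n).+1 ^ (tuple_size n).+1 <= c &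
      2 ^ (2 * (n * (n * n))) <= c].
Proof.
move=> n1; pose m := n + 2; have m4 : 3 < m by rewrite /m; lia.
have pM a i b j : a <= m ^ i -> b <= m ^ j -> a * b <= m ^ (i + j).
  by rewrite expnD; exact: leq_mul.
have pD a b i : a <= m ^ i -> b <= m ^ i -> a + b <= m ^ i.+1.
  move=> ha hb; rewrite expnS; apply: leq_trans (leq_add ha hb) _.
  by rewrite addnn -mul2n leq_mul2r; apply/orP; right; lia.
have pW a i j : a <= m ^ i -> i <= j -> a <= m ^ j.
  by move=> ha ij; apply: leq_trans ha _; rewrite leq_pexp2l //; lia.
have p0 i : 0 < m ^ i by rewrite expn_gt0; lia.
have small k i : k <= 16 -> k <= m ^ i.+2.
  move=> k16; apply: leq_trans k16 (pW _ 2 _ _ _); last by [].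
  by rewrite -[16]/(4 * 4) (pM 4 1 4 1) // expn1.
have nm : n <= m ^ 1 by rewrite expn1 /m leq_addr.
have K4 : ball_radius n <= m ^ 4.
  by apply: (pD); [exact: (pM 8 2 n 1 (small 8 0 isT) nm) | exact: (p0 3)].
have nK := pM _ _ _ _ nm K4.
have R6 : tuple_size n <= m ^ 6 by exact: (pD).
have L13 : conjugator_length n <= m ^ 13.
  apply: (pD); first exact: (pM 5 2 _ 10 (small 5 0 isT) (pM _ _ _ _ R6 K4)).
  by apply: pW (pM 4 2 n 1 (small 4 0 isT) nm) _.
have D14 : word_length n <= m ^ 14.
  apply: (pD) => //; apply: pW (pM _ _ _ _ K4 (pD _ _ 6 R6 (small 2 4 isT))) _.
  by [].
rewrite /c -/m {c}; split.
- rewrite leq_exp2l //; apply: pW (pM _ _ _ _ nm (pD _ _ 14 D14 (pW _ _ 14 nm isT))) _.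
  by [].
- have R7 : (tuple_size n).+1 <= m ^ 7 by rewrite -addn1; exact: (pD).
  apply: (@leq_trans ((2 ^ (tuple_size n).+1) ^ (tuple_size n).+1)).
    by rewrite leq_exp2r // ltnW // ltn_expl.
  by rewrite -expnM leq_exp2l //; apply: pW (pM _ _ _ _ R7 R7) _.
rewrite leq_exp2l //; apply: pW (pM 2 2 _ _ (small 2 0 isT) (pM _ _ _ _ nm (pM _ _ _ _ nm nm))) _.
by [].
Qed.

Lemma decision_correct (S S' : icfclr_system) (w := encode_system S ++ encode_system S') :
  plain (presented_by S) -> plain (presented_by S') ->
  decision (tokens_value w) (size w) (2 ^ (size w + 2) ^ 20) <->
  isomorphic (presented_by S) (presented_by S').
Proof.
move=> pS pS'; set n := size w; set c := 2 ^ _.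
have [h1 _ _] := size_encode_system S; have [h1' _ _] := size_encode_system S'.
have [Sn S'n] : size (encode_system S) <= n /\ size (encode_system S') <= n.
  by rewrite /n /w size_cat leq_addr leq_addl.
have n1 : 1 < n.
  rewrite /n /w size_cat; apply: (@leq_add 1 1).
    exact: leq_ltn_trans h1.
  exact: leq_ltn_trans h1'.
have [cap1 cap2 cap3] := caps n1.
have [E E'] := @read_systems c n cap3 n1 S S' erefl.
rewrite /decision !(read_fieldE cap3) // -/w E E' /= !mulKn //.
exact: isomorphism_test_correct cap1 cap2 _ _ _ _ (erefl _)
  (coded_rules cap3 n1 Sn) (coded_rules cap3 n1 S'n) pS pS'.
Qed.

Lemma decides_in_space_weaken (A : finType) (M : turing_machine A) w P s s' :
  s <= s' -> decides_in_space M w P s -> decides_in_space M w P s'.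
Proof. by move=> ss' [h1 h2]; split=> // k; exact: leq_trans (h2 k) ss'. Qed.

Lemma horner_nat_exp (p : {poly nat}) (d x : nat) : ((p ^+ d).[x])%R = (p.[x])%R ^ d.
Proof.
elim: d => [|d IH]; first by rewrite GRing.expr0 hornerC.
by rewrite GRing.exprS hornerM IH expnS.
Qed.

Theorem theoremD :
  exists (M : turing_machine token) (p : {poly nat}),
    forall S S' : icfclr_system,
      plain (presented_by S) -> plain (presented_by S') ->
      decides_in_space M (encode_system S ++ encode_system S')
        (isomorphic (presented_by S) (presented_by S'))
        (p.[maxn (system_size S) (system_size S')])%R.
Proof.
have [e eE] := computable_decision.
have [K KP] := decider_correct e (isT : 2 <= 20).
(* The bound [K * (n + 2) ^ 20] of the decider, where the length [n] of the two encodings is at most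
   twice [(X + 2) ^ 2]. *)
exists (decider e 20), (K%:P * (2%N%:P * ('X + 2%N%:P) ^+ 2 + 2%N%:P) ^+ 20)%R.
move=> S S' pS pS'; set s := maxn _ _.
rewrite hornerM hornerC horner_nat_exp hornerD hornerM !hornerC horner_nat_exp.
rewrite hornerD hornerX hornerC.
apply: decides_in_space_weaken (KP _ _ _); last first.
  by rewrite eE /env3 lt0b; exact: decision_correct.
rewrite leq_mul2l; apply/orP; right; rewrite leq_exp2r // leq_add2r size_cat.
rewrite -[X in _ <= X]/(2 * (s + 2) ^ 2) mul2n -addnn.
have bound (S0 : lr_system) : system_size S0 <= s -> size (encode_system S0) <= (s + 2) ^ 2.
  move=> h; apply: leq_trans (size_encode_system_le S0) _.
  by rewrite leq_exp2r // leq_add2r.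
by apply: leq_add; apply: bound; rewrite ?leq_maxl ?leq_maxr.
Qed.
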